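(* Let $D\in\mathbb N$, let $\mathbb T^\infty=\prod_{k=1}^D\mathbb T^{M_k}$ with $M_k\in\mathbb N\cup\{\infty\}$ be a representation of the infinite-dimensional torus as a product of $D$ tori, given by a partition $\mathbb N=J_1\sqcup\dots\sqcup J_D$ of the set of coordinates with $|J_k|=M_k$, and let $f\in L(\ln^+L)^{D-1}(\mathbb T^\infty)$. Then the Fejér means of $f$ converge to $f$ $D$-regularly (with respect to this representation), in the enhanced sense, almost everywhere on $\mathbb T^\infty$. That is, for almost every $x\in\mathbb T^\infty$ there are finite numbers $\sigma_p(x)$, $p\in\mathbb N$, such that for every $p\in\mathbb N$ and every constant $C\ge1$ $$\sigma_{p,N_1,\dots,N_p}(x)\to\sigma_p(x)$$ as $\min(N_1,\dots,N_p)\to\infty$ subject to the restriction that $N_i\le C N_j$ whenever $i,j\in\{1,\dots,p\}$ belong to the same set $J_k$; and $\lim_{p\to\infty}\sigma_p(x)=f(x)$.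
   Context: Let $\mathbb T=\mathbb R/\mathbb Z$ with Lebesgue measure normalized to total mass $1$. The infinite-dimensional torus $\mathbb T^\infty$ is the product of countably many copies of $\mathbb T$, with points $x=(x_1,x_2,\dots)$, equipped with the product of the normalized Lebesgue measures (equivalently, its normalized Haar measure); ''almost everywhere'' and $L^1(\mathbb T^\infty)$ refer to this measure. For a measure space $(X,\mu)$ and an integer $r\ge0$, $L(\ln^+L)^r(X)$ is the space of measurable complex-valued functions $f$ with $\int_X|f(x)|\,\ln^r(|f(x)|+1)\,d\mu(x)<\infty$; for $r=0$ this is $L^1(X)$. For an integer $l\ge 0$, $D_l(t)=\sum_{j=-l}^{l}e^{2\pi i jt}$ is the one-dimensional Dirichlet kernel and $K_l(t)=\frac1{l+1}\sum_{r=0}^{l}D_r(t)$ is the one-dimensional Fejér kernel. For $f\in L^1(\mathbb T^\infty)$, $p\in\mathbb N$ and nonnegative integers $N_1,\dots,N_p$, the Fejér mean of $f$ is $$\sigma_{p,N_1,\dots,N_p}(x)=\int_{\mathbb T^\infty}\prod_{j=1}^pK_{N_j}(x_j-t_j)\,f(t)\,dt .$$ A finite family of indices grows regularly if all of them tend to infinity while their pairwise ratios stay bounded by some constant $C$. The index grows $D$-regularly if, for each $k\in\{1,\dots,D\}$, the part of the index with coordinates in $J_k$ grows regularly (no restriction is imposed between coordinates in different sets $J_k$). Convergence ''in the enhanced sense'' means that for each fixed $p$ the $p$-dimensional means converge (here $D$-regularly), and that the resulting limits converge as $p\to\infty$. *)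

(* Defs.v *)
From HB Require Import structures.
From mathcomp Require Import all_boot all_order all_algebra.
From mathcomp Require Import archimedean ring_quotient complex.
From mathcomp Require Import all_classical all_reals all_analysis.
From mathcomp Require Import measurable_realfun lra ring.
Set Implicit Arguments.
Unset Strict Implicit.
Unset Printing Implicit Defensive.
Import Order.TTheory GRing.Theory Num.Theory.
Import numFieldNormedType.Exports.
Import Normc.
Local Open Scope classical_set_scope.
Local Open Scope complex_scope.
Local Open Scope ring_scope.

(* Complex values live in R[i]^o: the regular module is what gives R[i] its
   usual topology, through the numFieldType instances. *)

Section complex_functions.
Context d (X : measurableType d) (R : realType).

Definition complex_measurable (f : X -> R[i]^o) :=
  measurable_fun setT (fun x => complex.Re (f x)) /\
  measurable_fun setT (fun x => complex.Im (f x)).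

Definition complex_integral (mu : {measure set X -> \bar R})
    (f : X -> R[i]^o) : R[i]^o :=
  (\int[mu]_x complex.Re (f x)) +i* (\int[mu]_x complex.Im (f x)).

Definition LlogL (mu : {measure set X -> \bar R}) (r : nat)
    (f : X -> R[i]^o) :=
  complex_measurable f /\
  (\int[mu]_x (normc (f x) * ln (normc (f x) + 1) ^+ r)%:E < +oo)%E.

End complex_functions.

(* T = R/Z as a quotient additive group. *)
Definition circle (R : realType) : Type :=
  Quotient.quot (GRing.ZmodClosed.clone R (@Num.int_num_subdef R) _).

HB.instance Definition _ (R : realType) := GRing.Zmodule.on (circle R).
HB.instance Definition _ (R : realType) :=
  isPointed.Build (circle R) (0 : circle R).

Definition to_circle (R : realType) (t : R) : circle R := (\pi_(circle R) t)%qT.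

(* The Borel sets of R/Z: the sets whose preimage in R is Borel. *)
Definition circle_measurable (R : realType) : set (set (circle R)) :=
  image_set_system setT (@to_circle R) measurable.

Lemma circle_sigma_algebra (R : realType) :
  sigma_algebra setT (@circle_measurable R).
Proof. exact/sigma_algebra_image/sigma_algebra_measurable. Qed.

Lemma circle_measurable0 (R : realType) : @circle_measurable R set0.
Proof. by have [] := circle_sigma_algebra R. Qed.

Lemma circle_measurableC (R : realType) (A : set (circle R)) :
  circle_measurable A -> circle_measurable (~` A).
Proof. by rewrite -setTD; have [_ + _] := circle_sigma_algebra R; apply. Qed.

Lemma circle_measurable_bigcup (R : realType) (F : (set (circle R))^nat) :
  (forall i, circle_measurable (F i)) -> circle_measurable (\bigcup_i F i).
Proof. by have [_ _] := circle_sigma_algebra R; apply. Qed.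

HB.instance Definition _ (R : realType) := @isMeasurable.Build
  default_measure_display (circle R) (@circle_measurable R) (@circle_measurable0 R)
  (@circle_measurableC R) (@circle_measurable_bigcup R).

(* Normalized Lebesgue measure: [0, 1[ is a fundamental domain for R/Z. *)
Definition circle_measure (R : realType) (A : set (circle R)) : \bar R :=
  lebesgue_measure (`[0, 1[ `&` @to_circle R @^-1` A).

(* The infinite-dimensional torus with the product sigma-algebra; the
   coordinate x_j is x j.-1. *)
Definition torus (R : realType) :=
  @g_sigma_algebraType (nat -> circle R)
    (\bigcup_i preimage_set_system setT
       (fun x : nat -> circle R => x i) measurable).

HB.instance Definition _ (R : realType) := Measurable.on (torus R).

(* mu is the product of the normalized Lebesgue measures on the factors: its
   values on cylinders determine it; product_measure_exists below shows that
   there is one. *)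
Definition is_product_measure (R : realType)
    (mu : {measure set (torus R) -> \bar R}) :=
  forall (n : nat) (A : nat -> set (circle R)),
    (forall i, measurable (A i)) ->
    mu [set x | forall i, (i < n)%N -> A i (x i)] =
    (\prod_(i < n) circle_measure (A i))%E.

Section product_measure_existence.
Variable R : realType.
Local Notation RT := (measurableTypeR R).

Let mI01 : measurable (`[0%R, 1%R[%classic : set RT).
Proof. exact: measurable_itv. Qed.
Let U : {measure set RT -> \bar R} := mrestr (@lebesgue_measure R) mI01.

Let rays_unique (m1 m2 : {measure set RT -> \bar R}) :
    (forall a : R, m1 `]-oo, a[%classic = m2 `]-oo, a[%classic) ->
    (forall a : R, (m1 `]-oo, a[%classic < +oo)%E) ->
  forall A, measurable A -> m1 A = m2 A.
Proof.
move=> m12 moo A mA.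
have /(_ _ _ _ _ m1 m2) H := @measure_unique _ R RT
  (@RGenInftyO.G R) (fun n => `]-oo, n%:R[%classic).
apply: H => //.
- exact: RGenInftyO.measurableE.
- move=> _ _ [x ->] [y ->]; exists (Num.min x y).
  by apply/seteqP; split => z /=; rewrite !in_itv/= lt_min => /andP.
- by move=> n; exists n%:R.
- rewrite -subTset => x _; exists (Num.bound x) => //=.
  by rewrite in_itv/= unstable.ltr_bound.
- by move=> _ [x ->].
Qed.

Let clip (a : R) : R := Num.max 0 (Num.min a 1).

Let leb_co (x y : R) :
  lebesgue_measure (`[x, y[%classic : set RT) = (Num.max 0 (y - x))%:E.
Proof.
rewrite lebesgue_measure_itv/= lte_fin; case: ifPn => xy.
  by rewrite max_r// subr_ge0 ltW.
by rewrite max_l// subr_le0 leNgt.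
Qed.

Let U_ray a : U `]-oo, a[%classic = (clip a)%:E.
Proof.
rewrite /U/= /mrestr.
have -> : `]-oo, a[ `&` `[0, 1[ = `[0, Num.min a 1[%classic.
  apply/seteqP; split => z /=; rewrite !in_itv/= lt_min.
    by move=> [-> /andP[-> ->]].
  by move=> /and3P[-> -> ->].
by rewrite leb_co subr0.
Qed.

Let UT : U setT = 1%E.
Proof. by rewrite /U/= /mrestr setTI leb_co subr0 max_r. Qed.

Let U_le1 A : measurable A -> (U A <= 1)%E.
Proof. by move=> mA; rewrite -UT le_measure// inE. Qed.

Let T : RT -> RT := fun u : R => if u < 1 / 2 then 2 * u else 2 * u - 1.
Let b : RT -> RT := fun u : R => if u < 1 / 2 then 0 else 1.

Let mb : measurable_fun [set: RT] b.
Proof.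
apply: measurable_fun_ifT => //; exact: measurable_fun_ltr.
Qed.

Let mT : measurable_fun [set: RT] T.
Proof.
have m2 : measurable_fun setT (fun u : RT => 2 * u : RT).
  exact: mulrl_measurable.
apply: measurable_fun_ifT => //; first exact: measurable_fun_ltr.
have H := (measurable_funB m2 (@measurable_cst _ _ RT RT setT (1 : R))).
exact: H.
Qed.

Let mpre (f : RT -> RT) (A : set RT) :
  measurable_fun setT f -> measurable A -> measurable (f @^-1` A).
Proof. by move=> mf mA; rewrite -[_ @^-1` _]setTI; exact: mf. Qed.

Let lo : set RT := `]-oo, 1 / 2[%classic.
Let hi : set RT := `[1 / 2, +oo[%classic.
Let mlo : measurable lo. Proof. exact: measurable_itv. Qed.
Let mhi : measurable hi. Proof. exact: measurable_itv. Qed.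

Let half_ge0 : 0 <= 2^-1 :> R. Proof. by []. Qed.

Let U_lo (E : set RT) : measurable E -> U (lo `&` T @^-1` E) = ((2^-1)%:E * U E)%E.
Proof.
move=> mE; rewrite setIC.
pose m1 : {measure set RT -> \bar R} := pushforward (mrestr U mlo) T.
pose m2 : {measure set RT -> \bar R} := mscale (NngNum half_ge0) U.
have H := @rays_unique (m1 mT) m2; apply: H => // a.
  rewrite /m2/= /mscale/= -/U U_ray -EFinM /m1/= /pushforward/= /mrestr.
  have -> : T @^-1` `]-oo, a[ `&` lo `&` `[0, 1[ =
      `[0, Num.min (a / 2) (1 / 2)[%classic.
    apply/seteqP; split => z /=; rewrite /lo/= !in_itv/= lt_min /T.
      by move=> -[[+ zlo] /andP[-> _]]; rewrite zlo => za; lra.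
    by move=> /and3P[z0 za zlo]; rewrite zlo z0; split; [split|]; lra.
  rewrite leb_co /clip; congr EFin.
  by rewrite /Order.max /Order.min; case: (ltP a 1) => ?;
    case: (ltP (a / 2) (1 / 2)) => ?; do ![case: ltP => ?]; lra.
rewrite (@le_lt_trans _ _ 1%E) ?ltry//; apply: U_le1.
by apply: measurableI => //; exact: mpre.
Qed.

Let U_hi (E : set RT) : measurable E -> U (hi `&` T @^-1` E) = ((2^-1)%:E * U E)%E.
Proof.
move=> mE; rewrite setIC.
pose m1 : {measure set RT -> \bar R} := pushforward (mrestr U mhi) T.
pose m2 : {measure set RT -> \bar R} := mscale (NngNum half_ge0) U.
have H := @rays_unique (m1 mT) m2; apply: H => // a.
  rewrite /m2/= /mscale/= -/U U_ray -EFinM /m1/= /pushforward/= /mrestr.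
  have -> : T @^-1` `]-oo, a[ `&` hi `&` `[0, 1[ =
      `[1 / 2, Num.min ((a + 1) / 2) 1[%classic.
    apply/seteqP; split => z /=; rewrite /hi/= !in_itv/= lt_min andbT /T.
      by move=> -[[+ zhi] /andP[z0 z1]]; rewrite [z < _]ltNge zhi/= => za; lra.
    by move=> /and3P[zhi za z1]; rewrite [z < _]ltNge zhi/=; split; [split|]; lra.
  rewrite leb_co /clip; congr EFin.
  by rewrite /Order.max /Order.min; case: (ltP a 1) => ?;
    case: (ltP ((a + 1) / 2) 1) => ?; do ![case: ltP => ?]; lra.
rewrite (@le_lt_trans _ _ 1%E) ?ltry//; apply: U_le1.
by apply: measurableI => //; exact: mpre.
Qed.


(* T is the doubling map and b the leading binary digit; phi and psi collect the
   even and the odd binary digits, so that (phi, psi) maps the uniform measure U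
   on [0, 1[ to U x U.  Iterating psi gives independent uniform coordinates
   X j := phi (psi^j). *)
Fixpoint even_digits (n : nat) (u : RT) : R :=
  if n is m.+1 then (b u + even_digits m (T (T u))) / 2 else 0.

Let b01 u : 0 <= b u <= 1. Proof. by rewrite /b; case: ifP => _; lra. Qed.

Let b_lo (u : R) : u < 1 / 2 -> b u = 0. Proof. by rewrite /b => ->. Qed.
Let b_hi (u : R) : 1 / 2 <= u -> b u = 1.
Proof. by rewrite leNgt /b => /negbTE ->. Qed.

Let even_digits01 n u : 0 <= even_digits n u <= 1.
Proof.
elim: n u => [|n IH] u /=; first lra.
by have /andP[? ?] := b01 u; have /andP[? ?] := IH (T (T u)); lra.
Qed.

Let even_digits_nd u : nondecreasing_seq (even_digits ^~ u).
Proof.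
apply/nondecreasing_seqP => n; elim: n u => [|n IH] u.
  by have /andP[] := even_digits01 1 u.
change ((b u + even_digits n (T (T u))) / 2 <= (b u + even_digits n.+1 (T (T u))) / 2).
by rewrite ler_pM2r ?invr_gt0// lerD2l; exact: IH.
Qed.

Let phi (u : RT) : RT := limn (even_digits ^~ u).

Let even_digits_cvg u : even_digits ^~ u @ \oo --> (phi u : R).
Proof.
apply: nondecreasing_is_cvgn => //; exists 1 => _ [n _ <-].
by have /andP[] := even_digits01 n u.
Qed.

Let phi01 u : 0 <= phi u <= 1.
Proof.
apply/andP; split; [apply: limr_ge|apply: limr_le];
  try exact: (cvgP _ (@even_digits_cvg u)).
  by apply: nearW => n; have /andP[] := even_digits01 n u.
by apply: nearW => n; have /andP[] := even_digits01 n u.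
Qed.

Let phiE (u : RT) : phi u = (b u + phi (T (T u))) / 2 :> R.
Proof.
rewrite {1}/phi; apply/cvg_lim => //.
rewrite -(cvg_shiftS (even_digits ^~ u)) /=.
by apply: cvgMl; apply: cvgD; [exact: cvg_cst|exact: even_digits_cvg].
Qed.

Let mphi : measurable_fun [set: RT] phi.
Proof.
apply: (@measurable_fun_cvg _ _ _ _ even_digits) => [n|u _]; last exact: even_digits_cvg.
elim: n => [|n IH]; first exact: measurable_cst.
apply: measurable_funM; last exact: measurable_cst.
apply: measurable_funD; first exact: mb.
exact: (measurableT_comp IH (measurableT_comp mT mT)).
Qed.

Let psi : RT -> RT := phi \o T.

Let mpsi : measurable_fun [set: RT] psi.
Proof. exact: measurableT_comp. Qed.

Let S (x y : R) : set RT := [set u | (phi u < x) && (psi u < y)].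

Let mS x y : measurable (S x y).
Proof.
have -> : S x y = phi @^-1` `]-oo, x[ `&` psi @^-1` `]-oo, y[.
  by apply/seteqP; split => u; rewrite /S/= !in_itv/= => /andP.
by apply: measurableI; apply: mpre => //; exact: measurable_itv.
Qed.

Let F x y : R := fine (U (S x y)).

Let U_fin A : measurable A -> U A \is a fin_num.
Proof.
by move=> mA; rewrite ge0_fin_numE ?measure_ge0// (le_lt_trans (U_le1 mA))// ltry.
Qed.

Let FE x y : (F x y)%:E = U (S x y).
Proof. by rewrite fineK// U_fin. Qed.

Let F_step x y : F x y = (F y (2 * x) + F y (2 * x - 1)) / 2.
Proof.
apply: EFin_inj; rewrite EFinM EFinD !FE muleDl; last 2 first.
  by [].
  by apply: fin_num_adde_defr; exact: U_fin.
rewrite ![(_ * 2^-1%:E)%E]muleC -U_lo// -U_hi//.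
have -> : lo `&` T @^-1` S y (2 * x) = S x y `&` lo.
  apply/seteqP; split => u [].
    rewrite {1}/lo/= in_itv/= => ulo /andP[u1 u2]; split; last by rewrite /lo/= in_itv.
    by apply/andP; split => //; rewrite phiE b_lo//; move: u2; rewrite /psi/comp; lra.
  move=> /andP[u1 u2] ulo; split => //; move: ulo; rewrite /lo/= in_itv/= => ulo.
  by apply/andP; split => //; move: u1; rewrite phiE b_lo// /psi/comp; lra.
have -> : hi `&` T @^-1` S y (2 * x - 1) = S x y `&` hi.
  apply/seteqP; split => u [].
    rewrite {1}/hi/= in_itv/= andbT => uhi /andP[u1 u2]; split; last by rewrite /hi/= in_itv/= andbT.
    by apply/andP; split => //; rewrite phiE b_hi//; move: u2; rewrite /psi/comp; lra.
  move=> /andP[u1 u2] uhi; split => //; move: uhi; rewrite /hi/= in_itv/= andbT => uhi.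
  by apply/andP; split => //; move: u1; rewrite phiE b_hi// /psi/comp; lra.
rewrite -measureU//.
- rewrite -setIUr; congr (U _); rewrite -[LHS]setIT; congr (_ `&` _).
  apply/seteqP; split => // u _; rewrite /lo/hi/= !in_itv/= andbT.
  by case: (ltP u (1 / 2)); [left|right].
- exact: measurableI.
- exact: measurableI.
- apply/seteqP; split => // u [[_ +] [_ +]]; rewrite /lo/hi/= !in_itv/= andbT.
  by move=> ? ?; lra.
Qed.


Let contraction (X : Type) (h : X -> R) : (forall x, `|h x| <= 1) ->
  (forall x, exists y, `|h x| <= `|h y| / 2) -> forall x, h x = 0.
Proof.
move=> h1 hh x.
have hn n y : `|h y| <= (2 ^+ n)^-1.
  elim: n y => [|n IH] y; first by rewrite expr0 invr1.
  have [z /le_trans -> //] := hh y.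
  by rewrite exprSr invfM ler_pM2r ?invr_gt0.
apply/eqP/contraT; rewrite -normr_gt0 => hx.
have := upper_nthrootP (leqnn (Num.bound (`|h x|^-1))).
rewrite -ltf_pV2 ?posrE ?exprn_gt0 ?invr_gt0// invrK.
by rewrite ltNge hn.
Qed.

Let F01 x y : 0 <= F x y <= 1.
Proof. by rewrite -!lee_fin FE measure_ge0 U_le1. Qed.

Let F_xle0 x y : x <= 0 -> F x y = 0.
Proof.
move=> x0; apply: EFin_inj; rewrite FE [S x y](_ : _ = set0) ?measure0//.
by apply/seteqP; split => // u /andP[]; have /andP[] := phi01 u; lra.
Qed.

Let F_yle0 x y : y <= 0 -> F x y = 0.
Proof.
move=> y0; apply: EFin_inj; rewrite FE [S x y](_ : _ = set0) ?measure0//.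
by apply/seteqP; split => // u /andP[]; have /andP[] := phi01 (T u); rewrite /psi/=; lra.
Qed.

Let F_ygt1 x y : 1 < y -> F x y = F x 2.
Proof.
move=> y1; congr (fine (U _)); apply/seteqP; split => u /andP[u1 u2];
  by apply/andP; split => //; have /andP[] := phi01 (T u); rewrite /psi/=; lra.
Qed.

Let F_xgt1 x : 1 < x -> F x 2 = 1.
Proof.
move=> x1; apply: EFin_inj; rewrite FE -UT; congr (U _).
apply/seteqP; split => // u _; apply/andP; split.
  by have /andP[] := phi01 u; lra.
by have /andP[] := phi01 (T u); rewrite /psi/=; lra.
Qed.

Let clip01 x : 0 <= clip x <= 1.
Proof. by rewrite /clip le_max lexx/= ge_max ler01 ge_min lexx orbT. Qed.

Let clip_le0 x : x <= 0 -> clip x = 0.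
Proof. by move=> x0; rewrite /clip max_l// ge_min x0. Qed.

Let clip_ge1 x : 1 <= x -> clip x = 1.
Proof. by move=> x1; rewrite /clip min_r// max_r. Qed.

Let clip_step x : clip x = (clip (2 * x) + clip (2 * x - 1)) / 2.
Proof.
have [x0|x0] := leP x 0; first by rewrite !clip_le0; lra.
have [x1|x1] := leP 1 x; first by rewrite !clip_ge1; lra.
have clipE y : 0 < y < 1 -> clip y = y.
  by move=> /andP[y0 y1]; rewrite /clip min_l ?max_r ?ltW.
rewrite (clipE x) ?x0//; have [x2|x2] := leP x (1 / 2).
  rewrite (clip_le0 (x := 2 * x - 1)); last lra.
  have [->|x3] := eqVneq x (1 / 2); first by rewrite clip_ge1; lra.
  have x4 : x < 1 / 2 by rewrite lt_neqAle x3.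
  by rewrite clipE; lra.
by rewrite (clip_ge1 (x := 2 * x)) ?clipE; lra.
Qed.

Let F_marginal x : F x 2 = clip x.
Proof.
apply/eqP; rewrite -subr_eq0; apply/eqP.
apply: (@contraction R (fun x => F x 2 - clip x)) => {x} x.
  by rewrite ler_norml; have := F01 x 2; have := clip01 x; lra.
have F2 c : F 2 c = F c 2.
  rewrite F_step (@F_ygt1 c (2 * 2)); last lra.
  by rewrite (@F_ygt1 c (2 * 2 - 1)); lra.
rewrite F_step clip_step !F2 {F2}; have [x2|x2] := leP x (1 / 2).
  exists (2 * x); rewrite (F_xle0 (x := 2 * x - 1)) ?(clip_le0 (x := 2 * x - 1)); last 2 first.
  - lra.
  - lra.
  by rewrite !addr0 -mulrBl normrM [X in _ * X]gtr0_norm.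
exists (2 * x - 1); rewrite (F_xgt1 (x := 2 * x)) ?(clip_ge1 (x := 2 * x)); last 2 first.
- lra.
- lra.
by rewrite -mulrBl normrM [X in _ * X]gtr0_norm// opprD addrACA subrr add0r.
Qed.

Let F_prod x y : F x y = clip x * clip y.
Proof.
apply/eqP; rewrite -subr_eq0; apply/eqP.
pose h (z : R * R) := F z.1 z.2 - clip z.1 * clip z.2.
apply: (@contraction _ h _ _ (x, y)) => {x y} -[x y]; rewrite /h/=.
  rewrite ler_norml; have := F01 x y; have := clip01 x; have := clip01 y.
  move=> /andP[? ?] /andP[? ?] /andP[? ?].
  have : 0 <= clip x * clip y by rewrite mulr_ge0.
  have : clip x * clip y <= 1 by rewrite mulr_ile1.
  by lra.
rewrite F_step clip_step; have [x2|x2] := leP x (1 / 2).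
  exists (y, 2 * x) => /=; rewrite (@F_yle0 _ (2 * x - 1)) ?(clip_le0 (x := 2 * x - 1)); last 2 first.
  - lra.
  - lra.
  rewrite !addr0 [X in `|X|](_ : _ = (F y (2 * x) - clip y * clip (2 * x)) / 2); last by field.
  by rewrite normrM [X in _ * X]gtr0_norm.
exists (y, 2 * x - 1) => /=.
rewrite (@F_ygt1 _ (2 * x)) ?F_marginal ?(clip_ge1 (x := 2 * x)); last 2 first.
- lra.
- lra.
rewrite [X in `|X|](_ : _ = (F y (2 * x - 1) - clip y * clip (2 * x - 1)) / 2); last by field.
by rewrite normrM [X in _ * X]gtr0_norm.
Qed.


Let F_rect y (A : set RT) : measurable A ->
  U (phi @^-1` A `&` psi @^-1` `]-oo, y[%classic) = ((clip y)%:E * U A)%E.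
Proof.
move=> mA; have my : measurable (psi @^-1` `]-oo, y[%classic).
  by apply: mpre => //; exact: measurable_itv.
have /andP[cy _] := clip01 y.
pose m1 : {measure set RT -> \bar R} := pushforward (mrestr U my) phi.
pose m2 : {measure set RT -> \bar R} := mscale (NngNum cy) U.
have H := @rays_unique (m1 mphi) m2; apply: H => // a.
  rewrite /m2/= /mscale/= -/U U_ray -EFinM /m1/= /pushforward/= /mrestr.
  rewrite mulrC -F_prod FE; congr (U _); apply/seteqP; split => u;
    by rewrite /S/= !in_itv/= => /andP.
rewrite (@le_lt_trans _ _ 1%E) ?ltry//; apply: U_le1.
by apply: measurableI => //; apply: mpre => //; exact: measurable_itv.
Qed.

Let U_rect (A B : set RT) : measurable A -> measurable B ->
  U (phi @^-1` A `&` psi @^-1` B) = (U A * U B)%E.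
Proof.
move=> mA mB; rewrite setIC.
have mpA : measurable (phi @^-1` A) by exact: mpre.
have UA : 0 <= fine (U A) by rewrite fine_ge0 ?measure_ge0.
pose m1 : {measure set RT -> \bar R} := pushforward (mrestr U mpA) psi.
pose m2 : {measure set RT -> \bar R} := mscale (NngNum UA) U.
rewrite -(fineK (U_fin mA)).
have H := @rays_unique (m1 mpsi) m2; apply: H => // a.
  transitivity (U (phi @^-1` A `&` psi @^-1` `]-oo, a[%classic)).
    by rewrite setIC.
  by rewrite F_rect// /m2/= /mscale/= -/U U_ray (fineK (U_fin mA)) muleC.
rewrite (@le_lt_trans _ _ 1%E) ?ltry//; apply: U_le1.
by apply: measurableI => //; apply: mpre => //; exact: measurable_itv.
Qed.

Let X (j : nat) : RT -> RT := phi \o iter j psi.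

Let mX j : measurable_fun [set: RT] (X j).
Proof.
apply: measurableT_comp => //.
elim: j => [|j IH]; first exact: (@measurable_id _ RT).
exact: (measurableT_comp mpsi IH).
Qed.

Let mbox n (A : nat -> set RT) : (forall i, measurable (A i)) ->
  measurable [set u : RT | forall i, (i < n)%N -> A i (X i u)].
Proof.
move=> mA.
rewrite [X in measurable X](_ : _ = \bigcap_(i in `I_n) (X i @^-1` A i)) //.
by apply: bigcap_measurableType => i _; exact: mpre.
Qed.

Let U_box n (A : nat -> set RT) : (forall i, measurable (A i)) ->
  U [set u : RT | forall i, (i < n)%N -> A i (X i u)] =
  (\prod_(i < n) U (A i))%E.
Proof.
elim: n A => [|n IH] A mA.
  by rewrite big_ord0 -UT; congr (U _); apply/seteqP; split.
have mAS i : measurable (A i.+1) by [].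
rewrite big_ord_recl -(IH (fun i => A i.+1) mAS).
rewrite -(U_rect (mA 0%N) (@mbox n (fun i => A i.+1) mAS)).
congr (U _); apply/seteqP; split => u /=.
  move=> Au; split; first exact: (Au 0).
  by move=> i ni; have := Au i.+1 ni; rewrite /X/= -iterSr.
move=> [A0 AS] [|i] ni //; have := AS i ni.
by rewrite /X/= -iterSr.
Qed.

Let Phi (u : RT) : torus R := fun j => to_circle (X j u).

Let mcirc (A : set (circle R)) : measurable A ->
  measurable (@to_circle R @^-1` A : set RT).
Proof. by rewrite /measurable/= /circle_measurable/image_set_system/= setTI. Qed.

Let mPhi : measurable_fun [set: RT] Phi.
Proof.
apply: (@measurability _ _ _ (torus R) _ _ (\bigcup_i preimage_set_system setT
  (fun x : nat -> circle R => x i) measurable)) => //.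
move=> _ [B [i _ [A mA <-]] <-]; rewrite !setTI.
exact: (mpre (@mX i) (mcirc mA)).
Qed.

Lemma product_measure_exists :
  exists mu : {measure set (torus R) -> \bar R}, is_product_measure mu.
Proof.
pose mu : {measure set (torus R) -> \bar R} := pushforward U Phi.
exists (mu mPhi) => n A mA; rewrite /mu/= /pushforward/=.
rewrite (@U_box n (fun i => @to_circle R @^-1` A i)); last first.
  by move=> i; exact: mcirc.
by apply: eq_bigr => i _; rewrite /U/= /mrestr /circle_measure setIC.
Qed.

End product_measure_existence.

Section fejer.
Variable R : realType.

(* e^{2 pi i j t} on R/Z, computed on a representative of t. *)
Definition character (j : int) (t : circle R) : R[i]^o :=
  cos (2 * pi * j%:~R * repr t) +i* sin (2 * pi * j%:~R * repr t).

(* The index j in -l..l is k - l for k < 2l+1. *)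
Definition dirichlet_kernel (l : nat) (t : circle R) : R[i]^o :=
  \sum_(k < l.*2.+1) character (k%:Z - l%:Z) t.

Definition fejer_kernel (l : nat) (t : circle R) : R[i]^o :=
  (l.+1%:R)^-1 * \sum_(r < l.+1) dirichlet_kernel r t.

Definition fejer_mean (mu : {measure set (torus R) -> \bar R})
    (f : torus R -> R[i]^o) (p : nat) (N : 'I_p -> nat) (x : torus R) : R[i]^o :=
  complex_integral mu
    (fun t : torus R => (\prod_(j < p) fejer_kernel (N j) (x j - t j)) * f t).

(* The filter on (N_1, ..., N_p) of min N -> oo under the restriction
   N_i <= C N_j for coordinates i, j in the same block J_k. *)
Definition regular_filter (D : nat) (J : 'I_D -> set nat) (p : nat) (C : R) :
    set_system ('I_p -> nat) :=
  filter_from [set: nat] (fun n => [set N |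
    (forall i, (n <= N i)%N) /\
    (forall k (i j : 'I_p), J k i -> J k j -> (N i)%:R <= C * (N j)%:R)]).

End fejer.

Arguments regular_filter {R D} J p C.

(* Main.v *)
Require Import Defs.
From HB Require Import structures.
From mathcomp Require Import all_boot all_order all_algebra.
From mathcomp Require Import complex archimedean ring_quotient.
From mathcomp Require Import all_classical all_reals all_analysis.
From mathcomp Require Import measurable_realfun lra ring zify.
Set Implicit Arguments.
Unset Strict Implicit.
Unset Printing Implicit Defensive.
Import Order.TTheory GRing.Theory Num.Theory.
Import numFieldNormedType.Exports.
Import Normc.
Local Open Scope classical_set_scope.
Local Open Scope complex_scope.
Local Open Scope ring_scope.

(** The sigma_p(x) of the theorem is the conditional mean of f given the first
p coordinates.  Convergence to it comes from a maximal inequality for the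
regular Fejer means together with a density argument.

Conditional means are realised by resampling.  A map r : X * X -> X that
carries P x P to P, such as redrawing from a second point all binary digits
beyond a given level, gives the operator f |-> E f(r(x, .)), which averages f
over what r forgets.  Doob's weak type inequality for a nested family of such
operators is [maximal_weak].  The function [orlicz k] is of order
t (1 + ln (1 + t))^k and is built so that the integral of orlicz k (M f) is at
most a constant plus the integral of orlicz k.+1 (f); hence a composition of
d + 1 maximal operators has weak type on L (ln+ L)^d ([iter_maximal_weak]).
This is where the exponent D - 1 comes from: there is one maximal operator for
each block J_k, and the last one costs no logarithm.

Two points of the circle at distance at most 2^-b / 3 have the same first b
binary digits, either as they stand or after both are translated by 1/3
([third_trick]).  As K_l(d) <= min (l + 1, 2 / ((l + 1) d^2)) when |d| <= 1/2,
for 2^m <= l + 1 <= c 2^m the kernel K_l(x - t) is at most a constant times the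
sum over a >= 0 and over the two translations of 2^-a 2^(m - a) times the
indicator of the t that agree with x in m - a digits ([fejer_dyadic]).  In the
product over j < p, regularity lets one m serve all coordinates of a block.
With the a_j and the translations fixed, the averages of one block are nested
as m varies, so that they are controlled by one maximal operator, and all blocks
together by D of them ([cond_mean_le_iter_maximal], [fejer_int_le]).  Asking the
maximal function of index (a_j) to be at most lam * prod_j (4/3)^a_j excludes a
set of measure of order 1 / lam, since the (3/4)^a are summable, and leaves the
bound lam * prod_j 2^-a_j (4/3)^a_j, again summable ([regular_fejer_maximal]).

For a bounded g that depends on finitely many digits, the Fejer means in the
first p coordinates converge to the conditional mean off the boundaries of the
dyadic cells, because the kernel concentrates in the cell of x
([fejer_int_dyadic]), and the conditional mean is g itself for large p.  Such g
approximate every function of L (ln+ L)^(D - 1) in the sense of [orlicz]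
([approximable_orlicz]), and the maximal inequality, applied to c |u - g| with
a large c, passes the convergence on to u ([eps_limits_negligible]).  The
operators are positive, so that everything takes place among nonnegative
functions; the theorem follows by applying this to the positive and negative
parts of Re f and Im f. *)

(** * Conditional means by resampling and the Doob maximal inequality *)

Section resampling.
Local Open Scope ereal_scope.
Context d (X : measurableType d) (R : realType) (P : probability X R).
Implicit Types (r : X * X -> X) (f g : X -> \bar R).

(** r redraws part of a random point from an independent copy, without changing
its law. *)
Definition resampling r :=
  measurable_fun setT r /\
  forall A, measurable A -> (P \x P) (r @^-1` A) = P A.

Lemma measurable_superlevel (t : \bar R) f : measurable_fun setT f ->
  measurable [set x | t < f x].
Proof.
by move=> mf; rewrite -[X in measurable X]setTI; exact: emeasurable_fun_o_infty.
Qed.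

(** The average of f over what r redraws: the conditional expectation of f given
what r keeps. *)
Definition cond_mean r f (x : X) : \bar R := \int[P]_y f (r (x, y)).

Lemma cond_mean_ge0 r f : (forall x, 0 <= f x) -> forall x, 0 <= cond_mean r f x.
Proof. by move=> f0 x; exact: integral_ge0. Qed.

Lemma measurable_section r f x : measurable_fun setT r -> measurable_fun setT f ->
  measurable_fun setT (fun y => f (r (x, y))).
Proof.
move=> mr mf; apply: (measurableT_comp mf).
exact: (measurableT_comp mr (measurable_pair1 x)).
Qed.

Lemma measurable_cond_mean r f : measurable_fun setT r ->
  measurable_fun setT f -> (forall x, 0 <= f x) ->
  measurable_fun setT (cond_mean r f).
Proof.
move=> mr mf f0.
have := @measurable_fun_fubini_tonelli_F _ _ _ _ R P (f \o r) (measurableT_comp mf mr).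
by apply => x; exact: f0.
Qed.

Lemma le_cond_mean r f g : measurable_fun setT r ->
  measurable_fun setT f -> (forall x, 0 <= f x) -> measurable_fun setT g ->
  (forall x, f x <= g x) -> forall x, cond_mean r f x <= cond_mean r g x.
Proof.
move=> mr mf f0 mg fg x; apply: ge0_le_integral => //; [exact: (measurable_section x mr mf)|exact: (measurable_section x mr mg)].
Qed.

Lemma integral_resampling r f : resampling r ->
  measurable_fun setT f -> (forall x, 0 <= f x) ->
  \int[P \x P]_z f (r z) = \int[P]_x f x.
Proof.
move=> [mr Pr] mf f0.
rewrite -[LHS](@ge0_integral_pushforward _ _ _ _ _ r mr _ setT)//.
by apply: eq_measure_integral => A mA _; exact: Pr.
Qed.

Lemma integral_cond_mean r f : resampling r ->
  measurable_fun setT f -> (forall x, 0 <= f x) ->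
  \int[P]_x cond_mean r f x = \int[P]_x f x.
Proof.
move=> Hr mf f0; rewrite -[RHS](integral_resampling Hr)//.
rewrite fubini_tonelli1//; exact: measurableT_comp mf Hr.1.
Qed.

Lemma cond_mean_pull r f (h : X -> \bar R) : measurable_fun setT r ->
  measurable_fun setT f -> (forall x, 0 <= f x) ->
  (forall x, 0 <= h x) -> (forall x y, h (r (x, y)) = h x) ->
  forall x, cond_mean r (fun x => h x * f x) x = h x * cond_mean r f x.
Proof.
move=> mr mf f0 h0 hr x; rewrite /cond_mean -ge0_integralZl//.
- by apply: eq_integral => y _; rewrite hr.
- exact: (measurable_section x mr mf).
Qed.

(** A function h that only sees what r keeps comes out of the conditional mean. *)
Lemma integral_cond_mean_pull r f (h : X -> \bar R) : resampling r ->
  measurable_fun setT f -> (forall x, 0 <= f x) ->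
  measurable_fun setT h -> (forall x, 0 <= h x) ->
  (forall x y, h (r (x, y)) = h x) ->
  \int[P]_x (h x * cond_mean r f x) = \int[P]_x (h x * f x).
Proof.
move=> Hr mf f0 mh h0 hr.
rewrite -[RHS](integral_cond_mean (f := fun x => h x * f x) Hr).
- by apply: eq_integral => x _; rewrite cond_mean_pull//; exact: Hr.1.
- exact: emeasurable_funM.
- by move=> x; rewrite mule_ge0.
Qed.

Section maximal.
Variable r : nat -> X * X -> X.
Hypothesis rP : forall n, resampling (r n).
Hypothesis r_nested : forall m n x y z, (m <= n)%N ->
  r m (r n (x, y), z) = r m (x, z).

Let mr n : measurable_fun setT (r n). Proof. by have [] := rP n. Qed.

Definition maximal f (x : X) : \bar R := ereal_sup (range (fun n => cond_mean (r n) f x)).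

Lemma cond_mean_le_maximal f n x : cond_mean (r n) f x <= maximal f x.
Proof. by apply: ereal_sup_ubound; exists n. Qed.

Lemma maximal_ge0 f : (forall x, 0 <= f x) -> forall x, 0 <= maximal f x.
Proof.
by move=> f0 x; apply: le_trans (cond_mean_le_maximal f 0 x); exact: cond_mean_ge0.
Qed.

Lemma maximal_gtE f (t : \bar R) :
  [set x | t < maximal f x] = \bigcup_n [set x | t < cond_mean (r n) f x].
Proof.
apply/seteqP; split => x /=.
  by move=> /ereal_sup_gt[_ [n _ <-]] tn; exists n.
by move=> [n _ /= tn]; apply: lt_le_trans tn _; exact: cond_mean_le_maximal.
Qed.

Section fixed.
Variable f : X -> \bar R.
Hypothesis mf : measurable_fun setT f.
Hypothesis f0 : forall x, 0 <= f x.

Let mE n : measurable_fun setT (cond_mean (r n) f).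
Proof. exact: measurable_cond_mean. Qed.

Lemma measurable_maximal : measurable_fun setT (maximal f).
Proof.
rewrite (_ : maximal f = fun x => esups (fun n => cond_mean (r n) f x) 0%N).
  apply: (@measurable_fun_esups _ _ _ _ (fun n => cond_mean (r n) f)).
  exact: mE.
apply/funext => x; rewrite /esups/maximal; congr ereal_sup.
by apply/seteqP; split => _ [n _ <-]; exists n.
Qed.

(** The superlevel set of the maximal function is cut according to the first n
at which the n-th mean exceeds t.  Nestedness makes that piece invariant under
r n, so that the n-th mean of f has over it the same integral as f. *)
Lemma maximal_weak (t : R) : (0 < t)%R ->
  t%:E * P [set x | t%:E < maximal f x] <= \int[P]_x f x.
Proof.
move=> t0; rewrite maximal_gtE.
pose A n := [set x | t%:E < cond_mean (r n) f x].
have mA n : measurable (A n) by exact: measurable_superlevel.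
have ArE m n x y : (m <= n)%N -> A m (r n (x, y)) = A m x.
  by move=> mn; rewrite /A/= /cond_mean; under eq_integral do rewrite r_nested//.
rewrite -/(\bigcup_n A n) (seqDU_bigcup_eq A).
have mD n : measurable (seqDU A n).
  by apply: measurableD => //; exact: bigsetU_measurable.
(* seqDU A n is the set where n is the first index with a mean above t. *)
have DrE n x y : \1_(seqDU A n) (r n (x, y)) = \1_(seqDU A n) x :> R.
  rewrite !indicE; congr ((_ : bool)%:R)%R.
  apply/idP/idP; rewrite !inE /seqDU -!bigcup_mkord => -[H1 H2]; split.
  - by rewrite -(ArE n n x y).
  - by move=> [k /= kn H]; apply: H2; exists k => //; rewrite ArE// ltnW.
  - by rewrite (ArE n n x y).
  - by move=> [k /= kn H]; apply: H2; exists k => //; rewrite -(ArE k n x y)// ltnW.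
have -> : P (\bigcup_n seqDU A n) = \sum_(n <oo) P (seqDU A n).
  by rewrite measure_bigcup//=; apply: eq_eseriesl => n; rewrite in_setT.
rewrite -nneseriesZl//.
apply: (@le_trans _ _ (\sum_(n <oo) \int[P]_(x in seqDU A n) f x)).
  apply: lee_nneseries => [n _ _|n _]; first by rewrite mule_ge0// lee_fin ltW.
  rewrite integral_mkcond.
  rewrite (_ : \int[P]_x _ = \int[P]_x ((\1_(seqDU A n) x)%:E * f x)); last first.
    by apply: eq_integral => x _; rewrite epatch_indic muleC.
  rewrite -(@integral_cond_mean_pull (r n))//; last 2 first.
  - by apply/measurable_EFinP.
  - by move=> x y; rewrite DrE.
  rewrite -integral_cst//.
  rewrite [leLHS]integral_mkcond; apply: ge0_le_integral => //.
  - by move=> x _; rewrite patchE; case: ifP => // _; rewrite lee_fin ltW.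
  - by apply/(measurable_restrictT _ _).1 => //.
  - by apply: emeasurable_funM => //; apply/measurable_EFinP.
  - move=> x _; rewrite patchE indicE; case: ifPn => [|_].
      by rewrite inE mul1e => -[/ltW].
    by rewrite mul0e.
rewrite -ge0_integral_bigcup//.
- apply: ge0_subset_integral => //; exact: bigcup_measurable.
- by apply: measurable_funTS.
Qed.

End fixed.
End maximal.
End resampling.

(** * Functions of LlogL type and iterated maximal operators *)

Section orlicz.
Local Open Scope ereal_scope.
Context {R : realType}.

Lemma le_cancel_EFin (a b c : R) (y : \bar R) :
  c%:E <= b%:E + y -> (a + b <= c)%R -> a%:E <= y.
Proof.
by case: y => [y| |]//=; rewrite ?leey// -EFinD !lee_fin => ? ?; lra.
Qed.

(** One more maximal operator turns orlicz k into orlicz k.+1: bounding orlicz k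
by its values at powers of 2, and the measure of the set where M f > 2^(j + 1)
is at most 2^-j times the integral of f over the set where f > 2^j.  Recursively this is a
function of order t (1 + ln (1 + t))^k. *)
Fixpoint orlicz (k : nat) (t : \bar R) : \bar R :=
  if k is k'.+1 then
    \sum_(j <oo) (if (2 ^+ j)%:E < t
      then ((2 ^- j)%:E * orlicz k' (2 ^+ j.+2)%:E) * t else 0)
  else t.

Lemma nneseries_ge_term (u : nat -> \bar R) j : (forall i, 0 <= u i) ->
  u j <= \sum_(i <oo) u i.
Proof.
move=> u0; have := @nneseries_lim_ge _ u xpredT 0%N j.+1 (fun i _ _ => u0 i).
apply: le_trans; by rewrite big_nat_recr//= leeDr// sume_ge0.
Qed.

Lemma orlicz_ge0 k t : 0 <= t -> 0 <= orlicz k t.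
Proof.
elim: k t => [//|k IH] t t0 /=; apply: nneseries_ge0 => j _ _.
by case: ifP => // _; rewrite mule_ge0// mule_ge0// ?lee_fin ?invr_ge0 ?exprn_ge0// IH// lee_fin exprn_ge0.
Qed.

Let term_ge0 k j t : 0 <= t -> 0 <= (if (2 ^+ j)%:E < t
      then ((2 ^- j)%:E * orlicz k (2 ^+ j.+2)%:E) * t else 0).
Proof.
move=> t0; case: ifP => // _.
by rewrite mule_ge0// mule_ge0// ?lee_fin ?invr_ge0 ?exprn_ge0// orlicz_ge0// lee_fin exprn_ge0.
Qed.

Lemma le_orlicz k s t : 0 <= s -> s <= t -> orlicz k s <= orlicz k t.
Proof.
case: k => [//|k] s0 st /=; apply: lee_nneseries => [j _ _|j _]; first exact: term_ge0.
case: ifPn => [js|_]; last by rewrite term_ge0// (le_trans s0).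
rewrite (lt_le_trans js st) lee_wpmul2l//.
by rewrite mule_ge0// ?lee_fin ?invr_ge0 ?exprn_ge0// orlicz_ge0// lee_fin exprn_ge0.
Qed.

(** Hence a function whose orlicz k has a finite integral is integrable. *)
Lemma le1Dorlicz k t : 0 <= t -> t <= 1 + orlicz k t.
Proof.
elim: k t => [|k IH] t t0; first by rewrite /= leeDr.
have [t1|t1] := leP t 1; first by rewrite (le_trans t1)// leeDl// orlicz_ge0.
rewrite (le_trans _ (leeDr _ _))//.
apply: le_trans (nneseries_ge_term 0 (fun j => term_ge0 k j t0)).
rewrite expr0 t1 invr1 mul1e -[leLHS]mul1e lee_wpmul2r//.
have /(IH (2 ^+ 2)%:E)/le_cancel_EFin : (0 <= (2 ^+ 2)%:E :> \bar R)%E by rewrite lee_fin.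
by apply; lra.
Qed.

Lemma integral_prob_cst d (X : measurableType d) (P : probability X R) (c : \bar R) :
  \int[P]_x c = c.
Proof. by rewrite -[LHS]/(\int[P]_x (cst c x)) integral_cst// [X in _ * X](@probability_setT _ _ _ P) mule1. Qed.

Definition superlevel X (f : X -> \bar R) (t : R) : set X := [set x | t%:E < f x].

Lemma measurable_orlicz d (X : measurableType d) (f : X -> \bar R) k :
  measurable_fun setT f -> (forall x, 0 <= f x) ->
  measurable_fun setT (fun x => orlicz k (f x)).
Proof.
case: k => [//|k] mf f0 /=; apply: ge0_emeasurable_sum => [j x _ _|j _].
  exact: term_ge0.
apply: measurable_fun_ifT => //.
  apply: (measurable_fun_bool true); rewrite setTI.
  rewrite [X in measurable X](_ : _ = superlevel f (2 ^+ j)); last by apply/seteqP; split.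
  exact: measurable_superlevel.
by apply: measurable_funeM.
Qed.

Let orlicz_dyadic k (s : \bar R) : 0 <= s ->
  orlicz k s <= orlicz k 2%:E +
    \sum_(j <oo) (if (2 ^+ j.+1)%:E < s then orlicz k (2 ^+ j.+2)%:E else 0).
Proof.
move=> s0; have u0 j : 0 <= (if (2 ^+ j.+1)%:E < s then orlicz k (2 ^+ j.+2)%:E else 0).
  by case: ifP => // _; rewrite orlicz_ge0// lee_fin exprn_ge0.
have [s2|s2] := leP s 2%:E.
  by rewrite (le_trans (le_orlicz _ _ s2))// leeDl// nneseries_ge0.
apply: le_trans (leeDr _ _); last by rewrite orlicz_ge0// lee_fin.
case: s s0 s2 u0 => [s| |]// s0 s2 u0.
  have [j /andP[j1 j2]] : exists j, ((2 ^+ j.+1 < s) && (s <= 2 ^+ j.+2))%R.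
    have ex : exists n, (s <= 2 ^+ n)%R.
      exists (Num.bound s); apply/ltW/(lt_le_trans (archi_boundP _)); first by rewrite -lee_fin.
      by rewrite -natrX ler_nat ltnW// ltn_expl.
    have := ex_minnP ex; case=> -[|[|j]] H minj.
    - by move: H s2; rewrite expr0 lte_fin; lra.
    - by move: H s2; rewrite expr1 lte_fin; lra.
    - by exists j; rewrite H andbT ltNge; apply/negP => /minj; rewrite ltnn.
  apply: le_trans (nneseries_ge_term j u0); rewrite lte_fin j1.
  by apply: le_orlicz => //; rewrite lee_fin.
rewrite (_ : \sum_(j <oo) _ = +oo) ?leey//; apply/eq_infty => A.
have [A0|A0] := leP A 0%R; first by apply: (@le_trans _ _ 0); [rewrite lee_fin|exact: nneseries_ge0].
pose j := Num.bound A.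
apply: le_trans (nneseries_ge_term j u0); rewrite ltry.
have := @le1Dorlicz k (2 ^+ j.+2)%:E; rewrite lee_fin exprn_ge0// => /(_ isT)/le_cancel_EFin.
apply.
have jA : (A < j%:R)%R by rewrite archi_boundP ?ltW.
have : (j%:R <= 2 ^+ j :> R)%R by rewrite -natrX ler_nat ltnW// ltn_expl.
rewrite exprS exprS; have : (1 <= 2 ^+ j :> R)%R by rewrite exprn_ege1// ler1n.
by lra.
Qed.

(** For 2^(n - 1) < t <= 2^n, only the n terms j < n of the series are nonzero,
each of order t (1 + ln (1 + t))^k, and n is of order 1 + ln (1 + t). *)
Lemma orlicz_le_log k : exists2 C : R, (0 <= C)%R & forall t : R, (0 <= t)%R ->
  orlicz k t%:E <= (C * (t * (1 + ln (1 + t)) ^+ k))%:E.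
Proof.
have ln2 : (0 < ln 2 :> R)%R by rewrite ln_gt0// ltr1n.
have L0 (t : R) : (0 <= t)%R -> (0 <= ln (1 + t))%R by move=> t0; rewrite ln_ge0// lerDl.
elim: k => [|k [C C0 IH]]; first by exists 1%R => // t t0; rewrite mul1r expr0 mulr1.
pose b : R := (1 + ln 4)%R; have b1 : (1 <= b)%R by rewrite lerDl ln_ge0// ler1n.
pose e : R := (1 + (ln 2)^-1)%R; have e0 : (0 <= e)%R by rewrite addr_ge0// invr_ge0 ltW.
exists (e * (4 * C * b ^+ k))%R.
  by rewrite !mulr_ge0// exprn_ge0// (le_trans _ b1).
move=> t t0; set L := (1 + ln (1 + t))%R.
have L1 : (1 <= L)%R by rewrite lerDl L0.
have ex : exists n, (t <= 2 ^+ n)%R.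
  exists (Num.bound t); apply/ltW/(lt_le_trans (archi_boundP t0)).
  by rewrite -natrX ler_nat ltnW// ltn_expl.
have [n tn minn] := ex_minnP ex.
have nL : (n%:R <= e * L)%R.
  case: n tn minn => [_ _|n _ minn]; first by rewrite mulr_ge0// (le_trans _ L1).
  have nt : (2 ^+ n < t)%R by rewrite ltNge; apply/negP => /minn; rewrite ltnn.
  have : (n%:R * ln 2 <= ln (1 + t))%R.
    rewrite mulr_natl -lnXn// ler_ln ?posrE ?exprn_gt0//; lra.
  rewrite -ler_pdivlMr// => nle.
  have : (ln (1 + t) / ln 2 <= L / ln 2)%R.
    by rewrite ler_pM2r ?invr_gt0// /L; lra.
  have -> : (e * L = L + L / ln 2)%R by rewrite /e; ring.
  by rewrite -natr1 => ?; lra.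
rewrite /= (nneseries_split 0 n); last by move=> j _; exact: term_ge0.
rewrite add0n [X in _ + X]eseries0 ?adde0; last first.
  move=> j nj _; rewrite ifF//; apply/negbTE; rewrite -leNgt lee_fin.
  by rewrite (le_trans tn)// ler_weXn2l// ler1n.
pose K := (4 * C * b ^+ k * (t * L ^+ k))%R.
have K0 : (0 <= K)%R.
  rewrite /K !mulr_ge0// exprn_ge0//; first exact: le_trans b1.
  exact: le_trans L1.
apply: (@le_trans _ _ (\sum_(0 <= j < n) K%:E)).
  apply: lee_sum => j _; case: ifPn => [jt|_]; last by rewrite lee_fin.
  have j0 : (0 < 2 ^+ j :> R)%R by rewrite exprn_gt0.
  have {}jt : (2 ^+ j < t)%R by rewrite -lte_fin.
  apply: (@le_trans _ _ ((2 ^- j)%:E * (C * (2 ^+ j.+2 * (1 + ln (1 + 2 ^+ j.+2)) ^+ k))%:E * t%:E)).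
    apply: lee_wpmul2r; first by rewrite lee_fin.
    apply: lee_wpmul2l; first by rewrite lee_fin invr_ge0 ltW.
    by apply: IH; rewrite exprn_ge0.
  rewrite -!EFinM lee_fin /K.
  have -> : (2 ^- j * (C * (2 ^+ j.+2 * (1 + ln (1 + 2 ^+ j.+2)) ^+ k)) * t =
     4 * C * t * (1 + ln (1 + 2 ^+ j.+2)) ^+ k)%R.
    by rewrite !exprS; field; rewrite gt_eqF.
  rewrite [leRHS](_ : _ = 4 * C * t * (b * L) ^+ k)%R; last by rewrite exprMn; ring.
  rewrite ler_wpM2l// ?mulr_ge0// lerXn2r// ?nnegrE.
  - by rewrite addr_ge0// L0// exprn_ge0.
  - by rewrite mulr_ge0// ?(le_trans _ b1)// (le_trans _ L1).
  have : (ln (1 + 2 ^+ j.+2) <= ln 4 + ln (1 + t))%R.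
    rewrite -lnM ?posrE//; last by lra.
    by rewrite ler_ln ?posrE ?exprS//; lra.
  have : (0 <= ln (4 : R))%R by rewrite ln_ge0// ler1n.
  have := L0 _ t0; rewrite /b /L => *; nra.
rewrite sumEFin lee_fin big_const_nat iter_addr_0 subn0 -[X in (X <= _)%R]mulr_natl.
rewrite [leRHS](_ : _ = e * L * K)%R; last by rewrite /K exprS; ring.
by rewrite ler_wpM2r.
Qed.

Section maximal_orlicz.
Context d (X : measurableType d) (P : probability X R).
Variable r : nat -> X * X -> X.
Hypothesis rP : forall n, resampling P (r n).
Hypothesis r_nested : forall m n x y z, (m <= n)%N ->
  r m (r n (x, y), z) = r m (x, z).
Variable f : X -> \bar R.
Hypothesis mf : measurable_fun setT f.
Hypothesis f0 : forall x, 0 <= f x.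

Let mr n : measurable_fun setT (r n). Proof. by have [] := rP n. Qed.

Let measurable_superlevel_indic (t : R) : measurable_fun setT (fun x => (\1_(superlevel f t) x : R)%:E).
Proof. by apply/measurable_EFinP/measurable_indicP; exact: measurable_superlevel. Qed.

(** The part of f below t contributes at most t to every mean, so that the weak
type inequality for the part above t is enough. *)
Lemma maximal_weak_trunc (t : R) : (0 < t)%R ->
  t%:E * P (superlevel (maximal P r f) (2 * t)) <=
  \int[P]_x (f x * (\1_(superlevel f t) x)%:E).
Proof.
move=> t0; pose h x := f x * (\1_(superlevel f t) x)%:E.
have mh : measurable_fun setT h by apply: emeasurable_funM.
have h0 x : 0 <= h x by rewrite mule_ge0.
apply: le_trans (maximal_weak rP r_nested mh h0 t0).
apply: lee_wpmul2l; first by rewrite lee_fin ltW.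
apply: le_measure; rewrite ?inE.
- by apply: measurable_superlevel; exact: measurable_maximal.
- by apply: measurable_superlevel; exact: measurable_maximal.
move=> x; rewrite /superlevel/= !ltNge; apply: contra => ht.
apply: ub_ereal_sup => _ [n _ <-].
apply: (@le_trans _ _ (\int[P]_y (h (r n (x, y)) + t%:E))).
  apply: ge0_le_integral => //.
  - exact: (measurable_section x (mr n) mf).
  - apply: emeasurable_funD => //; exact: (measurable_section x (mr n) mh).
  - move=> y _; rewrite /h indicE; have [H|H] := leP (f (r n (x, y))) t%:E.
      by rewrite memNset ?mule0 ?add0e// /superlevel/= ltNge H.
    by rewrite mem_set// mule1 leeDl// lee_fin ltW.
rewrite ge0_integralD//; last 2 first.
- exact: (measurable_section x (mr n) mh).
- by move=> y _; rewrite lee_fin ltW.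
rewrite integral_prob_cst mulr2n mulrDl mul1r EFinD leeD2r//.
exact: le_trans (cond_mean_le_maximal _ _ _ _ _) ht.
Qed.

Lemma orlicz_maximal k :
  \int[P]_x orlicz k (maximal P r f x) <=
  orlicz k 2%:E + \int[P]_x orlicz k.+1 (f x).
Proof.
have M0 : forall x, 0 <= maximal P r f x by exact: maximal_ge0.
have mM : measurable_fun setT (maximal P r f) by exact: measurable_maximal.
pose u j x := if (2 ^+ j.+1)%:E < maximal P r f x then orlicz k (2 ^+ j.+2)%:E else 0.
have c0 j : 0 <= orlicz k (2 ^+ j)%:E :> \bar R by rewrite orlicz_ge0// lee_fin exprn_ge0.
have uE j : u j = fun x => orlicz k (2 ^+ j.+2)%:E * (\1_(superlevel (maximal P r f) (2 ^+ j.+1)) x)%:E.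
  apply/funext => x; rewrite /u indicE; case: ifPn => H.
    by rewrite mem_set// mule1.
  by rewrite memNset ?mule0//; apply/negP.
have mset j : measurable (superlevel (maximal P r f) (2 ^+ j.+1)).
  exact: measurable_superlevel.
have mi j : measurable_fun setT (fun x => (\1_(superlevel (maximal P r f) (2 ^+ j.+1)) x : R)%:E).
  by apply/measurable_EFinP/measurable_indicP.
have mu j : measurable_fun setT (u j) by rewrite uE; apply: emeasurable_funM.
have u0 j x : 0 <= u j x by rewrite /u; case: ifP.
apply: (@le_trans _ _ (\int[P]_x (orlicz k 2%:E + \sum_(j <oo) u j x))).
  apply: ge0_le_integral => //.
  - by move=> x _; exact: orlicz_ge0.
  - exact: measurable_orlicz.
  - by apply: emeasurable_funD => //; apply: ge0_emeasurable_sum.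
  - by move=> x _; exact: orlicz_dyadic.
rewrite ge0_integralD//; last 3 first.
- by move=> x _; rewrite -(expr1 2).
- by move=> x _; exact: nneseries_ge0.
- by apply: ge0_emeasurable_sum.
rewrite integral_prob_cst leeD2l//.
rewrite integral_nneseries// integral_nneseries//; last 2 first.
- move=> j; apply: measurable_fun_ifT => //; last by apply: measurable_funeM.
  apply: (measurable_fun_bool true); rewrite setTI.
  rewrite [X in measurable X](_ : _ = superlevel f (2 ^+ j)); last by apply/seteqP; split.
  exact: measurable_superlevel.
- by move=> j x _; exact: term_ge0.
apply: lee_nneseries => [j _ _|j _]; first exact: integral_ge0.
rewrite uE ge0_integralZl// integral_indic// setIT.
have j0 : (0 < 2 ^+ j :> R)%R by rewrite exprn_gt0.
have := maximal_weak_trunc j0; rewrite -exprS muleC -lee_pdivlMr// => H.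
apply: (@le_trans _ _ (orlicz k (2 ^+ j.+2)%:E * (\int[P]_x (f x * (\1_(superlevel f (2 ^+ j)) x)%:E) * (2 ^- j)%:E))).
  by rewrite lee_wpmul2l.
rewrite muleCA muleC [X in X * _]muleC -ge0_integralZl//; last 3 first.
- by apply: emeasurable_funM.
- by move=> x _; rewrite mule_ge0.
- by rewrite mule_ge0// lee_fin invr_ge0 ltW.
apply: ge0_le_integral => //.
- by move=> x _; rewrite !mule_ge0// lee_fin invr_ge0 ltW.
- by apply: measurable_funeM; apply: emeasurable_funM.
- apply: measurable_fun_ifT => //; last by apply: measurable_funeM.
  apply: (measurable_fun_bool true); rewrite setTI.
  rewrite [X in measurable X](_ : _ = superlevel f (2 ^+ j)); last by apply/seteqP; split.
  exact: measurable_superlevel.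
- move=> x _; rewrite indicE; case: ifPn => H2.
    by rewrite mem_set// mule1.
  by rewrite memNset ?mule0//; apply/negP.
Qed.

End maximal_orlicz.

Section iterated_maximal.
Context d (X : measurableType d) (P : probability X R).

Definition nested_resamplings (r : nat -> X * X -> X) :=
  (forall n, resampling P (r n)) /\
  forall m n x y z, (m <= n)%N -> r m (r n (x, y), z) = r m (x, z).

(** The operator with the highest index acts first. *)
Fixpoint iter_maximal (r : nat -> nat -> X * X -> X) d (f : X -> \bar R) : X -> \bar R :=
  if d is d'.+1 then iter_maximal r d' (maximal P (r d') f) else f.

Fixpoint iter_const (d : nat) : \bar R :=
  if d is d'.+1 then iter_const d' + orlicz d' 2%:E else 0.

Lemma iter_const_fin k : iter_const k \is a fin_num /\ 0 <= iter_const k.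
Proof.
elim: k => [//|k [IH1 IH2]] /=; have o0 : 0 <= orlicz k 2%:E by rewrite orlicz_ge0// lee_fin.
split; last by rewrite adde_ge0.
rewrite fin_numD IH1/= ge0_fin_numE//.
have [C C0 HC] := orlicz_le_log k.
by apply: le_lt_trans (HC 2%R _) _ => //; rewrite ltry.
Qed.

Lemma measurable_iter_maximal r k f : (forall i, nested_resamplings (r i)) ->
  measurable_fun setT f -> (forall x, 0 <= f x) ->
  measurable_fun setT (iter_maximal r k f).
Proof.
move=> rP; elim: k f => [//|k IH] f mf f0 /=; apply: IH; last exact: maximal_ge0.
by apply: measurable_maximal => //; have [] := rP k.
Qed.

(** Each maximal operator but the outermost one raises the index k of orlicz by
one; the outermost one only needs an integrable function. *)
Lemma iter_maximal_weak r k f (t : R) : (forall i, nested_resamplings (r i)) ->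
  measurable_fun setT f -> (forall x, 0 <= f x) -> (0 < t)%R ->
  t%:E * P (superlevel (iter_maximal r k.+1 f) t) <=
  iter_const k + \int[P]_x orlicz k (f x).
Proof.
move=> rP + + t0; elim: k f => [|k IH] f mf f0.
  by rewrite /= add0e; have [r1 r2] := rP 0%N; exact: maximal_weak.
have [r1 r2] := rP k.+1.
apply: le_trans (IH (maximal P (r k.+1) f) _ _) _.
- exact: measurable_maximal.
- exact: maximal_ge0.
by rewrite /= -addeA leeD2l//; exact: orlicz_maximal.
Qed.

End iterated_maximal.
End orlicz.

(** * Binary digits on the circle *)

Section circle.
Context {R : realType}.
Local Notation RT := (measurableTypeR R).
Implicit Types (t s : circle R).

Lemma to_circleD (x y : R) : to_circle (x + y) = to_circle x + to_circle y.
Proof. exact: raddfD. Qed.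

Lemma to_circleN (x : R) : to_circle (- x) = - to_circle x.
Proof. exact: raddfN. Qed.

Lemma to_circle_eqP (x y : R) :
  to_circle x = to_circle y <-> exists m : int, x = y + m%:~R.
Proof.
split=> [/eqP|[m ->]].
  rewrite /to_circle -Quotient.idealrBE => /intrP [m xy].
  by exists m; rewrite -xy addrC subrK.
apply/eqP; rewrite /to_circle -Quotient.idealrBE.
by apply/intrP; exists m; rewrite addrC addKr.
Qed.

Lemma to_circle_repr t : to_circle (repr t) = t.
Proof. exact: reprK. Qed.

Definition repr01 t : R := repr t - (Num.floor (repr t))%:~R.

Lemma repr01K t : to_circle (repr01 t) = t.
Proof.
rewrite -[RHS]to_circle_repr; apply/to_circle_eqP.
by exists (- Num.floor (repr t)); rewrite /repr01 rmorphN.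
Qed.

Lemma repr01_itv t : 0 <= repr01 t < 1.
Proof.
have /andP[] := Num.Theory.floor_itv (repr t); rewrite /repr01 intrD.
by move=> ? ?; lra.
Qed.

Lemma repr01_to_circle (x : R) : 0 <= x < 1 -> repr01 (to_circle x) = x.
Proof.
move=> x01; have := repr01_itv (to_circle x).
have /to_circle_eqP [m ->] : to_circle (repr01 (to_circle x)) = to_circle x by rewrite repr01K.
move=> H; suff -> : m = 0 by rewrite addr0.
have : (-1)%:~R < m%:~R :> R by rewrite rmorphN1; lra.
have : m%:~R < 1%:~R :> R by rewrite rmorph1; lra.
by rewrite !ltr_int; lia.
Qed.

Lemma measurable_to_circle : measurable_fun setT (@to_circle R : RT -> circle R).
Proof. by move=> _ A; rewrite /measurable/= /circle_measurable /image_set_system/= !setTI. Qed.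

Lemma circle_measurableE (A : set (circle R)) :
  measurable A = measurable (@to_circle R @^-1` A : set RT).
Proof. by rewrite /measurable/= /circle_measurable/image_set_system/= setTI. Qed.

Lemma measurable_floorr : measurable_fun setT (fun x : RT => (Num.floor x)%:~R : RT).
Proof.
apply: nondecreasing_measurable => // x y xy.
by rewrite ler_int Num.Theory.le_floor.
Qed.

Lemma measurable_repr01 : measurable_fun setT (repr01 : circle R -> RT).
Proof.
move=> _ B mB; rewrite setTI circle_measurableE.
rewrite [X in measurable X](_ : _ = (fun x : RT => x - (Num.floor x)%:~R : RT) @^-1` B).
  rewrite -[X in measurable X]setTI; apply: measurable_funB => //.
  exact: measurable_floorr.
apply/seteqP; split => x /=; suff -> : repr01 (to_circle x) = x - (Num.floor x)%:~R by [].
  rewrite -[RHS]repr01_to_circle; last first.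
    by have /andP[] := Num.Theory.floor_itv x; rewrite intrD => ? ?; lra.
  by congr repr01; apply/esym/to_circle_eqP; exists (- Num.floor x); rewrite rmorphN.
rewrite -[RHS]repr01_to_circle; last first.
  by have /andP[] := Num.Theory.floor_itv x; rewrite intrD => ? ?; lra.
by congr repr01; apply/esym/to_circle_eqP; exists (- Num.floor x); rewrite rmorphN.
Qed.

Lemma measurable_circle_add d (X : measurableType d) (f g : X -> circle R) :
  measurable_fun setT f -> measurable_fun setT g ->
  measurable_fun setT (fun x => f x + g x).
Proof.
move=> mf mg; rewrite (_ : (fun x => _) = fun x => to_circle (repr01 (f x) + repr01 (g x))).
  apply: (measurableT_comp measurable_to_circle).
  apply: (@measurable_funD _ _ R setT (repr01 \o f) (repr01 \o g)); exact: (measurableT_comp measurable_repr01).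
by apply/funext => x; rewrite to_circleD !repr01K.
Qed.

Lemma measurable_circle_opp d (X : measurableType d) (f : X -> circle R) :
  measurable_fun setT f -> measurable_fun setT (fun x => - f x).
Proof.
move=> mf; rewrite (_ : (fun x => _) = fun x => to_circle (- repr01 (f x))).
  apply: (measurableT_comp measurable_to_circle).
  by apply: (@measurable_funN _ _ R setT (repr01 \o f)); exact: (measurableT_comp measurable_repr01).
by apply/funext => x; rewrite to_circleN repr01K.
Qed.

Lemma lebesgue_affine (a b : R) (A : set RT) : 0 < a -> measurable A ->
  lebesgue_measure [set v : RT | A (a * v + b)] = (a^-1%:E * lebesgue_measure A)%E.
Proof.
move=> a0 mA.
have mphi : measurable_fun setT (fun v : RT => a * v + b : RT).
  by apply: measurable_funD => //; exact: mulrl_measurable.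
have a0' : 0 <= a by exact: ltW.
pose p : {measure set RT -> \bar R} :=
  pushforward (@lebesgue_measure R) (fun v : RT => a * v + b : RT).
pose m : {measure set RT -> \bar R} := mscale (NngNum a0') (p mphi).
have H : lebesgue_measure A = m A.
  apply: lebesgue_measure_unique => // _ [[x y] _ <-].
  rewrite /m /= /mscale/= /pushforward/=.
  rewrite [X in _ = (_ * lebesgue_measure X)%E](_ : _ = `](x - b) / a, (y - b) / a]%classic); last first.
    by apply/seteqP; split => v /=; rewrite !in_itv/= ltr_pdivrMr// ler_pdivlMr// => /andP[? ?]; apply/andP; split; move: (mulrC a v); lra.
  rewrite !lebesgue_measure_itv/= !lte_fin ltr_pM2r ?invr_gt0// ltrD2r.
  case: ifPn => _; last by rewrite mule0.
  by rewrite -!EFinB -EFinM; congr EFin; field; rewrite gt_eqF.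
rewrite H /m /= /mscale/= muleA -EFinM mulVf ?gt_eqF// mul1e.
by [].
Qed.

Lemma circle_measureE (A : set (circle R)) :
  circle_measure A = lebesgue_measure [set v : RT | 0 <= v < 1 /\ A (to_circle v)].
Proof. by congr lebesgue_measure; apply/seteqP; split => v /=; rewrite in_itv. Qed.

Lemma circle_measurable_shift s (A : set (circle R)) : measurable A ->
  measurable [set t | A (t + s)].
Proof.
move=> mA; rewrite -[X in measurable X]setTI.
by apply: (@measurable_circle_add _ _ id (cst s)).
Qed.

Definition slice (a b : R) (B : set RT) : set RT := [set v | a <= v < b /\ B v].

Lemma measurable_slice (a b : R) (B : set RT) : measurable B -> measurable (slice a b B).
Proof.
move=> mB; rewrite [X in measurable X](_ : _ = `[a, b[%classic `&` B); first exact: measurableI.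
by apply/seteqP; split => v /=; rewrite in_itv.
Qed.

Lemma measure_slice (a b c : R) (B : set RT) : a <= b <= c -> measurable B ->
  lebesgue_measure (slice a c B) =
  (lebesgue_measure (slice a b B) +
   lebesgue_measure (slice b c B))%E.
Proof.
move=> abc mB; rewrite -measureU//; [|exact: measurable_slice|exact: measurable_slice|].
- congr lebesgue_measure; apply/seteqP; split => v /=.
    by move=> [/andP[? ?] Bv]; have [?|?] := ltP v b; [left|right]; split => //; lra.
  by move=> [|] [/andP[? ?] Bv]; split => //; lra.
- by apply/seteqP; split => // v /= [[/andP[? ?] _] [/andP[? ?] _]]; lra.
Qed.

(** Lebesgue measure on [u, 1 + u[ is carried to [0, 1[ by translating the part
above 1. *)
Lemma circle_measure_shift s (A : set (circle R)) : measurable A ->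
  circle_measure [set t | A (t + s)] = circle_measure A.
Proof.
move=> mA; have /andP[s0 s1] := repr01_itv s; set u := repr01 s in s0 s1.
pose B := @to_circle R @^-1` A : set RT.
have mB : measurable B by rewrite -circle_measurableE.
have BS v : B (v + 1) = B v.
  by rewrite /B/=; congr A; apply/to_circle_eqP; exists 1.
have -> : circle_measure [set t | A (t + s)] =
    lebesgue_measure (slice u (1 + u) B).
  rewrite circle_measureE.
  have := @lebesgue_affine 1 u (slice u (1 + u) B) ltr01 (measurable_slice _ _ mB).
  rewrite invr1 mul1e => <-; congr lebesgue_measure; apply/seteqP; split => v /=;
    rewrite -{1}(repr01K s) -to_circleD -/u mul1r => -[? H]; split => //; lra.
rewrite (@measure_slice _ 1)//; last lra.
rewrite circle_measureE -/B (@measure_slice 0 u)//; last lra.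
rewrite addeC; congr (_ + _)%E.
have := @lebesgue_affine 1 1 (slice 1 (1 + u) B) ltr01 (measurable_slice _ _ mB).
rewrite invr1 mul1e => <-; congr lebesgue_measure; apply/seteqP; split => v;
  rewrite /slice/= mul1r BS => -[? H]; split => //; lra.
Qed.

(** The first b binary digits of t, read as an integer: t and s are in the same
dyadic interval of length 2^-b when digits b t = digits b s. *)
Definition digits (b : nat) t : int := Num.floor (2 ^+ b * repr01 t).

Lemma digits_ge0 b t : 0 <= digits b t.
Proof.
rewrite /digits Num.Theory.floor_ge_int mulr_ge0//; by have /andP[] := repr01_itv t.
Qed.

Lemma digits_lt b t : (digits b t)%:~R < 2 ^+ b :> R.
Proof.
apply: le_lt_trans (Num.Theory.floor_le _) _.
by rewrite gtr_pMr ?exprn_gt0//; have /andP[] := repr01_itv t.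
Qed.

Lemma digitsP b t : exists2 k, (k < 2 ^ b)%N & digits b t = Posz k.
Proof.
have := digits_lt b t; have := digits_ge0 b t.
by case: (digits b t) => // k _; rewrite -natrX -[k%:~R]/(k%:R) ltr_nat; exists k.
Qed.

Lemma digits0 t : digits 0 t = 0.
Proof.
have := digits_lt 0 t; rewrite expr0 -[1]/(1%:~R) ltr_int.
by have := digits_ge0 0 t; lia.
Qed.

(** The floor of 2^b u is congruent to digits b (to_circle u) modulo 2^b, and the
latter lies in [0, 2^b[. *)
Lemma digits_floor b (u v : R) :
  Num.floor (2 ^+ b * u) = Num.floor (2 ^+ b * v) ->
  digits b (to_circle u) = digits b (to_circle v).
Proof.
have E (w : R) : exists m : int, Num.floor (2 ^+ b * w) = digits b (to_circle w) + 2 ^+ b * m.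
  have /to_circle_eqP[m Hm] : to_circle w = to_circle (repr01 (to_circle w)) by rewrite repr01K.
  exists m; rewrite {1}Hm mulrDr.
  rewrite (_ : 2 ^+ b * m%:~R = (2 ^+ b * m)%:~R :> R); last by rewrite intrM rmorphXn.
  by rewrite Num.Theory.floorDrz ?intr_int// Num.Theory.intrKfloor.
have [m ->] := E u; have [n ->] := E v => H.
have lt w : digits b w < 2 ^+ b.
  by rewrite -(ltr_int R) rmorphXn; exact: digits_lt.
have := lt (to_circle u); have := lt (to_circle v).
have := digits_ge0 b (to_circle u); have := digits_ge0 b (to_circle v).
move: (digits b _) (digits b _) H => x y H *.
suff mn : m = n by move: H; rewrite mn; lia.
nia.
Qed.

(** If both grids separate u and v, a point k / 2^b and a point l / 2^b - 1/3
lie between them; then |3 (l - k) - 2^b| < 1, although 3 does not divide 2^b. *)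
Lemma third_trick b (u v : R) : `|u - v| <= 2 ^- b / 3 ->
  Num.floor (2 ^+ b * u) = Num.floor (2 ^+ b * v) \/
  Num.floor (2 ^+ b * (u + 1 / 3)) = Num.floor (2 ^+ b * (v + 1 / 3)).
Proof.
wlog uv : u v / u <= v => [th|].
  have [/th//|/ltW/th] := leP u v.
  by rewrite distrC => /[apply] -[->|->]; [left|right].
rewrite ler0_norm ?subr_le0// opprB => H.
have b0 : 0 < 2 ^+ b :> R by rewrite exprn_gt0.
have {}H : 2 ^+ b * v - 2 ^+ b * u <= 1 / 3.
  have : 2 ^+ b * (v - u) <= 2 ^+ b * (2 ^- b / 3) by rewrite ler_pM2l.
  by rewrite mulrA mulfV ?gt_eqF// mulrBr; lra.
have F (x y : R) : x <= y -> Num.floor x = Num.floor y \/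
    exists k : int, x < k%:~R /\ k%:~R <= y.
  move=> xy; have [e|ne] := eqVneq (Num.floor x) (Num.floor y); first by left.
  right; exists (Num.floor y); split; last exact: Num.Theory.floor_le.
  rewrite (lt_le_trans (Num.Theory.floorD1_gt x))// ler_int.
  by rewrite lezD1 lt_neqAle ne Num.Theory.le_floor.
have uv1 : 2 ^+ b * u <= 2 ^+ b * v by rewrite ler_pM2l.
have uv2 : 2 ^+ b * (u + 1 / 3) <= 2 ^+ b * (v + 1 / 3) by rewrite ler_pM2l// lerD2r.
have [?|[k [k1 k2]]] := F _ _ uv1; first by left.
have [?|[l [l1 l2]]] := F _ _ uv2; first by right.
(* A grid point k separates 2^b u from 2^b v, and l separates the translates. *)
exfalso.
pose T : int := 2 ^+ b.
have TE : T%:~R = 2 ^+ b :> R by rewrite rmorphXn.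
have [q T3] : exists q : int, T = 3 * q + 1 \/ T = 3 * q + 2.
  rewrite /T; elim: b {u v uv uv1 uv2 H b0 k k1 k2 l l1 l2 T TE} => [|b [q IH]]; first by exists 0; left.
  rewrite exprS; move: (2 ^+ b) IH => z [->|->]; [exists (2 * q); right|exists (2 * q + 1); left]; lia.
have E : (3 * (l - k) - T)%:~R = 3 * (l%:~R - k%:~R) - 2 ^+ b :> R.
  by rewrite rmorphB rmorphM rmorphB /= TE.
have A1 : (3 * (l - k) - T)%:~R < 1%:~R :> R by rewrite E; lra.
have A2 : (-1)%:~R < (3 * (l - k) - T)%:~R :> R by rewrite E; lra.
move: A1 A2; rewrite !ltr_int; lia.
Qed.

(** The first b digits of x followed by the digits of y. *)
Definition redraw (b : nat) x y : circle R :=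
  to_circle (((digits b x)%:~R + repr01 y) / 2 ^+ b).

Lemma repr01_redraw b x y : repr01 (redraw b x y) = ((digits b x)%:~R + repr01 y) / 2 ^+ b.
Proof.
have b0 : 0 < 2 ^+ b :> R by rewrite exprn_gt0.
rewrite /redraw repr01_to_circle// ; have /andP[y0 y1] := repr01_itv y.
have d0 : 0 <= (digits b x)%:~R :> R by rewrite ler0z digits_ge0.
apply/andP; split; first by apply: divr_ge0; [exact: addr_ge0|exact: ltW].
rewrite ltr_pdivrMr// mul1r.
have : digits b x + 1 <= 2 ^+ b by rewrite lezD1 -(ltr_int R) rmorphXn; exact: digits_lt.
by rewrite -(ler_int R) rmorphXn intrD/= => ?; lra.
Qed.

Lemma digits_redraw a b x y : (a <= b)%N -> digits a (redraw b x y) = digits a x.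
Proof.
move=> ab; rewrite /digits; apply: Num.Theory.floor_def.
rewrite repr01_redraw.
have a0 : 0 < 2 ^+ a :> R by rewrite exprn_gt0.
have c0 : 0 < 2 ^+ (b - a) :> R by rewrite exprn_gt0.
have -> : 2 ^+ b = 2 ^+ a * 2 ^+ (b - a) :> R by rewrite -exprD subnKC.
have -> : 2 ^+ a * (((digits b x)%:~R + repr01 y) / (2 ^+ a * 2 ^+ (b - a))) =
   ((digits b x)%:~R + repr01 y) / 2 ^+ (b - a) by field; rewrite !gt_eqF.
have /andP[y0 y1] := repr01_itv y.
have /andP[l1 l2] := Num.Theory.floor_itv (2 ^+ a * repr01 x).
have /andP[k1 k2] := Num.Theory.floor_itv (2 ^+ b * repr01 x).
rewrite -/(digits a x) -/(digits b x) in l1 l2 k1 k2 *.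
rewrite ler_pdivlMr// ltr_pdivrMr//.
have bE : 2 ^+ b = 2 ^+ a * 2 ^+ (b - a) :> R by rewrite -exprD subnKC.
have CE : (2 ^+ (b - a) : int)%:~R = 2 ^+ (b - a) :> R by rewrite rmorphXn.
set C : int := 2 ^+ (b - a) in CE; rewrite -CE in c0 bE *.
have H1 : digits a x * C <= digits b x.
  rewrite Num.Theory.floor_ge_int bE intrM mulrAC ler_pM2r//.
have H2 : digits b x + 1 <= (digits a x + 1) * C.
  rewrite lezD1 -(ltr_int R) (le_lt_trans k1)// bE intrM mulrAC ltr_pM2r//.
have {}H1 : (digits a x)%:~R * C%:~R <= (digits b x)%:~R :> R by rewrite -intrM ler_int.
have {}H2 : (digits b x)%:~R + 1 <= (digits a x + 1)%:~R * C%:~R :> R.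
  by rewrite -intrM -(intrD R _ 1) ler_int.
by apply/andP; split; lra.
Qed.

Lemma redraw_redraw a b x y z : (a <= b)%N -> redraw a (redraw b x y) z = redraw a x z.
Proof. by move=> ab; rewrite /redraw digits_redraw. Qed.

Lemma redraw0 x y : redraw 0 x y = y.
Proof. by rewrite /redraw digits0 expr0 divr1 add0r repr01K. Qed.

Lemma measurable_digits b : measurable_fun setT (fun x : circle R => (digits b x)%:~R : RT).
Proof.
apply: (measurableT_comp measurable_floorr).
apply: (@measurable_funM _ _ R setT (cst _) repr01) => //; exact: measurable_repr01.
Qed.

Lemma measurable_redraw b d (X : measurableType d) (f g : X -> circle R) :
  measurable_fun setT f -> measurable_fun setT g ->
  measurable_fun setT (fun x => redraw b (f x) (g x)).
Proof.
move=> mf mg; apply: (measurableT_comp measurable_to_circle).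
apply: (@measurable_funM _ _ R setT _ (cst _)) => //.
apply: (@measurable_funD _ _ R setT).
  exact: (measurableT_comp (measurable_digits b)).
exact: (measurableT_comp measurable_repr01).
Qed.

Lemma measurable_cell b (k : int) : measurable [set x : circle R | digits b x = k].
Proof.
rewrite [X in measurable X](_ : _ = (fun x : circle R => (digits b x)%:~R : RT) @^-1` [set k%:~R]).
  by rewrite -[X in measurable X]setTI; apply: measurable_digits.
by apply/seteqP; split => x /=; [move=> -> | move/intr_inj].
Qed.

Lemma circle_measure_cell b k : (k < 2 ^ b)%N ->
  circle_measure [set x | digits b x = k] = (2 ^- b : R)%:E.
Proof.
move=> kb; have b0 : 0 < 2 ^+ b :> R by rewrite exprn_gt0.
have kS : k.+1%:R = k%:R + 1 :> R by rewrite -natr1.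
have kb1 : k.+1%:R <= 2 ^+ b :> R by rewrite -natrX ler_nat.
rewrite circle_measureE [X in lebesgue_measure X](_ : _ =
  `[k%:R / 2 ^+ b, k.+1%:R / 2 ^+ b[%classic).
  rewrite lebesgue_measure_itv/= lte_fin ltr_pM2r ?invr_gt0// ltr_nat ltnSn.
  by rewrite -EFinB -mulrBl kS addrC addKr mul1r.
apply/seteqP; split => v /=; rewrite in_itv/= ler_pdivrMr// ltr_pdivlMr//.
  move=> [v01]; rewrite /digits repr01_to_circle// => H.
  have := Num.Theory.floor_itv (2 ^+ b * v); rewrite H intrD kS (mulrC v).
  exact.
move=> /andP[v0 v1].
have v01 : 0 <= v < 1.
  rewrite -(pmulr_lge0 _ b0) (le_trans _ v0)//=.
  by rewrite -(ltr_pM2r b0) mul1r (lt_le_trans v1).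
split => //; rewrite /digits repr01_to_circle//.
by apply: Num.Theory.floor_def; rewrite mulrC v0 intrD -kS.
Qed.

(** An affine map carries y to the redrawn point, inside the k-th dyadic
interval of length 2^-b. *)
Lemma circle_measure_redraw b k (A : set (circle R)) : (k < 2 ^ b)%N -> measurable A ->
  ((2 ^- b)%:E * circle_measure [set y | A (to_circle ((k%:R + repr01 y) / 2 ^+ b))] =
   lebesgue_measure (slice (k%:R / 2 ^+ b) (k.+1%:R / 2 ^+ b) (@to_circle R @^-1` A)))%E.
Proof.
move=> kb mA; have b0 : 0 < 2 ^+ b :> R by rewrite exprn_gt0.
have b0' : 0 < 2 ^- b :> R by rewrite invr_gt0.
have mB : measurable (@to_circle R @^-1` A : set RT) by rewrite -circle_measurableE.
have := @lebesgue_affine (2 ^- b) (k%:R / 2 ^+ b) _ b0' (measurable_slice (k%:R / 2 ^+ b) (k.+1%:R / 2 ^+ b) mB).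
rewrite invrK => H; rewrite [X in circle_measure X](_ : _ = [set y | A (to_circle (2 ^- b * repr01 y + k%:R / 2 ^+ b))]); last first.
  have E (y : circle R) : (k%:R + repr01 y) / 2 ^+ b = 2 ^- b * repr01 y + k%:R / 2 ^+ b.
    by rewrite mulrDl addrC (mulrC (repr01 y)).
  by apply/seteqP; split => y /=; rewrite E.
rewrite circle_measureE [X in (_ * lebesgue_measure X)%E](_ : _ = [set v | slice (k%:R / 2 ^+ b) (k.+1%:R / 2 ^+ b)
         (to_circle (R:=R) @^-1` A) (2 ^- b * v + k%:R / 2 ^+ b)]).
  by rewrite H muleA -EFinM mulVf ?mul1e// gt_eqF.
apply/seteqP; split => v.
  move=> [v01 /=]; rewrite /slice/= repr01_to_circle// => ?; split => //.
  rewrite (mulrC (2 ^- b)) -mulrDl ler_pM2r ?ltr_pM2r// -natr1; lra.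
rewrite /slice/= (mulrC (2 ^- b)) -mulrDl ler_pM2r// ltr_pM2r// -natr1 => -[vk ?].
have v01 : 0 <= v < 1 by lra.
by split => //=; rewrite repr01_to_circle// (mulrC (2 ^- b)) -mulrDl.
Qed.

Lemma sum_circle_measure_redraw b (A : set (circle R)) : measurable A ->
  (\sum_(k < 2 ^ b) (2 ^- b)%:E * circle_measure [set y | A (to_circle ((k%:R + repr01 y) / 2 ^+ b))] =
   circle_measure A)%E.
Proof.
move=> mA.
have b0 : 0 < 2 ^+ b :> R by rewrite exprn_gt0.
have mB : measurable (@to_circle R @^-1` A : set RT) by rewrite -circle_measurableE.
rewrite (eq_bigr (fun k : 'I_(2 ^ b) => lebesgue_measure (slice (k%:R / 2 ^+ b) (k.+1%:R / 2 ^+ b) (@to_circle R @^-1` A)))); last first.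
  by move=> k _; exact: circle_measure_redraw.
have H n : (\sum_(k < n) lebesgue_measure (slice (k%:R / 2 ^+ b) (k.+1%:R / 2 ^+ b) (@to_circle R @^-1` A)) =
   lebesgue_measure (slice 0 (n%:R / 2 ^+ b) (@to_circle R @^-1` A)))%E.
  elim: n => [|n IH].
    rewrite big_ord0 mul0r (_ : slice _ _ _ = set0) ?measure0//.
    by apply/seteqP; split => // v [/andP[? ?] _]; lra.
  rewrite big_ord_recr/= IH -measure_slice//; apply/andP; split; first by rewrite divr_ge0// ltW.
  by rewrite ler_pM2r ?invr_gt0// ler_nat.
rewrite H natrX divff ?gt_eqF// circle_measureE.
Qed.

End circle.

(** * Resampling digits on the infinite torus *)

Section torus.
Context {R : realType}.
Local Notation X := (torus R).

Lemma measurable_coord i : measurable_fun setT (fun x : X => x i : circle R).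
Proof.
move=> _ A mA; rewrite setTI; apply: sub_sigma_algebra.
by exists i => //; exists A => //; rewrite setTI.
Qed.

Lemma measurable_torus d (Y : measurableType d) (f : Y -> X) :
  (forall i, measurable_fun setT (fun y => f y i : circle R)) ->
  measurable_fun setT f.
Proof.
move=> mf; apply: (@measurability _ _ _ X _ _ (\bigcup_i preimage_set_system setT
  (fun x : nat -> circle R => x i) measurable)) => //.
move=> _ [B [i _ [A mA <-]] <-]; rewrite !setTI.
by rewrite -[X in measurable X]setTI; exact: (mf i).
Qed.

Definition cylinder n (A : nat -> set (circle R)) : set X :=
  [set x | forall i, (i < n)%N -> A i (x i)].

Lemma measurable_cylinder n A : (forall i, measurable (A i)) ->
  measurable (cylinder n A).
Proof.
move=> mA; rewrite [X in measurable X](_ : _ = \bigcap_(i in `I_n) ((fun x : X => x i) @^-1` A i)) //.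
apply: bigcap_measurableType => i _; rewrite -[X in measurable X]setTI.
exact: measurable_coord.
Qed.

Lemma measurable_coord_preimage i (A : set (circle R)) : measurable A ->
  measurable [set x : X | A (x i)].
Proof. by move=> mA; rewrite -[X in measurable X]setTI; exact: measurable_coord. Qed.

(** The cylinders are stable under intersection and generate the product
sigma-algebra. *)
Lemma eq_measure_cylinder (m1 m2 : {measure set X -> \bar R}) :
  (forall n A, (forall i, measurable (A i)) -> m1 (cylinder n A) = m2 (cylinder n A)) ->
  (m1 setT < +oo)%E -> forall B, measurable B -> m1 B = m2 B.
Proof.
move=> m12 m1oo B mB.
pose G : set (set X) := [set C | exists n A, (forall i, measurable (A i)) /\ C = cylinder n A].
have GT : G setT.
  by exists 0%N, (fun=> setT); split => //; apply/seteqP; split => // x _ i.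
apply: (@measure_unique _ R X G (fun=> setT)) => //.
- apply/seteqP; split => [C|].
    apply: smallest_sub; first exact: smallest_sigma_algebra.
    move=> _ [i _ [A mA <-]]; apply: sub_sigma_algebra.
    exists i.+1, (fun j => if j == i then A else setT); split.
      by move=> j; case: ifP.
    rewrite setTI; apply/seteqP; split => x /=.
      by move=> Ax j _; case: eqP => // ->.
    by move=> /(_ i (ltnSn i)); rewrite eqxx.
  apply: smallest_sub; first exact: sigma_algebra_measurable.
  by move=> _ [n [A [mA ->]]]; exact: measurable_cylinder.
- move=> _ _ [n [A [mA ->]]] [m [A' [mA' ->]]].
  exists (maxn n m), (fun i => (if (i < n)%N then A i else setT) `&` (if (i < m)%N then A' i else setT)).
  split; first by move=> i; apply: measurableI; case: ifP.
  apply/seteqP; split => x /=.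
    by move=> [H1 H2] i _; split; case: ifPn => // ?; [apply: H1|apply: H2].
  move=> H; split=> i ni.
    by have := H i; rewrite leq_max ni => /(_ isT)[].
  by have := H i; rewrite leq_max ni orbT => /(_ isT)[].
- by rewrite -subTset => x _; exists 0%N.
- by move=> _ [n [A [mA ->]]]; exact: m12.
Qed.

Variable P : probability X R.
Hypothesis hP : is_product_measure P.

Lemma circle_measureT : circle_measure [set: circle R] = 1%E.
Proof.
rewrite /circle_measure preimage_setT setIT lebesgue_measure_itv/= lte_fin ltr01.
by rewrite -EFinB subr0.
Qed.

Lemma coord_law i A : measurable A -> P [set x | A (x i)] = circle_measure A.
Proof.
move=> mA; have := @hP i.+1 (fun j => if j == i then A else setT).
have -> : [set x : X | forall j, (j < i.+1)%N -> (if j == i then A else setT) (x j)] = [set x | A (x i)].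
  apply/seteqP; split => x /=.
    by move=> /(_ i (ltnSn i)); rewrite eqxx.
  by move=> Ax j _; case: eqP => // ->.
move=> ->; last by move=> j; case: ifP.
rewrite big_ord_recr/= eqxx big1 ?mul1e// => j _.
by rewrite ltn_eqF// circle_measureT.
Qed.

Lemma resampling_cylinder (r : X * X -> X) : measurable_fun setT r ->
  (forall n A, (forall i, measurable (A i)) ->
     (P \x P)%E (r @^-1` cylinder n A) = (\prod_(i < n) circle_measure (A i))%E) ->
  resampling P r.
Proof.
move=> mr H; split => // A mA.
pose p : {measure set X -> \bar R} := pushforward (P \x P)%E r.
rewrite -[LHS]/(p mr A); apply: eq_measure_cylinder => //.
  by move=> n B mB; rewrite hP//; exact: H.
rewrite /p/= /pushforward preimage_setT.
have := H 0%N (fun=> setT) (fun i => measurableT).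
rewrite big_ord0 (_ : cylinder 0 _ = setT) ?preimage_setT.
  by move=> ->; rewrite ltry.
by apply/seteqP; split.
Qed.

Definition merge (S : pred nat) (z : X * X) : X := fun i => if S i then z.1 i else z.2 i.

Let mfst i : measurable_fun setT (fun z : X * X => z.1 i : circle R).
Proof. exact: (measurableT_comp (measurable_coord i) measurable_fst). Qed.

Let msnd i : measurable_fun setT (fun z : X * X => z.2 i : circle R).
Proof. exact: (measurableT_comp (measurable_coord i) measurable_snd). Qed.

(** This is the independence of the coordinates in S from the others. *)
Lemma resampling_merge S : resampling P (merge S).
Proof.
apply: resampling_cylinder.
  apply: measurable_torus => i; rewrite /merge.
  by case: (S i); [exact: mfst|exact: msnd].
move=> n A mA.
rewrite [X in (P \x P)%E X](_ : _ = cylinder n (fun i => if S i then A i else setT) `*`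
  cylinder n (fun i => if S i then setT else A i)).
  rewrite product_measure1E; try by apply: measurable_cylinder => i; case: (S i).
  have -> := @hP n (fun i => if S i then A i else setT).
    have -> := @hP n (fun i => if S i then setT else A i).
      rewrite -big_split/=; apply: eq_bigr => i _.
      by case: (S i); rewrite circle_measureT ?mule1 ?mul1e.
    by move=> i; case: (S i).
  by move=> i; case: (S i).
apply/seteqP; split => [[x y]|[x y]] /=.
  by move=> H; split => i /= ni; have := H i ni; rewrite /merge/=; case: (S i).
by move=> [H1 H2] i ni; have := H1 i ni; have := H2 i ni; rewrite /merge/=; case: (S i).
Qed.

Lemma integral_indep (S : pred nat) (f g : X -> \bar R) :
  measurable_fun setT f -> (forall x, 0 <= f x)%E ->
  measurable_fun setT g -> (forall x, 0 <= g x)%E ->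
  (forall x y, (forall i, S i -> x i = y i) -> f x = f y) ->
  (forall x y, (forall i, ~~ S i -> x i = y i) -> g x = g y) ->
  (\int[P]_x (f x * g x) = \int[P]_x f x * \int[P]_x g x)%E.
Proof.
move=> mf f0 mg g0 fS gS.
have mfg : measurable_fun setT (fun x => f x * g x)%E by exact: emeasurable_funM.
rewrite -(integral_resampling (resampling_merge S) mfg); last by move=> x; rewrite mule_ge0.
rewrite (eq_integral (fun z : X * X => f z.1 * g z.2)%E); last first.
  move=> [x y] _ /=; congr (_ * _)%E; [apply: fS|apply: gS] => i Si; rewrite /merge/=.
    by rewrite Si.
  by rewrite (negbTE Si).
rewrite fubini_tonelli1/=; last 2 first.
- by apply: emeasurable_funM; [exact: (measurableT_comp mf)|exact: (measurableT_comp mg)].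
- by move=> z; rewrite mule_ge0.
rewrite /fubini_F -ge0_integralZr//; last exact: integral_ge0.
by apply: eq_integral => x _; rewrite /= ge0_integralZl.
Qed.

Lemma measurable_prode n (phi : nat -> X -> \bar R) :
  (forall i, measurable_fun setT (phi i)) ->
  measurable_fun setT (fun x => \prod_(i < n) phi i x)%E.
Proof.
move=> mphi; elim: n => [|n IH].
  rewrite (_ : (fun x : X => _) = cst 1%E)//.
  by apply/funext => x; rewrite big_ord0.
rewrite (_ : (fun x : X => _) = fun x => (\prod_(i < n) phi i x) * phi n x)%E.
  exact: emeasurable_funM.
by apply/funext => x; rewrite big_ord_recr.
Qed.

Lemma integral_prod_coord n (phi : nat -> X -> \bar R) :
  (forall i, measurable_fun setT (phi i)) -> (forall i x, 0 <= phi i x)%E ->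
  (forall i (x y : X), x i = y i -> phi i x = phi i y) ->
  (\int[P]_x \prod_(i < n) phi i x = \prod_(i < n) \int[P]_x phi i x)%E.
Proof.
move=> mphi phi0 phiS; elim: n => [|n IH].
  by rewrite big_ord0; under eq_integral do rewrite big_ord0; rewrite integral_prob_cst.
rewrite big_ord_recr -IH/=; under eq_integral do rewrite big_ord_recr/=.
apply: (@integral_indep (fun i => i < n)%N) => //.
- exact: measurable_prode.
- by move=> x; exact: prode_ge0.
- move=> x y H; apply: eq_bigr => i _; apply: phiS; exact: H.
- by move=> x y H; apply: phiS; apply: H; rewrite ltnn.
Qed.

(** Level None keeps the coordinate.  The translation by s moves the dyadic grid,
and fejer_dyadic uses s = 0 and s = 1/3. *)
Definition redraw_at (l : option nat) (s x y : circle R) : circle R :=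
  if l is Some b then redraw b (x + s) y - s else x.

Definition resample (l : nat -> option nat) (s : nat -> circle R) (z : X * X) : X :=
  fun i => redraw_at (l i) (s i) (z.1 i) (z.2 i).

Lemma measurable_redraw_at l s d (Y : measurableType d) (f g : Y -> circle R) :
  measurable_fun setT f -> measurable_fun setT g ->
  measurable_fun setT (fun x => redraw_at l s (f x) (g x)).
Proof.
move=> mf mg; case: l => [b|]//=; apply: measurable_circle_add => //.
by apply: measurable_redraw => //; exact: measurable_circle_add.
Qed.

Lemma measurable_resample l s : measurable_fun setT (resample l s).
Proof. by apply: measurable_torus => i; exact: measurable_redraw_at. Qed.

Let redraw_at_law l s i (A : set (circle R)) : measurable A ->
  (\int[P]_x P [set y | A (redraw_at l s (x i) (y i))] = circle_measure A)%E.
Proof.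
move=> mA; case: l => [b|]/=; last first.
  rewrite -(coord_law i mA) -[in RHS](setIT [set x | A (x i)]) -integral_indic//; last first.
    exact: measurable_coord_preimage.
  apply: eq_integral => x _; rewrite indicE; have [Ax|Ax] := boolP (x \in _).
    rewrite (_ : [set _ | _] = setT) ?probability_setT//.
    by apply/seteqP; split => // y _; move: Ax; rewrite inE.
  rewrite (_ : [set _ | _] = set0) ?measure0//.
  by apply/seteqP; split => // y /= Ay; move: Ax; rewrite notin_setE.
pose B := [set v : circle R | A (v - s)].
have mB : measurable B by exact: circle_measurable_shift.
pose Bk (k : nat) : set (circle R) :=
  [set y | B (to_circle ((k%:R + repr01 y) / 2 ^+ b))].
have mBk k : measurable (Bk k).
  rewrite -[X in measurable X]setTI.
  apply: (measurableT_comp measurable_to_circle) => //.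
  apply: (@measurable_funM _ _ R setT _ (cst _)) => //.
  by apply: (@measurable_funD _ _ R setT (cst _) repr01) => //; exact: measurable_repr01.
rewrite -(circle_measure_shift (- s) mA) -/B -(sum_circle_measure_redraw b mB).
pose C (k : 'I_(2 ^ b)) := [set x : X | digits b (x i + s) = k].
have mC k : measurable (C k).
  apply: (@measurable_coord_preimage i [set x | digits b (x + s) = k]).
  exact: (circle_measurable_shift s (measurable_cell b k)).
transitivity (\int[P]_x \sum_(k < 2 ^ b) (circle_measure (Bk k) * (\1_(C k) x)%:E))%E.
  apply: eq_integral => x _.
  have [d db dE] := digitsP b (x i + s).
  rewrite (bigD1 (Ordinal db))//= [X in (_ + X)%E]big1 => [|k /eqP kd]; last first.
    rewrite indicE memNset ?mule0// /C/= dE => -[kE]; apply: kd; exact: val_inj.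
  rewrite adde0 indicE mem_set ?mule1; last by rewrite /C/= dE.
  rewrite -(coord_law i)//; congr (P _); apply/seteqP.
  by split => y /=; rewrite /redraw dE.
rewrite ge0_integral_sum//; last 2 first.
- move=> k; apply: measurable_funeM; apply/measurable_EFinP; exact/measurable_indicP.
- by move=> k x _; rewrite mule_ge0// lee_fin.
apply: eq_bigr => k _; rewrite ge0_integralZl//.
rewrite integral_indic// setIT muleC; congr (_ * _)%E.
apply: etrans (coord_law i (circle_measurable_shift s (measurable_cell b k))) _.
rewrite (circle_measure_shift s (measurable_cell b k)).
  exact: circle_measure_cell.
by apply/measurable_EFinP; exact/measurable_indicP.
Qed.

(** On each cylinder the product structure reduces the claim to one coordinate,
where the law of the redrawn point is computed on each dyadic interval. *)
Lemma resampling_resample l s : resampling P (resample l s).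
Proof.
apply: resampling_cylinder; first exact: measurable_resample.
move=> n A mA.
have mE i : measurable [set z : X * X | A i (redraw_at (l i) (s i) (z.1 i) (z.2 i))].
  by rewrite -[X in measurable X]setTI; exact: measurable_redraw_at.
have my i (c : circle R) : measurable [set v | A i (redraw_at (l i) (s i) c v)].
  rewrite -[X in measurable X]setTI.
  exact: (@measurable_redraw_at _ _ _ _ (cst c) id).
transitivity (\int[P]_x \prod_(i < n) P [set y | A i (redraw_at (l i) (s i) (x i) (y i))])%E.
  rewrite /product_measure1/=; apply: eq_integral => x _.
  rewrite (_ : xsection _ _ = cylinder n (fun i => [set v | A i (redraw_at (l i) (s i) (x i) v)])).
    by rewrite hP//; apply: eq_bigr => i _; rewrite (coord_law i (my i _)).
  by apply/seteqP; split => y; rewrite /xsection/= inE.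
rewrite (@integral_prod_coord n (fun i x => P [set y | A i (redraw_at (l i) (s i) (x i) (y i))])).
- by apply: eq_bigr => i _; exact: redraw_at_law.
- move=> i; have := measurable_fun_xsection P (mE i).
  congr measurable_fun; apply/funext => x /=; congr (P _).
  by apply/seteqP; split => y; rewrite /xsection/= inE.
- by move=> i x; exact: measure_ge0.
- by move=> i x y ->.
Qed.

(** None stands for an infinite level. *)
Definition le_level (l l' : option nat) : bool :=
  match l, l' with
  | _, None => true
  | Some a, Some b => (a <= b)%N
  | None, Some _ => false
  end.

Lemma redraw_at_nested l l' s (x y z : circle R) : le_level l l' ->
  redraw_at l s (redraw_at l' s x y) z = redraw_at l s x z.
Proof.
by case: l l' => [a|] [b|]//= ab; rewrite subrK redraw_redraw.
Qed.

Lemma resample_nested l l' s x y z : (forall i, le_level (l i) (l' i)) ->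
  resample l s (resample l' s (x, y), z) = resample l s (x, z).
Proof. by move=> ll'; apply/funext => i; exact: redraw_at_nested. Qed.

Lemma nested_resample (l : nat -> nat -> option nat) s :
  (forall m n i, (m <= n)%N -> le_level (l m i) (l n i)) ->
  nested_resamplings P (fun n => resample (l n) s).
Proof.
move=> H; split=> [n|m n x y z mn]; first exact: resampling_resample.
by apply: resample_nested => i; exact: H.
Qed.

(** Redrawing two disjoint sets of coordinates in turn redraws their union; the
two independent copies are merged into one. *)
Lemma cond_mean_comp l l' s (f : X -> \bar R) :
  measurable_fun setT f -> (forall x, 0 <= f x)%E ->
  (forall i, l i = None \/ l' i = None) ->
  forall x, cond_mean P (resample l s) (cond_mean P (resample l' s) f) x =
  cond_mean P (resample (fun i => if l i is None then l' i else l i) s) f x.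
Proof.
move=> mf f0 ll' x; set l2 := (fun i : nat => if l i is None then l' i else l i).
pose S i := l i != None.
have mr := @measurable_resample l2 s.
rewrite {3}/cond_mean -(integral_resampling (resampling_merge S) (measurable_section x mr mf))//.
have mm := (resampling_merge S).1.
rewrite (@fubini_tonelli1 _ _ _ _ _ P P (fun z => f (resample l2 s (x, merge S z)))); last 2 first.
- exact: (measurableT_comp (measurable_section x mr mf) mm).
- by move=> z; exact: f0.
apply: eq_integral => y _; apply: eq_integral => z _ /=; congr f.
apply/funext => i; rewrite /resample/merge/S/l2/=.
by case: (ll' i) => -> //=; case: (l i).
Qed.

Definition cell (p : nat) (b : nat -> nat) (s : nat -> circle R) (x : X) : set X :=
  cylinder p (fun i => [set t | digits (b i) (t + s i) = digits (b i) (x i + s i)]).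

(** The mean of f over a cell is its conditional mean given the digits that
define the cell; each of the p sides has length 2^-(b i). *)
Lemma integral_cell p b s (f : X -> \bar R) x :
  measurable_fun setT f -> (forall x, 0 <= f x)%E ->
  (\int[P]_t ((\1_(cell p b s x) t)%:E * f t) =
   (\prod_(i < p) 2 ^- b i)%:E *
   cond_mean P (resample (fun i => Some (if (i < p)%N then b i else 0%N)) s) f x)%E.
Proof.
move=> mf f0; set l := (fun i : nat => Some (if (i < p)%N then b i else 0%N)).
have mA i : measurable [set t : circle R | digits (b i) (t + s i) = digits (b i) (x i + s i)].
  exact: (circle_measurable_shift (s i) (measurable_cell (b i) _)).
have mc : measurable (cell p b s x) by exact: measurable_cylinder.
have m1 : measurable_fun setT (fun t => (\1_(cell p b s x) t : R)%:E).
  by apply/measurable_EFinP/measurable_indicP.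
rewrite -(integral_cond_mean_pull (resampling_resample l s))//; last first.
  move=> t y; congr EFin; rewrite !indicE; congr ((_ : bool)%:R).
  apply/idP/idP; rewrite !inE => H i ip; have := H i ip; rewrite /resample/l/= ip subrK digits_redraw//.
transitivity (\int[P]_t (cond_mean P (resample l s) f x * (\1_(cell p b s x) t)%:E))%E.
  apply: eq_integral => t _; rewrite muleC indicE; have [|_] := boolP (t \in _); last by rewrite !mule0.
  rewrite inE => tc; congr (_ * _)%E; apply: eq_integral => y _; congr f.
  apply/funext => i; rewrite /resample/l/=; case: ifP => ip; last by rewrite !redraw0.
  by congr (_ - _); rewrite /redraw (tc i ip).
rewrite ge0_integralZl//.
  rewrite integral_indic// setIT muleC; congr (_ * _)%E.
  rewrite /cell hP// -prodEFin; apply: eq_bigr => i _.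
  rewrite (circle_measure_shift (s i) (measurable_cell (b i) _)).
  by have [k kb ->] := digitsP (b i) (x i + s i); exact: circle_measure_cell.
exact: cond_mean_ge0.
Qed.

End torus.

(** * The Fejer kernel and its dyadic majorant *)

Section fejer_kernel.
Context {R : realType}.
Local Notation C := R[i].

Definition cexp (u : R) : C := cos (2 * pi * u) +i* sin (2 * pi * u).

Lemma cexpD u v : cexp (u + v) = cexp u * cexp v.
Proof.
rewrite /cexp mulrDr cosD sinD; apply/eqP; rewrite eq_complex/=.
by apply/andP; split; apply/eqP; ring.
Qed.

Lemma cexp0 : cexp 0 = 1.
Proof. by rewrite /cexp mulr0 cos0 sin0. Qed.

Lemma cexpN u : cexp u * cexp (- u) = 1.
Proof. by rewrite -cexpD subrr cexp0. Qed.

Lemma cexp_nat (n : nat) : cexp n%:R = 1.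
Proof.
elim: n => [|n IH]; first exact: cexp0.
rewrite -natr1 cexpD IH mul1r /cexp mulr1.
by rewrite (_ : 2 * pi = pi *+ 2) ?mulr_natl// cos2pi sin2pi.
Qed.

Lemma cexp_int (m : int) : cexp m%:~R = 1.
Proof.
case: m => n; first exact: cexp_nat.
rewrite NegzE rmorphN/= -[LHS]mul1r -{1}(cexp_nat n.+1).
exact: cexpN.
Qed.

Lemma cexp_mulrn u (n : nat) : cexp (n%:R * u) = cexp u ^+ n.
Proof.
elim: n => [|n IH]; first by rewrite mul0r cexp0 expr0.
by rewrite -natr1 mulrDl mul1r cexpD IH exprSr.
Qed.

Lemma normc_cexp u : normc (cexp u) = 1.
Proof. by rewrite /cexp /normc cos2Dsin2 sqrtr1. Qed.

Lemma characterE j u : character j (to_circle u) = cexp (j%:~R * u).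
Proof.
have /to_circle_eqP [m Hm] : to_circle u = to_circle (repr (to_circle u)) by rewrite to_circle_repr.
move: Hm; rewrite /character; move: (repr _) => w ->.
by rewrite (mulrDr j%:~R) cexpD -intrM cexp_int mulr1 /cexp !mulrA.
Qed.

(** The Fejer kernel is |geo l u|^2 / (l + 1). *)
Definition geo (l : nat) (u : R) : C := \sum_(k < l.+1) cexp (k%:R * u).

(** On the right, the passage from l to l + 1 adds the Dirichlet sum of order
l + 1, which is 1 plus the cross terms of cexp ((l + 1) u) with geo. *)
Lemma geo_expand l u : geo l u * geo l (- u) =
  \sum_(r < l.+1) \sum_(k < r.*2.+1) cexp ((k%:Z - r%:Z)%:~R * u).
Proof.
elim: l => [|l IH].
  by rewrite /geo !big_ord1 !mul0r cexp0 mulr1 [RHS](_ : _ = \sum_(k < 1) cexp ((k%:Z - 0)%:~R * u))// big_ord1 subrr mul0r cexp0.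
rewrite big_ord_recr/= -IH.
have geoS v : geo l.+1 v = geo l v + cexp (l.+1%:R * v) by rewrite /geo big_ord_recr.
rewrite !geoS mulrDl !mulrDr -!addrA; congr (_ + _).
rewrite -(big_mkord xpredT (fun k => cexp ((k%:Z - l.+1%:Z)%:~R * u))).
rewrite (@big_cat_nat _ _ _ l.+1)//=; last by rewrite doubleS -addnn; lia.
congr (_ + _).
  rewrite /geo big_mkord mulr_suml; apply: eq_bigr => k _.
  by rewrite -cexpD; congr cexp; rewrite rmorphB/= mulrBl mulrN.
rewrite [in RHS]big_nat_recl/=; last by rewrite doubleS -addnn; lia.
rewrite subrr mul0r cexp0 addrC mulrN cexpN; congr (_ + _).
rewrite /geo mulr_sumr.
rewrite (_ : \sum_(l.+1 <= i < l.+1.*2) _ =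
  \sum_(0 <= i < l.+1) cexp (((i + l.+1).+1%:Z - l.+1%:Z)%:~R * u)); last first.
  by rewrite -{1}[l.+1]add0n big_addn -addnn addnK.
rewrite big_nat_rev/= big_mkord; apply: eq_bigr => k _.
rewrite -cexpD; congr cexp; rewrite add0n subSS mulrN -mulrBl; congr (_ * _).
have kl : (k <= l)%N by rewrite -ltnS.
have -> : ((l - k + l.+1).+1%:Z - l.+1%:Z) = l.+1%:Z - k%:Z by lia.
by rewrite rmorphB.
Qed.

Lemma geo_conj l u : geo l u * geo l (- u) = (normc (geo l u) ^+ 2)%:C.
Proof.
have -> : geo l (- u) = (geo l u)^*.
  rewrite /geo rmorph_sum; apply: eq_bigr => k _.
  by rewrite mulrN /cexp/= mulrN cosN sinN.
case: (geo l u) => a b; rewrite /normc sqr_sqrtr ?addr_ge0 ?sqr_ge0//.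
apply/eqP; rewrite eq_complex/=; apply/andP; split; apply/eqP; ring.
Qed.

Definition fejer (l : nat) (t : circle R) : R := complex.Re (fejer_kernel l t).

Let fejerE' l u : fejer_kernel l (to_circle u) = ((l.+1%:R)^-1 * normc (geo l u) ^+ 2)%:C.
Proof.
rewrite /fejer_kernel rmorphM /= -geo_conj geo_expand; congr (_ * _).
  by rewrite fmorphV rmorph_nat.
apply: eq_bigr => r _; apply: eq_bigr => k _; exact: characterE.
Qed.

Lemma fejer_kernelE l t : fejer_kernel l t = (fejer l t)%:C.
Proof. by rewrite /fejer -(repr01K t) fejerE'. Qed.

Lemma fejerE l u : fejer l (to_circle u) = (l.+1%:R)^-1 * normc (geo l u) ^+ 2.
Proof. by rewrite /fejer fejerE'. Qed.

Lemma fejer_ge0 l t : 0 <= fejer l t.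
Proof. by rewrite -(repr01K t) fejerE mulr_ge0// ?invr_ge0// sqr_ge0. Qed.

Lemma fejer_le l t : fejer l t <= l.+1%:R.
Proof.
rewrite -(repr01K t) fejerE; set u := repr01 t.
have H : normc (geo l u) <= l.+1%:R.
  rewrite /geo; elim: l => [|l IH].
    by rewrite big_ord1 normc_cexp.
  rewrite big_ord_recr/=; apply: le_trans (le_normcD _ _) _.
  by rewrite -[l.+2%:R]natr1 normc_cexp lerD2r.
have n0 : 0 <= normc (geo l u) by case: (geo l u) => a b; exact: sqrtr_ge0.
by rewrite mulrC ler_pdivrMr ?ltr0n// -expr2 lerXn2r// nnegrE ler0n.
Qed.

(** Below pi / 4, sin y >= y cos (pi / 4); above, sin^2 y >= 1/2 while y <= 2. *)
Lemma sqr_sin_ge (y : R) : 0 <= y <= pi / 2 -> y ^+ 2 / 8 <= sin y ^+ 2.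
Proof.
move=> /andP[y0 y2].
have p2 := @pihalf_lt2 R; have p0 := @pi_gt0 R.
have c4 : cos (pi / 4 : R) ^+ 2 = 1 / 2.
  have := @cos_mulr2n R (pi / 4).
  rewrite (_ : pi / 4 *+ 2 = pi / 2); last by rewrite -mulr_natr; field.
  by rewrite cos_pihalf mulr2n => H; lra.
have c4p : 0 <= cos (pi / 4 : R) by rewrite cos_ge0_pihalf//; apply/andP; split; lra.
have [y4|y4] := leP y (pi / 4); last first.
  have : sin (pi / 4) ^+ 2 <= sin y ^+ 2.
    rewrite lerXn2r ?nnegrE ?sin_ge0_pi//; try (by apply/andP; split; lra).
    by rewrite ltW// ltr_sin ?in_itv/=//; apply/andP; split; lra.
  rewrite [in X in X -> _]sin2cos2 c4 => H.
  have : y ^+ 2 <= 2 ^+ 2 by rewrite lerXn2r ?nnegrE//; lra.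
  lra.
have [->|yn0] := eqVneq y 0; first by rewrite expr0n mul0r sqr_ge0.
have yp : 0 < y by rewrite lt_neqAle eq_sym yn0.
have [c /[!in_itv]/= /andP[c0 cy]] : exists2 c, c \in `]0, y[%R & sin y - sin 0 = cos c * (y - 0).
  have csin : {within `[0, y], continuous (@sin R)}.
    by apply: continuous_subspaceT => x; exact: continuous_sin.
  exact: (MVT yp _ csin).
rewrite sin0 !subr0 => ->.
have H : cos (pi / 4) <= cos c.
  rewrite le_eqVlt; apply/orP; right; rewrite ltr_cos ?in_itv/=; try (by apply/andP; split; lra).
  lra.
have H2 : cos (pi / 4 : R) ^+ 2 <= cos c ^+ 2 by rewrite lerXn2r ?nnegrE// (le_trans c4p).
rewrite exprMn; rewrite c4 in H2.
have := sqr_ge0 y; nra.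
Qed.

(** The geometric sum gives |geo l d| |e^(2 pi i d) - 1| <= 2. *)
Lemma fejer_decay l (d : R) : `|d| <= 1 / 2 ->
  fejer l (to_circle d) * (l.+1%:R * d ^+ 2) <= 2.
Proof.
move=> d2; rewrite fejerE.
rewrite (_ : _ * _ = (normc (geo l d) * d) ^+ 2); last by rewrite exprMn mulrACA mulVf ?pnatr_eq0// mul1r.
have z1 : 2 * d ^+ 2 <= normc (cexp d - 1) ^+ 2.
  rewrite /cexp /normc/= sqr_sqrtr ?addr_ge0 ?sqr_ge0// subr0.
  have cs := cos2Dsin2 (2 * pi * d).
  have -> : (cos (2 * pi * d) - 1) ^+ 2 + sin (2 * pi * d) ^+ 2 = 2 * (1 - cos (2 * pi * d)).
    by move: cs; move: (cos _) (sin _) => c s cs; rewrite sqrrB expr1n mulr1 mulr2n; lra.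
  rewrite (_ : 2 * pi * d = (pi * d) *+ 2); last by rewrite mulr2n; ring.
  rewrite cos_mulr2n cos2sin2 mulr2n.
  have : (pi * `|d|) ^+ 2 / 8 <= sin (pi * `|d|) ^+ 2.
    apply: sqr_sin_ge; rewrite mulr_ge0 ?pi_ge0//=.
    by rewrite ler_pM2l ?pi_gt0// (le_trans d2)// div1r.
  have -> : sin (pi * `|d|) ^+ 2 = sin (pi * d) ^+ 2.
    by case: (ler0P d) => _ //; rewrite mulrN sinN sqrrN.
  rewrite exprMn real_normK ?num_real//.
  have : 2 ^+ 2 <= pi ^+ 2 :> R by rewrite lerXn2r ?nnegrE ?pi_ge0 ?pi_ge2.
  have := sqr_ge0 d; nra.
have geoM : geo l d * (cexp d - 1) = cexp d ^+ l.+1 - 1.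
  rewrite subrX1 mulrC /geo; congr (_ * _); apply: eq_bigr => k _.
  exact: cexp_mulrn.
have : normc (geo l d * (cexp d - 1)) <= 2.
  rewrite geoM -cexp_mulrn (le_trans (le_normcD _ _))// normcN normc1 normc_cexp.
  by [].
have n0 (z : C) : 0 <= normc z by case: z => a b; exact: sqrtr_ge0.
rewrite normcM => H; have : (normc (geo l d) * normc (cexp d - 1)) ^+ 2 <= 2 ^+ 2.
  by rewrite lerXn2r ?nnegrE ?mulr_ge0.
rewrite !exprMn; have := sqr_ge0 (normc (geo l d)); nra.
Qed.

Lemma fejer_cosE l t : fejer l t = (l.+1%:R)^-1 * \sum_(r < l.+1)
  \sum_(k < r.*2.+1) cos (2 * pi * ((k%:Z - r%:Z)%:~R * repr01 t)).
Proof.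
have ReM (a : R) (z : C) : complex.Re (a%:C * z) = a * complex.Re z.
  by case: z => x y /=; rewrite mul0r subr0.
have E : fejer_kernel l t = (l.+1%:R^-1)%:C * \sum_(r < l.+1)
    \sum_(k < r.*2.+1) cexp ((k%:Z - r%:Z)%:~R * repr01 t).
  by rewrite -{1}(repr01K t) fejerE' rmorphM /= -geo_conj geo_expand.
rewrite /fejer E ReM.
congr (_ * _); rewrite raddf_sum; apply: eq_bigr => r _.
by rewrite raddf_sum; apply: eq_bigr => k _.
Qed.

Lemma measurable_cos_circle (w : R) : measurable_fun setT (fun t => cos (w * repr01 t)).
Proof.
apply: (measurableT_comp (continuous_measurable_fun (@continuous_cos R))).
by apply: (@measurable_funM _ _ R setT (cst _) repr01) => //; exact: measurable_repr01.
Qed.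

Lemma measurable_cos_sub (j : int) (c : circle R) :
  measurable_fun setT (fun t : circle R => cos (2 * pi * (j%:~R * repr01 (c - t)))).
Proof.
under eq_fun do rewrite mulrA; apply: (measurableT_comp (measurable_cos_circle _)).
by apply: measurable_circle_add => //; exact: measurable_circle_opp.
Qed.

Lemma measurable_fejer l : measurable_fun setT (fejer l).
Proof.
rewrite (_ : fejer l = fun t => (l.+1%:R)^-1 * \sum_(r < l.+1) \sum_(k < r.*2.+1)
    cos (2 * pi * ((k%:Z - r%:Z)%:~R * repr01 t))); last first.
  by apply/funext => t; exact: fejer_cosE.
apply: (@measurable_funM _ _ R setT (cst _)) => //.
apply: measurable_sum => r; apply: measurable_sum => k.
under eq_fun do rewrite mulrA; exact: measurable_cos_circle.
Qed.

Definition third (al : bool) : circle R := if al then to_circle (1 / 3) else 0.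

Lemma digits_third b t (d : R) : `|d| <= 2 ^- b / 3 ->
  exists al, digits b (t + third al) = digits b (t + to_circle d + third al).
Proof.
move=> db; set v := repr01 t.
have H : `|(v + d) - v| <= 2 ^- b / 3 by rewrite addrC addKr.
have [E|E] := third_trick H.
  exists false; rewrite /third !addr0 -(repr01K t) -to_circleD.
  by apply/esym; exact: digits_floor.
exists true; rewrite /third -{1 2}(repr01K t) -!to_circleD.
by apply/esym; exact: digits_floor.
Qed.

Let decay_bound (F L p q e : R) : 0 < p -> 0 < q -> 0 <= F -> q <= L ->
  F * (L * e ^+ 2) <= 2 -> p / q / 3 < e -> F <= 18 * (q / p ^+ 2).
Proof.
move=> p0 q0 F0 qL decay pe.
have e0 : 0 < e by apply: le_lt_trans pe; rewrite !divr_ge0// ltW.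
have pe2 : (p / q / 3) ^+ 2 <= e ^+ 2.
  have pq : 0 <= p / q / 3 by rewrite !divr_ge0// ltW.
  by apply: lerXn2r; rewrite ?nnegrE// ltW.
have H1 : F * (q * (p / q / 3) ^+ 2) <= 2.
  apply: le_trans decay; apply: ler_wpM2l => //.
  by apply: ler_pM => //; [exact: ltW|exact: sqr_ge0].
rewrite mulrA ler_pdivlMr ?exprn_gt0//.
have : F * (q * (p / q / 3) ^+ 2) * (9 * q) <= 2 * (9 * q) by rewrite ler_pM2r ?mulr_gt0.
rewrite (_ : _ * _ * _ = F * p ^+ 2); last by field; rewrite gt_eqF.
by rewrite mulrA -natrM.
Qed.

(** Let d be the representative of x - t with |d| <= 1/2, and a the least index
with |d| <= 2^-(m - a) / 3, so that x and t share m - a digits in one of the two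
grids.  For a = 0 the bound l + 1 on the kernel is enough; for a > 0 minimality
makes |d| large and the decay applies, with the constant 72 = 18 * 4.  If there
is no such a, then |d| > 1/3 and the term a = m, where no digit is compared,
serves. *)
Lemma fejer_dyadic l m A (c : R) (x t : circle R) :
  2 ^+ m <= l.+1%:R :> R -> l.+1%:R <= c * 2 ^+ m -> (m <= A)%N ->
  fejer l (x - t) <= (c + 72) * \sum_(a < A.+1) \sum_(al : bool)
    (2 ^- a * 2 ^+ (m - a)) *
    (digits (m - a) (t + third al) == digits (m - a) (x + third al))%:R.
Proof.
move=> ml lc mA.
have c0 : 0 <= c.
  by rewrite -(pmulr_lge0 _ (exprn_gt0 m (ltr0n R 2))) (le_trans _ lc).
have term_ge0 a al : 0 <= (2 ^- a * 2 ^+ (m - a)) *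
    (digits (m - a) (t + third al) == digits (m - a) (x + third al))%:R :> R.
  by rewrite !mulr_ge0// ?invr_ge0 exprn_ge0.
have key a : (a <= m)%N -> fejer l (x - t) <= (c + 72) * (2 ^- a * 2 ^+ (m - a)) ->
  (exists al, digits (m - a) (t + third al) = digits (m - a) (x + third al)) ->
  fejer l (x - t) <= (c + 72) * \sum_(a < A.+1) \sum_(al : bool)
    (2 ^- a * 2 ^+ (m - a)) *
    (digits (m - a) (t + third al) == digits (m - a) (x + third al))%:R.
  move=> am H [al E]; apply: le_trans H _; rewrite ler_wpM2l ?addr_ge0//.
  have aA : (a < A.+1)%N by rewrite ltnS (leq_trans am).
  rewrite (bigD1 (Ordinal aA))//= (bigD1 al)//= E eqxx mulr1 -addrA lerDl.
  by rewrite addr_ge0// sumr_ge0// => i _; rewrite sumr_ge0.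
pose u := repr01 (x - t).
have [d d2 dE] : exists2 d : R, `|d| <= 1 / 2 & to_circle d = x - t.
  have /andP[u0 u1] : 0 <= u < 1 := repr01_itv (x - t).
  have [u2|u2] := leP u (1 / 2).
    by exists u; rewrite ?repr01K// ger0_norm.
  exists (u - 1).
    by rewrite ler_norml; clear -u0 u1 u2; clearbody u; apply/andP; split; lra.
  by rewrite -(repr01K (x - t)); apply/to_circle_eqP; exists (-1); rewrite rmorphN1.
have xE : x = t + to_circle d by rewrite dE addrC subrK.
have decay := fejer_decay l d2; rewrite dE in decay.
have l0 : 0 < l.+1%:R :> R by rewrite ltr0n.
have F0 := fejer_ge0 l (x - t).
have pw n : 0 < 2 ^+ n :> R by rewrite exprn_gt0.
(* a ranges over 0..m, and the majorant has a term for each a <= A. *)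
have [/existsP/=[a0 Ha0]|/existsPn/= none] :=
    boolP [exists a : 'I_m.+1, `|d| <= 2 ^- (m - a) / 3].
  have ex : exists a, (a <= m)%N && (`|d| <= 2 ^- (m - a) / 3).
    by exists a0; rewrite Ha0 andbT -ltnS.
  have [a /andP[am da] mina] := ex_minnP ex.
  apply: (key a) => //; last by have [al Hal] := digits_third t da; exists al; rewrite Hal -xE.
  case: a am da mina => [|a] am da mina.
    rewrite subn0 expr0 invr1 mul1r (le_trans (fejer_le _ _))// (le_trans lc)//.
    by rewrite ler_pM2r// lerDl.
  have : 2 ^- (m - a) / 3 < `|d|.
    rewrite ltNge; apply/negP => H; suff : (a < a)%N by rewrite ltnn.
    by apply: mina; rewrite H andbT ltnW.
  have -> : 2 ^- (m - a) = 2 ^+ a / 2 ^+ m :> R.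
    by rewrite -{2}(subnK (ltnW am)) exprD; field; rewrite !gt_eqF.
  rewrite -(real_normK (num_real d)) in decay.
  move=> /(decay_bound (pw a) (pw m) F0 ml decay) H2; apply: le_trans H2 _.
  rewrite (_ : 2 ^- a.+1 * 2 ^+ (m - a.+1) = 2 ^+ m / (2 ^+ a) ^+ 2 / 4); last first.
    by rewrite -{2}(subnK am) exprD exprS; field; rewrite !gt_eqF.
  have : 0 <= 2 ^+ m / (2 ^+ a) ^+ 2 :> R by rewrite divr_ge0 ?sqr_ge0// ltW.
  by move: (_ / _) => z z0; nra.
apply: (key m) => //; last by exists false; rewrite subnn !digits0.
have := none ord_max; rewrite -ltNge /= subnn expr0 invr1 => d3.
rewrite mulr1.
have e2 : 1 / 9 <= d ^+ 2 by rewrite -(real_normK (num_real d)); move: `|d| d3 => e ?; nra.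
have H1 : fejer l (x - t) * (2 ^+ m * (1 / 9)) <= 2.
  by apply: le_trans decay; apply: ler_wpM2l => //; apply: ler_pM => //; exact: ltW.
have H2 : fejer l (x - t) <= 18 / 2 ^+ m.
  by rewrite ler_pdivlMr//; lra.
apply: le_trans H2 _; rewrite ler_pM2r ?invr_gt0//; lra.
Qed.

Section integral.
Variable P : probability (torus R) R.
Hypothesis hP : is_product_measure P.

Lemma integrable_bounded d (Y : measurableType d) (Q : probability Y R) (f : Y -> R) (M : R) :
  measurable_fun setT f -> (forall y, `|f y| <= M) -> Q.-integrable setT (EFin \o f).
Proof.
move=> mf fM; apply/integrableP; split; first exact/measurable_EFinP.
apply: (@le_lt_trans _ _ (\int[Q]_y M%:E)%E).
  apply: ge0_le_integral => //=.
  - by apply/measurable_EFinP; exact: measurableT_comp.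
  - by move=> y _; rewrite lee_fin.
by rewrite integral_prob_cst ltry.
Qed.

Lemma integral_coord_shift i s (phi : circle R -> R) (M : R) :
  measurable_fun setT phi -> (forall t, `|phi t| <= M) ->
  (\int[P]_t (phi (t i))%:E = \int[P]_t (phi (t i + s)%R)%:E)%E.
Proof.
move=> mphi phiM.
have m1 := @measurable_coord R i.
have m2 : measurable_fun setT (fun t : torus R => t i + s : circle R).
  exact: (measurable_circle_add m1).
rewrite -[LHS](@integral_pushforward _ _ _ _ R (fun t : torus R => t i : circle R) m1 P setT (EFin \o phi))//; last 2 first.
- exact/measurable_EFinP.
- by apply: (@integrable_bounded _ _ _ _ M) => //; exact: measurableT_comp.
rewrite -[RHS](@integral_pushforward _ _ _ _ R (fun t : torus R => t i + s : circle R) m2 P setT (EFin \o phi))//; last 2 first.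
- exact/measurable_EFinP.
- by apply: (@integrable_bounded _ _ _ _ M) => //; exact: measurableT_comp.
apply: eq_measure_integral => A mA _; rewrite /pushforward.
apply: etrans (coord_law hP i mA) _.
rewrite -(circle_measure_shift s mA); apply/esym.
exact: (coord_law hP i (circle_measurable_shift s mA)).
Qed.

(** For j <> 0, translating by 1 / (2 j) changes the sign of the integrand. *)
Lemma integral_cos_coord i (j : int) (c : circle R) :
  (\int[P]_t (cos (2 * pi * (j%:~R * repr01 (c - t i))))%:E = (j == 0)%:R%:E)%E.
Proof.
have [->|j0] := eqVneq j 0.
  under eq_integral do rewrite mul0r mulr0 cos0.
  by rewrite integral_prob_cst.
have jR : j%:~R != 0 :> R by rewrite intr_eq0.
pose phi (t : circle R) : R := cos (2 * pi * (j%:~R * repr01 (c - t))).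
have mphi : measurable_fun setT phi by exact: measurable_cos_sub.
have phi1 t : `|phi t| <= 1 by exact: cos_max.
have phiE (t : circle R) u : to_circle u = c - t -> phi t = complex.Re (cexp (j%:~R * u)).
  move=> ut; rewrite /phi -[LHS]/(complex.Re (cexp (j%:~R * repr01 (c - t)))).
  by rewrite -!characterE repr01K ut.
pose s : circle R := to_circle (- (2 * j%:~R)^-1).
have phis t : phi (t + s) = - phi t.
  rewrite (phiE _ (repr01 (c - t) + (2 * j%:~R)^-1)); last first.
    by rewrite to_circleD repr01K opprD addrA /s to_circleN opprK.
  rewrite (phiE t (repr01 (c - t))) ?repr01K// mulrDr cexpD.
  rewrite (_ : j%:~R * (2 * j%:~R)^-1 = 1 / 2); last by field.
  have -> : cexp (1 / 2) = -1.
    rewrite /cexp (_ : 2 * pi * (1 / 2) = pi); last by field.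
    by rewrite cospi sinpi; apply/eqP; rewrite eq_complex/= oppr0 !eqxx.
  by rewrite mulrN1 raddfN.
have iphi : P.-integrable setT (EFin \o (fun t : torus R => phi (t i))).
  by apply: (@integrable_bounded _ _ _ _ 1) => //; apply: measurableT_comp => //; exact: measurable_coord.
have := integral_coord_shift i s mphi phi1.
under [X in _ = X -> _]eq_integral do rewrite phis EFinN.
rewrite integralN/=; last by apply: integrable_add_def.
have := integrable_fin_num measurableT iphi.
rewrite /comp /phi/=; case: (integral _ _ _) => // r _.
by rewrite -EFinN => -[] H; congr EFin; lra.
Qed.

(** Only the frequency 0 of each Dirichlet kernel contributes. *)
Lemma integral_fejer l i (c : circle R) : (\int[P]_t (fejer l (c - t i)%R)%:E = 1)%E.
Proof.
have iphi (j : int) : P.-integrable setT (fun t : torus R => (cos (2 * pi * (j%:~R * repr01 (c - t i))))%:E).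
  apply: (@integrable_bounded _ _ _ (fun t : torus R => cos (2 * pi * (j%:~R * repr01 (c - t i)))) 1) => [|t]; last exact: cos_max.
  exact: (measurableT_comp (measurable_cos_sub j c) (@measurable_coord R i)).
under eq_integral.
  move=> t _; rewrite fejer_cosE EFinM -sumEFin.
  under eq_bigr do rewrite -sumEFin.
  over.
rewrite integralZl//=; last first.
  by apply: integrable_sum => // r _; apply: integrable_sum => // k _; exact: iphi.
rewrite integral_sum//; last first.
  by move=> r; apply: integrable_sum => // k _; exact: iphi.
rewrite (eq_bigr (fun=> 1%E)); last first.
  move=> r _; rewrite integral_sum//.
  under eq_bigr do rewrite integral_cos_coord.
  have rr : (r < r.*2.+1)%N by rewrite ltnS -addnn leq_addr.
  rewrite (bigD1 (Ordinal rr))//= subrr eqxx big1 ?adde0// => k /eqP kr.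
  rewrite subr_eq0; case: eqP => // -[kE]; exfalso; apply: kr; exact: val_inj.
rewrite sumEFin sumr_const card_ord -EFinM; congr EFin.
by rewrite mulVf// pnatr_eq0.
Qed.

End integral.
End fejer_kernel.

(** * Comparison with L (ln+ L)^k *)

Section orlicz_integrability.
Local Open Scope ereal_scope.
Context {R : realType}.

Lemma orlicz_add k (a b : \bar R) : 0 <= a -> 0 <= b ->
  orlicz k (a + b) <= orlicz k (2%:E * a) + orlicz k (2%:E * b).
Proof.
move=> a0 b0.
have H (x y : \bar R) : 0 <= x -> x <= y -> x + y <= 2%:E * y.
  by move=> x0 xy; rewrite mule_natl mule2n leeD2r.
have [ab|/ltW ba] := leP a b.
  rewrite (le_trans (le_orlicz k _ (H a b a0 ab))) ?adde_ge0//.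
  by rewrite leeDr// orlicz_ge0// mule_ge0.
rewrite addeC (le_trans (le_orlicz k _ (H b a b0 ba))) ?adde_ge0//.
by rewrite leeDl// orlicz_ge0// mule_ge0.
Qed.

Lemma orlicz_small k (t : R) : (0 <= t <= 1)%R -> orlicz k t%:E <= t%:E.
Proof.
move=> /andP[t0 t1]; case: k => [//|k] /=.
rewrite eseries0 ?lee_fin// => j _ _; rewrite ifF//.
apply/negbTE; rewrite -leNgt lee_fin (le_trans t1)// exprn_ege1// ler1n.
by [].
Qed.

Lemma orlicz_EFin_lty k (t : R) : (0 <= t)%R -> orlicz k t%:E < +oo.
Proof.
by move=> t0; have [C C0 H] := @orlicz_le_log R k; rewrite (le_lt_trans (H _ t0))// ltry.
Qed.

(** Where ln (t + 1) <= 1 the left side is bounded; elsewhere 1 + ln (t + 1) is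
at most 2 ln (t + 1). *)
Lemma orlicz_le_LlogL k (c : R) : (0 < c)%R -> exists2 B : R, (0 <= B)%R &
  forall t : R, (0 <= t)%R -> orlicz k (c * t)%:E <= (B * (1 + t * ln (t + 1) ^+ k))%:E.
Proof.
move=> c0; have [C C0 H] := @orlicz_le_log R k.
have L0 (t : R) : (0 <= t)%R -> (0 <= ln (1 + t))%R by move=> t0; rewrite ln_ge0// lerDl.
pose b := (1 + ln (1 + c))%R; have b1 : (1 <= b)%R by rewrite lerDl L0// ltW.
have b0 : (0 <= b)%R by rewrite (le_trans _ b1).
pose B1 := (C * (c * b ^+ k))%R.
have B10 : (0 <= B1)%R by rewrite !mulr_ge0 ?exprn_ge0// ltW.
pose E1 := (expR 1 + 1 : R)%R.
have E0 : (0 <= E1)%R by rewrite addr_ge0 ?expR_ge0.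
exists (B1 * (2 ^+ k * E1))%R.
  by apply: mulr_ge0 => //; apply: mulr_ge0 => //; exact: exprn_ge0.
move=> t t0; set L := ln (t + 1).
have Lg : (0 <= L)%R by rewrite /L addrC L0.
apply: le_trans (H _ _) _; first by rewrite mulr_ge0// ltW.
rewrite lee_fin.
have H1 : (1 + ln (1 + c * t) <= b * (1 + L))%R.
  have : (ln (1 + c * t) <= ln (1 + c) + ln (t + 1))%R.
    rewrite -lnM ?posrE; [|lra|lra]; rewrite ler_ln ?posrE; last 2 first.
    - by rewrite ltr_wpDr// mulr_ge0// ltW.
    - by rewrite mulr_gt0//; lra.
    nra.
  have := L0 _ (ltW c0); rewrite /b -/L => ? ?; nra.
have H1' : (0 <= 1 + ln (1 + c * t))%R.
  by rewrite addr_ge0// L0// mulr_ge0// ltW.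
have H2 : ((1 + ln (1 + c * t)) ^+ k <= b ^+ k * (1 + L) ^+ k)%R.
  rewrite -exprMn; apply: lerXn2r; rewrite ?nnegrE// (le_trans H1')//.
have H3 : (t * (1 + L) ^+ k <= 2 ^+ k * E1 * (1 + t * L ^+ k))%R.
  have [L1|L1] := leP L 1%R.
    have te : (t <= E1)%R.
      have : (t + 1 <= expR 1)%R by rewrite -[leLHS]lnK ?posrE ?ler_expR//; lra.
      by rewrite /E1; lra.
    apply: (@le_trans _ _ (E1 * 2 ^+ k)%R).
      by apply: ler_pM => //; [rewrite exprn_ge0//; lra|apply: lerXn2r; rewrite ?nnegrE; lra].
    rewrite mulrC ler_peMr//; first by rewrite mulr_ge0 ?exprn_ge0.
    by rewrite lerDl mulr_ge0// exprn_ge0.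
  apply: (@le_trans _ _ (t * (2 * L) ^+ k)%R).
    by rewrite ler_wpM2l//; apply: lerXn2r; rewrite ?nnegrE; lra.
  rewrite exprMn mulrCA -!mulrA ler_wpM2l ?exprn_ge0//.
  have tL : (0 <= t * L ^+ k)%R by rewrite mulr_ge0// exprn_ge0.
  have : (1 <= E1)%R by rewrite lerDr expR_ge0.
  by move: (t * L ^+ k)%R tL => z z0 ?; nra.
apply: (@le_trans _ _ (C * (c * t * (b ^+ k * (1 + L) ^+ k)))%R).
  by rewrite ler_wpM2l// ler_wpM2l// mulr_ge0// ltW.
rewrite (_ : (C * _ = B1 * (t * (1 + L) ^+ k)))%R; last by rewrite /B1; ring.
rewrite -[leRHS]mulrA; apply: ler_wpM2l => //.
Qed.

End orlicz_integrability.

(** * Density of functions of finitely many digits *)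

Section density.
Context {R : realType}.
Local Notation X := (torus R).
Variable P : probability X R.
Hypothesis hP : is_product_measure P.

Definition dyadic_level (n i : nat) : option nat := Some (if (i < n)%N then n else 0%N).

(** Keeps n digits of each of the first n coordinates. *)
Definition dyadic_map n : X * X -> X := resample (dyadic_level n) (fun=> 0).

Lemma dyadic_mapS m n x y z : (m <= n)%N ->
  dyadic_map m (dyadic_map n (x, y), z) = dyadic_map m (x, z).
Proof.
move=> mn; apply: resample_nested => i; rewrite /dyadic_level/=.
by case: ifP => // im; rewrite (leq_trans im mn).
Qed.

Definition dyadic_fun T n (g : X -> T) := forall x y, g (dyadic_map n (x, y)) = g x.

Lemma dyadic_funS T m n (g : X -> T) : (m <= n)%N -> dyadic_fun m g -> dyadic_fun n g.
Proof. by move=> mn gm x y; rewrite -(gm _ y) dyadic_mapS. Qed.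

Lemma dyadic_fun_digits T n (g : X -> T) (x z : X) : dyadic_fun n g ->
  (forall i, (i < n)%N -> digits n (x i) = digits n (z i)) -> g x = g z.
Proof.
move=> gn xz; rewrite -(gn x x) -(gn z x); congr g; apply/funext => i.
rewrite /dyadic_map/resample/dyadic_level/=; case: ifP => ni; last by rewrite !redraw0.
by rewrite /redraw !addr0 xz.
Qed.

Lemma digits_dyadic_fun i b : dyadic_fun (maxn b i.+1) (fun x : X => digits b (x i)).
Proof.
move=> x y; rewrite /dyadic_map/resample/dyadic_level/= leq_maxr addr0 subr0.
by rewrite digits_redraw// leq_maxl.
Qed.

Definition sdiff (A B : set X) : set X := (A `\` B) `|` (B `\` A).

Lemma measurable_sdiff A B : measurable A -> measurable B -> measurable (sdiff A B).
Proof. by move=> mA mB; apply: measurableU; exact: measurableD. Qed.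

Lemma sdiff_trans A B C : sdiff A C `<=` sdiff A B `|` sdiff B C.
Proof.
by move=> x; rewrite /sdiff/=; have [?|?] := pselect (A x); have [?|?] := pselect (B x);
  have [?|?] := pselect (C x); tauto.
Qed.

Definition dyadic_approx (A : set X) := measurable A /\ forall eta : R, 0 < eta ->
  exists n B, [/\ measurable B, dyadic_fun n B & (P (sdiff A B) <= eta%:E)%E].

Lemma dyadic_approx_dyadic n B : measurable B -> dyadic_fun n B -> dyadic_approx B.
Proof.
move=> mB Bn; split => // eta eta0; exists n, B; split => //.
by rewrite /sdiff setDv setU0 measure0 lee_fin ltW.
Qed.

Let half_add (eta : R) : (eta%:E = (eta / 2)%:E + (eta / 2)%:E)%E.
Proof. by rewrite -EFinD -splitr. Qed.

(** With stability under complements and finite unions, this makes the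
sets with dyadic approximations a sigma-algebra. *)
Lemma dyadic_approx_lim A : measurable A ->
  (forall eta : R, 0 < eta -> exists2 B, dyadic_approx B & (P (sdiff A B) <= eta%:E)%E) ->
  dyadic_approx A.
Proof.
move=> mA H; split => // eta eta0.
have eta2 : 0 < eta / 2 by rewrite divr_gt0.
have [B [mB aB] AB] := H _ eta2; have [n [C [mC Cn BC]]] := aB _ eta2.
exists n, C; split => //; rewrite half_add.
apply: (@le_trans _ _ (P (sdiff A B `|` sdiff B C))).
  by apply: le_measure; rewrite ?inE; [exact: measurable_sdiff|apply: measurableU; exact: measurable_sdiff|exact: sdiff_trans].
apply: le_trans (measureU2 _ _ _) _; [exact: measurable_sdiff|exact: measurable_sdiff|].
exact: leeD.
Qed.

Lemma dyadic_approxC A : dyadic_approx A -> dyadic_approx (~` A).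
Proof.
move=> [mA aA]; split; first exact: measurableC.
move=> eta /aA [n [B [mB Bn AB]]]; exists n, (~` B); split; first exact: measurableC.
  by move=> x y; rewrite /setC/=; congr (~ _); exact: Bn.
by rewrite /sdiff !setDE !setCK setUC ![~` _ `&` _]setIC -!setDE.
Qed.

Lemma dyadic_approxU A A' : dyadic_approx A -> dyadic_approx A' -> dyadic_approx (A `|` A').
Proof.
move=> [mA aA] [mA' aA']; split; first exact: measurableU.
move=> eta eta0; have eta2 : 0 < eta / 2 by rewrite divr_gt0.
have [n [B [mB Bn AB]]] := aA _ eta2; have [m [B' [mB' Bm AB']]] := aA' _ eta2.
exists (maxn n m), (B `|` B'); split; first exact: measurableU.
  move=> x y; rewrite /setU/=; congr (_ \/ _).
    exact: (dyadic_funS (leq_maxl n m) Bn).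
  exact: (dyadic_funS (leq_maxr n m) Bm).
rewrite half_add.
apply: (@le_trans _ _ (P (sdiff A B `|` sdiff A' B'))).
  apply: le_measure; rewrite ?inE.
  - by apply: measurable_sdiff; exact: measurableU.
  - by apply: measurableU; exact: measurable_sdiff.
  - by move=> x; rewrite /sdiff/=; tauto.
apply: le_trans (measureU2 _ _ _) _; [exact: measurable_sdiff|exact: measurable_sdiff|].
exact: leeD.
Qed.

Lemma dyadic_approx_bigcup (F : (set X)^nat) : (forall i, dyadic_approx (F i)) ->
  dyadic_approx (\bigcup_i F i).
Proof.
move=> aF; have mF i : measurable (F i) by have [] := aF i.
have mU : measurable (\bigcup_i F i) by exact: bigcup_measurable.
pose U n := \big[setU/set0]_(i < n.+1) F i.
have mUn n : measurable (U n) by exact: bigsetU_measurable.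
have aU n : dyadic_approx (U n).
  rewrite /U; elim: n.+1 => [|{}n IH]; last by rewrite big_ord_recr; exact: dyadic_approxU.
  by rewrite big_ord0; exact: (@dyadic_approx_dyadic 0%N).
have UE : \bigcup_n U n = \bigcup_i F i by rewrite /U bigcup_bigsetU_bigcup.
have cvgU : P (U n) @[n --> \oo] --> P (\bigcup_i F i).
  by rewrite -UE; apply: nondecreasing_cvg_mu => //; [rewrite UE|move=> m n mn; apply/subsetPset; exact: subset_bigsetU].
have fin A : measurable A -> P A \is a fin_num by move=> mA; exact: fin_num_measure.
apply: dyadic_approx_lim => // eta eta0.
have /fine_cvgP[_ /cvgrPdist_lt /(_ _ eta0) [n _ /(_ n (leqnn n))]] :
    P (U n) @[n --> \oo] --> (fine (P (\bigcup_i F i)))%:E by rewrite fineK// fin.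
move=> Hn; exists (U n) => //.
have sub : U n `<=` \bigcup_i F i.
  by rewrite -UE; exact: bigcup_sup.
rewrite /sdiff [X in _ `|` X](_ : _ = set0) ?setU0; last by apply/seteqP; split => // x [/sub].
rewrite measureD// ?[X in (X < _)%E]?ge0_fin_numE//; last first.
  by rewrite -ge0_fin_numE// fin.
rewrite setIidr//.
rewrite -[X in (X - _)%E](fineK (fin _ mU)) -[X in (_ - X)%E](fineK (fin _ (mUn n))) -EFinB lee_fin.
apply: le_trans (ltW Hn); exact: ler_norm.
Qed.

(** A ray is the union over b of the sets where the whole dyadic interval of
length 2^-b around the coordinate lies in the ray. *)
Lemma dyadic_approx_coord i (A : set (circle R)) : measurable A ->
  dyadic_approx [set x : X | A (x i)].
Proof.
move=> mA; pose h (x : X) : measurableTypeR R := repr01 (x i).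
have mh : measurable_fun setT h.
  exact: (measurableT_comp measurable_repr01 (@measurable_coord R i)).
suff H (B : set (measurableTypeR R)) : measurable B -> dyadic_approx (h @^-1` B).
  rewrite (_ : [set x | _] = h @^-1` (@to_circle R @^-1` A)).
    by apply: H; rewrite -circle_measurableE.
  by apply/seteqP; split => x /=; rewrite /h repr01K.
have -> : (measurable B) = (<<s @RGenInftyO.G R >> B).
  by congr (_ B); exact: RGenInftyO.measurableE.
move: B; apply: smallest_sub; last first.
  move=> _ [a ->].
  pose C b := [set x : X | (digits b (x i) + 1)%:~R <= 2 ^+ b * a].
  have -> : h @^-1` `]-oo, a[%classic = \bigcup_b C b.
    apply/seteqP; split => x /=; rewrite /h in_itv/=.
      move=> ha; pose n := Num.bound (a - repr01 (x i))^-1.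
      have d0 : 0 < a - repr01 (x i) by rewrite subr_gt0.
      exists n => //; rewrite /C/= intrD.
      have := Num.Theory.floor_le (2 ^+ n * repr01 (x i)); rewrite -/(digits n (x i)).
      have : 1 <= 2 ^+ n * (a - repr01 (x i)).
        rewrite -ler_pdivrMr// div1r ltW// (lt_le_trans (archi_boundP _)) ?invr_ge0 ?ltW//.
        by rewrite -natrX ltr_nat ltn_expl.
      by rewrite mulrBr => h1 h2; rewrite (le_trans (lerD h2 h1))// addrC subrK.
    move=> [b _ /=]; rewrite /C/=.
    have := Num.Theory.floorD1_gt (2 ^+ b * repr01 (x i)); rewrite -/(digits b (x i)).
    by move=> H1 H2; have := lt_le_trans H1 H2; rewrite ltr_pM2l// exprn_gt0.
  apply: dyadic_approx_bigcup => b; apply: (@dyadic_approx_dyadic (maxn b i.+1)).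
    rewrite /C; under eq_set do rewrite intrD.
    have m1 : measurable_fun setT (fun x : X => (digits b (x i))%:~R + 1 : measurableTypeR R).
      apply: (@measurable_funD _ _ R setT _ (cst 1)) => //.
      exact: (measurableT_comp (measurable_digits b) (@measurable_coord R i)).
    rewrite (_ : [set _ | _] = (fun x : X => (digits b (x i))%:~R + 1 : measurableTypeR R) @^-1` `]-oo, 2 ^+ b * a]%classic).
      by rewrite -[X in measurable X]setTI; apply: m1 => //; exact: measurable_itv.
    by apply/seteqP; split => x /=; rewrite in_itv.
  by move=> x y; rewrite /C/= digits_dyadic_fun.
split.
- rewrite preimage_set0; apply: (@dyadic_approx_dyadic 0%N) => //.
- by move=> B aB; rewrite setTD preimage_setC; exact: dyadic_approxC.
- by move=> F aF; rewrite preimage_bigcup; exact: dyadic_approx_bigcup.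
Qed.

Lemma dyadic_approx_measurable A : measurable A -> dyadic_approx A.
Proof.
move: A; apply: smallest_sub; last first.
  by move=> _ [i _ [A mA <-]]; rewrite setTI; exact: dyadic_approx_coord.
split.
- exact: (@dyadic_approx_dyadic 0%N).
- by move=> B aB; rewrite setTD; exact: dyadic_approxC.
- by move=> F aF; exact: dyadic_approx_bigcup.
Qed.

Variable k : nat.

(** The scale c is arbitrary, as orlicz k is not homogeneous. *)
Definition approximable (u : X -> R) := forall c eta : R, 0 < c -> 0 < eta ->
  exists (n : nat) (g : X -> R) (M : R), [/\ measurable_fun setT g, forall x, 0 <= g x <= M,
    dyadic_fun n g & (\int[P]_x orlicz k (c * `|u x - g x|)%:E <= eta%:E)%E].

Let morl (c : R) (v w : X -> R) : measurable_fun setT v -> measurable_fun setT w ->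
  0 <= c -> measurable_fun setT (fun x => orlicz k (c * `|v x - w x|)%:E).
Proof.
move=> mv mw c0; apply: measurable_orlicz; last by move=> x; rewrite lee_fin mulr_ge0.
apply/measurable_EFinP; apply: measurable_funM => //.
by apply: measurableT_comp => //; exact: measurable_funB.
Qed.

Let orl_ge0 (c a : R) : 0 <= c -> 0 <= a -> (0 <= orlicz k (c * a)%:E)%E.
Proof. by move=> c0 a0; rewrite orlicz_ge0// lee_fin mulr_ge0. Qed.

Let orl_triangle (c : R) (a b d : R) : 0 <= c -> `|a| <= `|b| + `|d| ->
  (orlicz k (c * `|a|)%:E <= orlicz k (2 * c * `|b|)%:E + orlicz k (2 * c * `|d|)%:E)%E.
Proof.
move=> c0 abd.
apply: (@le_trans _ _ (orlicz k ((c * `|b|)%:E + (c * `|d|)%:E))).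
  by apply: le_orlicz; rewrite lee_fin ?mulr_ge0// -mulrDr ler_wpM2l.
by apply: le_trans (orlicz_add k _ _) _; rewrite ?lee_fin ?mulr_ge0// -!EFinM !mulrA.
Qed.

Lemma approximable_lim (u : X -> R) : measurable_fun setT u ->
  (forall c eta : R, 0 < c -> 0 < eta -> exists v : X -> R,
    [/\ measurable_fun setT v, approximable v &
     (\int[P]_x orlicz k (c * `|u x - v x|)%:E <= eta%:E)%E]) -> approximable u.
Proof.
move=> mu H c eta c0 eta0.
have c2 : 0 < 2 * c by rewrite mulr_gt0.
have eta2 : 0 < eta / 2 by rewrite divr_gt0.
have [v [mv av uv]] := H _ _ c2 eta2.
have [n [g [M [mg gM gn vg]]]] := av _ _ c2 eta2.
exists n, g, M; split => //; rewrite half_add.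
apply: le_trans (leeD uv vg); rewrite -ge0_integralD//.
- apply: ge0_le_integral => //.
  + by move=> x _; rewrite orl_ge0// ltW.
  + by apply: morl => //; exact: ltW.
  + by apply: emeasurable_funD; apply: morl => //; exact: ltW.
  + move=> x _; apply: orl_triangle; first exact: ltW.
    by rewrite (_ : u x - g x = (u x - v x) + (v x - g x)) ?ler_normD//; ring.
- by move=> x _; rewrite orl_ge0// ltW.
- by apply: morl => //; exact: ltW.
- by move=> x _; rewrite orl_ge0// ltW.
- by apply: morl => //; exact: ltW.
Qed.

Lemma approximableD (u v : X -> R) : measurable_fun setT u -> measurable_fun setT v ->
  approximable u -> approximable v -> approximable (fun x => u x + v x).
Proof.
move=> mu mv au av c eta c0 eta0.
have c2 : 0 < 2 * c by rewrite mulr_gt0.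
have eta2 : 0 < eta / 2 by rewrite divr_gt0.
have [n [g [M [mg gM gn ug]]]] := au _ _ c2 eta2.
have [n' [g' [M' [mg' gM' gn' vg]]]] := av _ _ c2 eta2.
exists (maxn n n'), (fun x => g x + g' x), (M + M'); split.
- exact: measurable_funD.
- by move=> x; have := gM x; have := gM' x; lra.
- move=> x y; rewrite (dyadic_funS (leq_maxl n n') gn).
  by rewrite (dyadic_funS (leq_maxr n n') gn').
rewrite half_add; apply: le_trans (leeD ug vg); rewrite -ge0_integralD//.
- apply: ge0_le_integral => //.
  + by move=> x _; rewrite orl_ge0// ltW.
  + by apply: morl => //; [exact: measurable_funD|exact: measurable_funD|exact: ltW].
  + by apply: emeasurable_funD; apply: morl => //; exact: ltW.
  + move=> x _; apply: orl_triangle; first exact: ltW.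
    by rewrite (_ : _ - _ = (u x - g x) + (v x - g' x)) ?ler_normD//; ring.
- by move=> x _; rewrite orl_ge0// ltW.
- by apply: morl => //; exact: ltW.
- by move=> x _; rewrite orl_ge0// ltW.
- by apply: morl => //; exact: ltW.
Qed.

Lemma approximable_indic (A : set X) (b : R) : 0 <= b -> measurable A ->
  approximable (fun x => b * \1_A x).
Proof.
move=> b0 mA c eta c0 eta0.
have o0 : (0 <= orlicz k (c * b)%:E)%E by rewrite orl_ge0// ltW.
have ofin : (orlicz k (c * b)%:E)%E \is a fin_num.
  by rewrite ge0_fin_numE// orlicz_EFin_lty// mulr_ge0// ltW.
pose K := fine (orlicz k (c * b)%:E).
have K0 : 0 <= K by rewrite fine_ge0.
have [_ /(_ (eta / (K + 1)))] := dyadic_approx_measurable mA.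
have K1 : 0 < K + 1 by rewrite ltr_wpDl.
rewrite divr_gt0// => /(_ isT) [n [B [mB Bn AB]]].
have mAB := measurable_sdiff mA mB.
exists n, (fun x => b * \1_B x), b; split.
- by apply: measurable_funM => //; exact/measurable_indicP.
- by move=> x; rewrite indicE; case: (_ \in _); rewrite ?mulr1 ?mulr0 ?b0 ?lexx.
- move=> x y; congr (_ * _); rewrite !indicE; congr ((_ : bool)%:R).
  by apply/idP/idP; rewrite !inE Bn.
apply: (@le_trans _ _ (\int[P]_x (K%:E * (\1_(sdiff A B) x)%:E))%E).
  apply: ge0_le_integral => //.
  - by move=> x _; rewrite orl_ge0// ltW.
  - by apply: morl; [| |exact: ltW]; apply: measurable_funM => //; exact/measurable_indicP.
  - by apply: measurable_funeM; apply/measurable_EFinP; exact/measurable_indicP; exact: mAB.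
  - move=> x _; rewrite -mulrBr normrM (ger0_norm b0) !indicE /K fineK//.
    have [xA|xA] := boolP (x \in A); have [xB|xB] := boolP (x \in B).
    + rewrite subrr normr0 !mulr0; apply: le_trans (orlicz_small k _) _; first by rewrite lexx ler01.
      by rewrite mule_ge0// lee_fin.
    + rewrite subr0 normr1 mulr1 mem_set ?mule1//; left; split; first by rewrite inE in xA.
      by rewrite notin_setE in xB.
    + rewrite sub0r normrN1 mulr1 mem_set ?mule1//; right; split; first by rewrite inE in xB.
      by rewrite notin_setE in xA.
    + rewrite subrr normr0 !mulr0; apply: le_trans (orlicz_small k _) _; first by rewrite lexx ler01.
      by rewrite mule_ge0// lee_fin.
rewrite ge0_integralZl//; last first.
  by apply/measurable_EFinP; exact/measurable_indicP.
rewrite integral_indic// setIT.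
apply: (@le_trans _ _ (K%:E * (eta / (K + 1))%:E)%E).
  by apply: lee_wpmul2l; rewrite ?lee_fin.
rewrite -EFinM lee_fin mulrCA ger_pMr// ler_pdivrMr// mul1r lerDl//.
Qed.

Import HBNNSimple.

Lemma approximable_nnsfun (s : {nnsfun X >-> R}) : approximable s.
Proof.
have -> : (s : X -> R) = fun x => \sum_(y <- finmap.enum_fset (fset_set (range s))) y * \1_(s @^-1` [set y]) x.
  by apply/funext => x; rewrite (fimfunE s x) fsbig_finite.
have : forall y, y \in finmap.enum_fset (fset_set (range s)) -> 0 <= y.
  move=> y yr; have H := @in_fset_set _ (range s) (@fimfunP _ _ s) y.
  have : y \in range s by rewrite -H; exact: yr.
  by rewrite inE => -[x _ <-]; exact: fun_ge0.
have ms y : measurable (s @^-1` [set y]) by [].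
elim: (finmap.enum_fset _) => [|y r IH] r0.
  rewrite (_ : (fun x : X => _) = (fun x => 0 * \1_(set0 : set X) x)).
    exact: approximable_indic.
  by apply/funext => x; rewrite big_nil mul0r.
rewrite (_ : (fun x => _) = fun x => y * \1_(s @^-1` [set y]) x +
  \sum_(y <- r) y * \1_(s @^-1` [set y]) x); last first.
  by apply/funext => x; rewrite big_cons.
apply: approximableD.
- by apply: measurable_funM => //; exact/measurable_indicP.
- by apply: measurable_sum => z; apply: measurable_funM => //; exact/measurable_indicP.
- by apply: approximable_indic => //; apply: r0; rewrite mem_head.
- by apply: IH => z zr; apply: r0; rewrite in_cons zr orbT.
Qed.

(** Simple functions below u converge to u, and dominated convergence applies
with the bound orlicz k (c u). *)
Lemma approximable_orlicz (u : X -> R) : measurable_fun setT u -> (forall x, 0 <= u x) ->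
  (forall c : R, 0 < c -> (\int[P]_x orlicz k (c * u x)%:E < +oo)%E) -> approximable u.
Proof.
move=> mu u0 uoo; apply: approximable_lim => // c eta c0 eta0.
have mU : measurable_fun setT (EFin \o u) by exact/measurable_EFinP.
pose s := nnsfun_approx measurableT mU.
have scvg x : s^~ x @ \oo --> u x.
  have H : (EFin \o s^~ x) @ \oo --> (EFin \o u) x.
    by apply: cvg_nnsfun_approx => // y _; rewrite lee_fin.
  by move/fine_cvgP : H => [].
have su n x : s n x <= u x.
  rewrite -(cvg_lim _ (scvg x))//.
  apply: (@nondecreasing_cvgn_le _ (s^~ x)); last exact: (cvgP _ (scvg x)).
  by move=> a b ab; exact/lefP/nd_nnsfun_approx.
pose f_ n x := orlicz k (c * `|u x - s n x|)%:E.
have f_le n x : (f_ n x <= orlicz k (c * u x)%:E)%E.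
  rewrite /f_ ger0_norm ?subr_ge0//; apply: le_orlicz; rewrite lee_fin.
    by rewrite mulr_ge0 ?subr_ge0// ltW.
  by rewrite ler_pM2l// gerBl; exact: fun_ge0.
have mf n : measurable_fun setT (f_ n) by apply: morl => //; exact: ltW.
have f0 n x : (0 <= f_ n x)%E by rewrite orl_ge0// ltW.
have f_cvg x : f_ ^~ x @ \oo --> 0%E.
  apply/fine_cvgP; split.
    by near=> n; rewrite ge0_fin_numE// orlicz_EFin_lty// mulr_ge0// ltW.
  apply/cvgrPdist_lt => e e0; near=> n.
  have H : c * `|u x - s n x| <= Num.min 1 (e / 2).
    rewrite -ler_pdivlMl//; apply: ltW; near: n.
    by move/cvgrPdist_lt : (scvg x); apply; rewrite mulr_gt0 ?invr_gt0// lt_min ltr01 divr_gt0.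
  rewrite sub0r normrN /= ger0_norm ?fine_ge0//.
  rewrite -lte_fin fineK; last by rewrite ge0_fin_numE// orlicz_EFin_lty// mulr_ge0// ltW.
  move: H; rewrite le_min => /andP[H1 H2].
  apply: le_lt_trans (orlicz_small _ _) _; first by rewrite H1 andbT mulr_ge0// ltW.
  by rewrite lte_fin (le_lt_trans H2)// ltr_pdivrMr// ltr_pMr// ltr1n.
have ig : P.-integrable setT (fun x => orlicz k (c * u x)%:E).
  apply/integrableP; split.
    apply: measurable_orlicz; last by move=> x; rewrite lee_fin mulr_ge0// ltW.
    by apply/measurable_EFinP; exact: measurable_funM.
  apply: le_lt_trans (uoo c c0); rewrite le_eqVlt; apply/orP; left; apply/eqP.
  by apply: eq_integral => x _; rewrite gee0_abs// orl_ge0// ltW.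
have A1 : {ae P, forall x, setT x -> f_ ^~ x @ \oo --> (cst 0%E : X -> \bar R) x}.
  by apply: aeW => x _; exact: f_cvg.
have A2 : {ae P, forall x n, setT x -> (`|f_ n x| <= orlicz k (c * u x)%:E)%E}.
  by apply: aeW => x n _; rewrite gee0_abs.
have [_ _ H] := dominated_convergence measurableT mf (measurable_cst _) A1 ig A2.
rewrite integral_cst// mul0e in H.
move/fine_cvgP : H => [Hfin /cvgrPdist_lt/(_ _ eta0) Hlt].
near \oo => n; exists (s n); split => //; first exact: approximable_nnsfun.
have F : (\int[P]_x f_ n x)%E \is a fin_num by near: n.
rewrite -[X in (X <= _)%E](fineK F) lee_fin.
have : `|0 - fine (\int[P]_x f_ n x)| < eta by near: n.
by rewrite sub0r normrN ger0_norm ?fine_ge0 ?integral_ge0// => /ltW.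
Unshelve. all: by end_near. Qed.

End density.

(** * The maximal inequality for regular Fejer means *)

Section domination.
Context {R : realType}.
Local Notation X := (torus R).
Variable P : probability X R.
Hypothesis hP : is_product_measure P.

(** Functions of p coordinates become sequences, so that cells and kernels of all p
share one type. *)
Definition extend T (x0 : T) p (a : 'I_p -> T) (i : nat) : T := oapp a x0 (insub i).

Lemma extendE T (x0 : T) p (a : 'I_p -> T) (j : 'I_p) : extend x0 a j = a j.
Proof. by rewrite /extend valK. Qed.

Definition kern p (N : nat -> nat) (x t : X) : R := \prod_(j < p) fejer (N j) (x j - t j).

Definition fejer_int p N (f : X -> \bar R) (x : X) : \bar R :=
  (\int[P]_t ((kern p N x t)%:E * f t))%E.

Lemma kern_ge0 p N x t : 0 <= kern p N x t.
Proof. by apply: prodr_ge0 => j _; exact: fejer_ge0. Qed.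

Lemma measurable_fejer_sub l i (c : circle R) :
  measurable_fun setT (fun t : X => fejer l (c - t i)).
Proof.
apply: (measurableT_comp (measurable_fejer l)).
by apply: measurable_circle_add => //; apply: measurable_circle_opp; exact: measurable_coord.
Qed.

Lemma measurable_kern p N x : measurable_fun setT (kern p N x).
Proof. by apply: measurable_prod => j _; exact: measurable_fejer_sub. Qed.

Lemma integral_kern p N x : (\int[P]_t (kern p N x t)%:E = 1)%E.
Proof.
rewrite /kern; under eq_integral do rewrite -prodEFin.
rewrite (@integral_prod_coord _ _ hP p (fun j (t : X) => (fejer (N j) (x j - t j))%:E)).
- by rewrite big1// => j _; exact: integral_fejer.
- by move=> j; apply/measurable_EFinP; exact: measurable_fejer_sub.
- by move=> j t; rewrite lee_fin fejer_ge0.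
- by move=> j s t ->.
Qed.

Section blocks.
(** kappa i is the index of the block that contains the coordinate i. *)
Variable kappa : nat -> nat.

Definition cell_level p (a : nat -> nat) (n i : nat) : nat := if (i < p)%N then (n - a i)%N else 0%N.

Definition block_level p (a : nat -> nat) (k n i : nat) : option nat :=
  if kappa i == k then Some (cell_level p a n i) else None.

(** In block k, a coordinate i < p keeps n - a i digits and the others are redrawn;
the coordinates of the other blocks are kept. *)
Definition block_resample p a (s : nat -> circle R) k n :=
  resample (block_level p a k n) s.

Lemma nested_block_resample p a s k : nested_resamplings P (block_resample p a s k).
Proof.
apply: nested_resample => // m n i mn; rewrite /block_level; case: ifP => // _.
by rewrite /= /cell_level; case: ifP => // _; rewrite leq_sub2r.
Qed.

(** The left side redraws block after block; each step is one of the means over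
which the maximal operator of that block takes the supremum. *)
Lemma cond_mean_le_iter_maximal p a s (m : nat -> nat) D (f : X -> \bar R) x :
  measurable_fun setT f -> (forall x, 0 <= f x)%E -> (forall i, (kappa i < D)%N) ->
  (cond_mean P (resample (fun i => Some (cell_level p a (m (kappa i)) i)) s) f x <=
   iter_maximal P (block_resample p a s) D f x)%E.
Proof.
move=> mf f0 kD.
pose L d i := if (kappa i < d)%N then Some (cell_level p a (m (kappa i)) i) else None.
have -> : (fun i => Some (cell_level p a (m (kappa i)) i)) = L D.
  by apply/funext => i; rewrite /L kD.
elim: D {kD} f mf f0 x => [|d IH] f mf f0 x.
  rewrite /= /cond_mean (_ : (fun y => f _) = fun=> f x) ?integral_prob_cst//.
have -> : L d.+1 = fun i => if L d i is None then block_level p a d (m d) i else L d i.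
  apply/funext => i; rewrite /L/block_level ltnS leq_eqVlt.
  by case: (ltnP (kappa i) d) => [kd|kd]; rewrite ?orbT//= orbF; case: eqP => // ->.
rewrite -cond_mean_comp//; last first.
  move=> i; rewrite /L/block_level; case: eqP => [->|]; last by right.
  by left; rewrite ltnn.
have [rP rn] := nested_block_resample p a s d.
have mr k n : measurable_fun setT (block_resample p a s k n) by exact: measurable_resample.
have mM := measurable_maximal rP mf f0.
have M0 := @maximal_ge0 _ X R P (block_resample p a s d) f f0.
rewrite /=; apply: le_trans (IH _ mM M0 x).
apply: le_cond_mean => //.
- exact: measurable_resample.
- by apply: measurable_cond_mean => //; exact: measurable_resample.
- exact: cond_mean_ge0.
- by move=> y; exact: (cond_mean_le_maximal P (block_resample p a s d) f (m d) y).
Qed.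

Definition shift_of p (e : 'I_p -> nat * bool) (i : nat) : circle R :=
  third (extend (0%N, false) e i).2.
Definition scale_of p (e : 'I_p -> nat * bool) (i : nat) : nat := (extend (0%N, false) e i).1.

Definition dyadic_maximal D p (e : 'I_p -> nat * bool) (f : X -> \bar R) : X -> \bar R :=
  iter_maximal P (block_resample p (scale_of e) (shift_of e)) D f.

Definition nat_index p A (e : {ffun 'I_p -> 'I_A.+1 * bool}) (j : 'I_p) : nat * bool :=
  (nat_of_ord (e j).1, (e j).2).

(** Expanding the product of the majorants of fejer_dyadic gives a sum over
functions e that choose, for each coordinate, an index a and a translation.
The factors 2^(m - a) cancel against the sides of the cell. *)
Lemma fejer_int_le D p (N m : nat -> nat) A (C : R) (f : X -> \bar R) (x : X) :
  measurable_fun setT f -> (forall x, 0 <= f x)%E -> (forall i, (kappa i < D)%N) ->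
  (forall j : 'I_p, [/\ 2 ^+ m (kappa j) <= (N j).+1%:R :> R,
     (N j).+1%:R <= C * 2 ^+ m (kappa j) & (m (kappa j) <= A)%N]) ->
  (fejer_int p N f x <= \sum_(e : {ffun 'I_p -> 'I_A.+1 * bool})
     (\prod_(j < p) ((C + 72) * 2 ^- (e j).1))%:E * dyadic_maximal D (nat_index e) f x)%E.
Proof.
move=> mf f0 kD H.
have C0 : (p = 0)%N \/ 0 <= C + 72.
  case: p H => [|p] H; [by left|right].
  have [_ H2 _] := H ord0; rewrite addr_ge0//.
  by rewrite -(pmulr_lge0 _ (exprn_gt0 (m (kappa (@ord0 p))) (ltr0n R 2))) (le_trans _ H2).
pose F (j : 'I_p) (e : 'I_A.+1 * bool) (t : X) : R := (C + 72) * (2 ^- e.1 * 2 ^+ (m (kappa j) - e.1) *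
    (digits (m (kappa j) - e.1) (t j + third e.2) == digits (m (kappa j) - e.1) (x j + third e.2))%:R).
have C0j (j : 'I_p) : 0 <= C + 72 by case: C0 => // p0; case: j => j /=; rewrite {1}p0.
have le1 t : kern p N x t <= \sum_(e : {ffun 'I_p -> 'I_A.+1 * bool}) \prod_(j < p) F j (e j) t.
  rewrite -(bigA_distr_bigA (fun j e => F j e t)) /kern; apply: ler_prod => j _.
  rewrite fejer_ge0/=; have [H1 H2 H3] := H j.
  apply: le_trans (fejer_dyadic (x j) (t j) H1 H2 H3) _.
  by rewrite pair_bigA/= mulr_sumr.
pose b (e : {ffun 'I_p -> 'I_A.+1 * bool}) i := (m (kappa i) - scale_of (nat_index e) i)%N.
have FE (e : {ffun 'I_p -> 'I_A.+1 * bool}) (t : X) : \prod_(j < p) F j (e j) t = (\prod_(j < p) ((C + 72) * 2 ^- (e j).1)) *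
   ((\prod_(j < p) 2 ^+ b e j) * (\1_(cell p (b e) (shift_of (nat_index e)) x) t : R)).
  have -> : \1_(cell p (b e) (shift_of (nat_index e)) x) t = \prod_(j < p)
     (digits (b e j) (t j + third (e j).2) == digits (b e j) (x j + third (e j).2))%:R :> R.
    rewrite indicE; have [tc|tc] := boolP (t \in _).
      rewrite big1// => j _; move: tc; rewrite inE => /(_ j (ltn_ord j)) /=.
      by rewrite /shift_of extendE /nat_index/= => ->; rewrite eqxx.
    move: tc; rewrite notin_setE => tc; apply/esym/eqP/prodf_eq0.
    apply: contrapT => nex; apply: tc => i ip /=.
    rewrite /shift_of (extendE (0%N, false) (nat_index e) (Ordinal ip)) /nat_index/=.
    apply/eqP; apply: contrapT => /negP ne; apply: nex.
    by exists (Ordinal ip) => //; rewrite (negbTE ne).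
  rewrite -!big_split/=; apply: eq_bigr => j _.
  rewrite /F /b /scale_of extendE /nat_index/=; ring.
have mb e : measurable (cell p (b e) (shift_of (nat_index e)) x).
  apply: measurable_cylinder => i.
  exact: (circle_measurable_shift _ (measurable_cell (b e i) _)).
have m1 e : measurable_fun setT (fun t => (\1_(cell p (b e) (shift_of (nat_index e)) x) t : R)%:E).
  by apply/measurable_EFinP/measurable_indicP.
pose w (e : {ffun 'I_p -> 'I_A.+1 * bool}) := \prod_(j < p) ((C + 72) * 2 ^- (e j).1).
have w0 e : 0 <= w e by apply: prodr_ge0 => j _; rewrite mulr_ge0 ?invr_ge0 ?exprn_ge0//; exact: (C0j j).
have pb0 e : 0 <= \prod_(j < p) 2 ^+ b e j :> R by apply: prodr_ge0 => j _; rewrite exprn_ge0.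
apply: (@le_trans _ _ (\int[P]_t \sum_(e : {ffun 'I_p -> 'I_A.+1 * bool})
   ((w e * \prod_(j < p) 2 ^+ b e j)%:E * ((\1_(cell p (b e) (shift_of (nat_index e)) x) t)%:E * f t)))%E).
  apply: ge0_le_integral => //.
  - by move=> t _; rewrite mule_ge0// lee_fin kern_ge0.
  - by apply: emeasurable_funM => //; apply/measurable_EFinP; exact: measurable_kern.
  - apply: emeasurable_sum => e; apply: measurable_funeM; exact: emeasurable_funM.
  - move=> t _; apply: (@le_trans _ _ ((\sum_(e : {ffun 'I_p -> 'I_A.+1 * bool}) \prod_(j < p) F j (e j) t)%:E * f t)%E).
      by apply: lee_wpmul2r => //; rewrite lee_fin.
    rewrite -sumEFin ge0_sume_distrl; last first.
      by move=> e _; rewrite lee_fin FE mulr_ge0 ?w0// mulr_ge0.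
    by rewrite le_eqVlt; apply/orP; left; apply/eqP; apply: eq_bigr => e _;
      rewrite FE muleA -EFinM mulrA.
rewrite ge0_integral_sum//; last 2 first.
- by move=> e; apply: measurable_funeM; exact: emeasurable_funM.
- by move=> e t _; rewrite mule_ge0 ?lee_fin ?mulr_ge0 ?w0// mule_ge0// lee_fin.
apply: lee_sum => e _; rewrite ge0_integralZl//; last 3 first.
- exact: emeasurable_funM.
- by move=> t _; rewrite mule_ge0// lee_fin.
- by rewrite lee_fin mulr_ge0// w0.
rewrite integral_cell// muleA -EFinM.
rewrite (_ : _ * _ * _ = w e); last first.
  rewrite -mulrA -big_split/= big1 ?mulr1// => j _.
  by rewrite mulfV// expf_eq0 pnatr_eq0 andbF.
apply: lee_wpmul2l; first by rewrite lee_fin w0.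
exact: (cond_mean_le_iter_maximal p (scale_of (nat_index e)) (shift_of (nat_index e)) m x).
Qed.

Lemma geo_sum_le (q : R) n : 0 <= q < 1 -> \sum_(a < n) q ^+ a <= (1 - q)^-1.
Proof.
move=> /andP[q0 q1]; rewrite -[leRHS]mul1r ler_pdivlMr ?subr_gt0//.
elim: n => [|n IH]; first by rewrite big_ord0 mul0r.
have -> : (\sum_(a < n.+1) q ^+ a) * (1 - q) = 1 - q ^+ n.+1.
  elim: n {IH} => [|n IH]; first by rewrite big_ord1 expr0 expr1 mul1r.
  by rewrite big_ord_recr/= mulrDl IH [q ^+ n.+2]exprS; ring.
by rewrite gerBl exprn_ge0.
Qed.

Lemma sum_prod_geo_le p A (q B : R) : 0 <= q < 1 -> 0 <= B ->
  \sum_(e : {ffun 'I_p -> 'I_A.+1 * bool}) \prod_(j < p) (B * q ^+ (e j).1) <=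
  (B * (2 / (1 - q))) ^+ p.
Proof.
move=> q01 B0; have /andP[q0 _] := q01.
rewrite -(bigA_distr_bigA (fun j (e : 'I_A.+1 * bool) => B * q ^+ e.1)).
rewrite -[X in _ <= _ ^+ X](card_ord p) -prodr_const; apply: ler_prod => j _.
rewrite sumr_ge0 => [|e _]; last by rewrite mulr_ge0// exprn_ge0.
rewrite -mulr_sumr ler_wpM2l// -(pair_bigA _ (fun (a : 'I_A.+1) (_ : bool) => q ^+ a))/=.
under eq_bigr do rewrite sumr_const card_bool -mulr_natr mulrC.
by rewrite -mulr_sumr ler_wpM2l// geo_sum_le.
Qed.

Lemma measure_bigU_le (I : Type) (r : seq I) (F : I -> set X) :
  (forall i, measurable (F i)) ->
  (P (\big[setU/set0]_(i <- r) F i) <= \sum_(i <- r) P (F i))%E.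
Proof.
move=> mF; elim: r => [|i r IH]; first by rewrite !big_nil measure0.
rewrite !big_cons; apply: le_trans (measureU2 _ _ _) _ => //.
  exact: bigsetU_measurable.
exact: leeD.
Qed.

Lemma in_bigU (I : eqType) (r : seq I) (F : I -> set X) x :
  (\big[setU/set0]_(i <- r) F i) x <-> exists2 i, i \in r & F i x.
Proof.
elim: r => [|i r IH]; first by rewrite big_nil; split => // -[].
rewrite big_cons; split.
  move=> [Fi|/IH[j jr Fj]]; first by exists i => //; rewrite mem_head.
  by exists j => //; rewrite in_cons jr orbT.
move=> [j]; rewrite in_cons => /orP[/eqP ->|jr] Fj; first by left.
by right; apply/IH; exists j.
Qed.

(** The union is finite: A bounds the levels m, and with them the indices a. *)
Definition exceptional D p (f : X -> \bar R) (lam : R) A : set X :=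
  \big[setU/set0]_(e : {ffun 'I_p -> 'I_A.+1 * bool})
    superlevel (dyadic_maximal D (nat_index e) f) (lam * \prod_(j < p) (4 / 3) ^+ (e j).1).

Lemma measurable_exceptional D p f lam A : measurable_fun setT f ->
  (forall x, 0 <= f x)%E -> measurable (exceptional D p f lam A).
Proof.
move=> mf f0; apply: bigsetU_measurable => e _; apply: measurable_superlevel.
by apply: measurable_iter_maximal => // k; exact: nested_block_resample.
Qed.

Lemma exceptionalS D p f lam A B : (A <= B)%N ->
  exceptional D p f lam A `<=` exceptional D p f lam B.
Proof.
move=> AB x; rewrite /exceptional => /in_bigU[e _ He]; apply/in_bigU.
have AB' : (A.+1 <= B.+1)%N by [].
exists [ffun j => (widen_ord AB' (e j).1, (e j).2)]; first by rewrite mem_index_enum.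
rewrite (_ : nat_index _ = nat_index e); last first.
  by apply/funext => j; rewrite /nat_index ffunE.
by under eq_bigr do rewrite ffunE.
Qed.

(** The thresholds contribute (3/4)^a per coordinate, and summing over a and the
two translations gives 2 / (1 - 3/4) = 8. *)
Lemma exceptional_measure d p f (lam : R) A : measurable_fun setT f ->
  (forall x, 0 <= f x)%E -> 0 < lam ->
  (P (exceptional d.+1 p f lam A) <=
   (lam^-1 * 8 ^+ p)%:E * (iter_const d + \int[P]_x orlicz d (f x)))%E.
Proof.
move=> mf f0 lam0; set K := (iter_const d + _)%E.
have K0 : (0 <= K)%E.
  have [_ c0] := @iter_const_fin R d.
  by rewrite adde_ge0// integral_ge0// => x _; exact: orlicz_ge0.
have w0 (e : {ffun 'I_p -> 'I_A.+1 * bool}) : 0 < \prod_(j < p) (4 / 3) ^+ (e j).1 :> R.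
  by apply: prodr_gt0 => j _; rewrite exprn_gt0.
apply: (le_trans (measure_bigU_le _ _)).
  move=> e; apply: measurable_superlevel.
  by apply: measurable_iter_maximal => // k; exact: nested_block_resample.
apply: (@le_trans _ _ (\sum_(e : {ffun 'I_p -> 'I_A.+1 * bool})
   (lam^-1 * \prod_(j < p) (1 * (3 / 4) ^+ (e j).1))%:E * K)%E).
  apply: lee_sum => e _.
  have -> : lam^-1 * \prod_(j < p) (1 * (3 / 4) ^+ (e j).1) =
     (lam * \prod_(j < p) (4 / 3) ^+ (e j).1)^-1.
    rewrite invfM -prodfV; congr (_ * _); apply: eq_bigr => j _.
    by rewrite mul1r -exprVn; congr (_ ^+ _); field.
  rewrite lee_pdivlMl ?mulr_gt0//.
  apply: iter_maximal_weak => //; last by rewrite mulr_gt0.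
  by move=> k; exact: nested_block_resample.
rewrite -ge0_sume_distrl; last first.
  move=> e _; rewrite lee_fin mulr_ge0 ?invr_ge0 ?ltW//.
  by rewrite prodr_gt0// => j _; rewrite mul1r exprn_gt0.
apply: lee_wpmul2r => //; rewrite sumEFin lee_fin -mulr_sumr.
rewrite ler_pM2l ?invr_gt0//.
apply: le_trans (sum_prod_geo_le p A _ ler01) _; first lra.
rewrite le_eqVlt; apply/orP; left; apply/eqP; congr (_ ^+ _); by field.
Qed.

(** Here the sum is over 2^-a (4/3)^a = (2/3)^a, and 2 / (1 - 2/3) = 6. *)
Lemma fejer_int_le_off_exceptional D p (N m : nat -> nat) A (C lam : R) (f : X -> \bar R) (x : X) :
  measurable_fun setT f -> (forall x, 0 <= f x)%E -> (forall i, (kappa i < D)%N) ->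
  0 <= C -> 0 < lam ->
  (forall j : 'I_p, [/\ 2 ^+ m (kappa j) <= (N j).+1%:R :> R,
     (N j).+1%:R <= C * 2 ^+ m (kappa j) & (m (kappa j) <= A)%N]) ->
  ~ exceptional D p f lam A x ->
  (fejer_int p N f x <= (((C + 72) * 6) ^+ p * lam)%:E)%E.
Proof.
move=> mf f0 kD C0 lam0 H xE; apply: (le_trans (fejer_int_le x mf f0 kD H)).
have C72 : 0 <= C + 72 by rewrite addr_ge0.
apply: (@le_trans _ _ (\sum_(e : {ffun 'I_p -> 'I_A.+1 * bool})
   ((\prod_(j < p) ((C + 72) * (2 / 3) ^+ (e j).1)) * lam)%:E)%E).
  apply: lee_sum => e _.
  apply: (@le_trans _ _ ((\prod_(j < p) ((C + 72) * 2 ^- (e j).1))%:E *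
      (lam * \prod_(j < p) (4 / 3) ^+ (e j).1)%:E)%E).
    apply: lee_wpmul2l.
      by rewrite lee_fin prodr_ge0// => j _; rewrite mulr_ge0// invr_ge0 exprn_ge0.
    rewrite leNgt; apply/negP => H2; apply: xE; apply/in_bigU; exists e; first by rewrite mem_index_enum.
    exact: H2.
  rewrite -EFinM lee_fin mulrCA mulrC ler_pM2r// -big_split/= le_eqVlt.
  apply/orP; left; apply/eqP; apply: eq_bigr => j _.
  by rewrite -mulrA; congr (_ * _); rewrite -exprVn -exprMn; congr (_ ^+ _); field.
rewrite sumEFin lee_fin -mulr_suml ler_pM2r//.
apply: le_trans (sum_prod_geo_le p A _ C72) _; first lra.
rewrite le_eqVlt; apply/orP; left; apply/eqP; congr (_ ^+ _); congr (_ * _); by field.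
Qed.

Definition regular_index p (C : R) (N : nat -> nat) := forall i j, (i < p)%N -> (j < p)%N ->
  kappa i = kappa j -> (N i)%:R <= C * (N j)%:R.

(** For a block, 2^m is the largest power of 2 that is at most the least N j + 1. *)
Lemma regular_scale p (C : R) N : 1 <= C -> regular_index p C N ->
  exists m : nat -> nat, forall j : 'I_p, 2 ^+ m (kappa j) <= (N j).+1%:R :> R /\
     (N j).+1%:R <= 2 * C * 2 ^+ m (kappa j).
Proof.
move=> C1 rN.
have H k : exists mk, forall j : 'I_p, kappa j = k -> 2 ^+ mk <= (N j).+1%:R :> R /\
     (N j).+1%:R <= 2 * C * 2 ^+ mk.
  have [/existsP/=[j0 /eqP j0k]|/existsPn none] := boolP [exists j : 'I_p, kappa j == k]; last first.
    by exists 0%N => j jk; have := none j; rewrite jk eqxx.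
  (* The least N of the block fixes the scale of the block. *)
  pose i0 := [arg min_(i < j0 | kappa i == k) N i]%N.
  have [ik imin] : kappa i0 = k /\ forall j : 'I_p, kappa j = k -> (N i0 <= N j)%N.
    rewrite /i0; case: arg_minnP; first by rewrite j0k.
    by move=> i /eqP ik H; split => // j jk; apply: H; rewrite jk.
  have /andP[t1 t2] := trunc_log_bounds (isT : (1 < 2)%N) (ltn0Sn (N i0)).
  exists (trunc_log 2 (N i0).+1) => j jk; split.
    by rewrite -natrX ler_nat (leq_trans t1)// ltnS imin.
  have H1 : (N j)%:R <= C * (N i0)%:R by apply: rN; rewrite ?ltn_ord// ik.
  have H2 : (N i0).+1%:R <= 2 * 2 ^+ trunc_log 2 (N i0).+1 :> R.
    by rewrite -exprS -natrX ler_nat ltnW.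
  have C0 : 0 < C by lra.
  apply: (@le_trans _ _ (C * (N i0).+1%:R)); last by rewrite mulrAC [leRHS]mulrC ler_pM2l.
  by rewrite -!natr1; nra.
have [m Hm] := choice H.
by exists m => j; exact: Hm.
Qed.

(** The exceptional sets increase with A and their measures are bounded
uniformly, so that their union serves all N at once. *)
Lemma regular_fejer_maximal d p f (lam : R) : measurable_fun setT f ->
  (forall x, 0 <= f x)%E -> (forall i, (kappa i < d.+1)%N) -> 0 < lam ->
  exists W, [/\ measurable W,
    (P W <= (lam^-1 * 8 ^+ p)%:E * (iter_const d + \int[P]_x orlicz d (f x)))%E &
    forall x, ~ W x -> forall (C : R) N, 1 <= C -> regular_index p C N ->
      (fejer_int p N f x <= (((2 * C + 72) * 6) ^+ p * lam)%:E)%E].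
Proof.
move=> mf f0 kD lam0; pose E := exceptional d.+1 p f lam.
have mE A : measurable (E A) by exact: measurable_exceptional.
exists (\bigcup_A E A); split.
- exact: bigcup_measurable.
- have H : P (E A) @[A --> \oo] --> P (\bigcup_A E A).
    apply: nondecreasing_cvg_mu => //; first exact: bigcup_measurable.
    by move=> A B AB; apply/subsetPset; exact: exceptionalS.
  rewrite -(cvg_lim _ H)//; apply: lime_le; first exact: (cvgP _ H).
  by apply: nearW => A; exact: exceptional_measure.
- move=> x xW C N C1 rN; have [m Hm] := regular_scale C1 rN.
  pose A := (\max_(j < p) m (kappa j))%N.
  apply: (@fejer_int_le_off_exceptional _ _ _ m A) => //.
  + lra.
  + by move=> j; have [? ?] := Hm j; split => //; exact: leq_bigmax.
  + by move=> xE; apply: xW; exists A.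
Qed.

End blocks.
End domination.

(** * Fejer means of functions of finitely many digits *)

Section boundary.
Context {R : realType}.
Implicit Types c t : circle R.

(** c is an end point of a dyadic interval of length 2^-n. *)
Definition on_boundary n c : Prop := exists k : int, 2 ^+ n * repr01 c = k%:~R.

(** If c is at distance delta from the ends of its dyadic interval, every t in
another interval is at distance at least delta from c. *)
Lemma fejer_off_cell n c : ~ on_boundary n c -> exists2 B : R, 0 <= B &
  forall l t, digits n t != digits n c -> fejer l (c - t) <= B / l.+1%:R.
Proof.
move=> nb; set y := repr01 c; pose k := Num.floor (2 ^+ n * y).
have [k1 k2] : k%:~R < 2 ^+ n * y /\ 2 ^+ n * y < k%:~R + 1.
  have /andP[h1 h2] := floor_itv (2 ^+ n * y); split; last by rewrite -intrD1.
  rewrite lt_neqAle h1 andbT; apply/eqP => E; apply: nb; exists k.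
  by rewrite E.
pose v := Num.min (2 ^+ n * y - k%:~R) (k%:~R + 1 - 2 ^+ n * y).
have v0 : 0 < v by rewrite lt_min !subr_gt0 k1.
have n0 : 0 < 2 ^+ n :> R by rewrite exprn_gt0.
pose delta := v / 2 ^+ n.
have d0 : 0 < delta by rewrite divr_gt0.
exists (2 / delta ^+ 2); first by rewrite divr_ge0// exprn_ge0// ltW.
move=> l t tc.
have [d ct d2] : exists2 d : R, to_circle d = c - t & `|d| <= 1 / 2.
  have /andP[e0 e1] := repr01_itv (c - t).
  have [h|h] := leP (repr01 (c - t)) (1 / 2).
    by exists (repr01 (c - t)); [exact: repr01K|rewrite ger0_norm].
  exists (repr01 (c - t) - 1); last by rewrite ler0_norm; lra.
  rewrite -[RHS]repr01K; apply/to_circle_eqP.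
  by exists (-1); rewrite rmorphN1.
have dd : delta <= `|d|.
  rewrite leNgt; apply/negP => dlt; move: tc => /negP; apply; apply/eqP.
  have -> : t = to_circle (y - d).
    by rewrite to_circleD to_circleN ct repr01K opprB addrC subrK.
  rewrite -[in RHS](repr01K c) -/y; apply: digits_floor.
  have : 2 ^+ n * `|d| < v by rewrite mulrC -ltr_pdivlMr.
  rewrite lt_min => /andP[m1 m2].
  have dn : - (2 ^+ n * `|d|) <= 2 ^+ n * d <= 2 ^+ n * `|d|.
    by rewrite -mulrN !ler_pM2l// ler_norm lerNl -normrN ler_norm.
  have /andP[? ?] := dn.
  rewrite -/k; apply/eqP; rewrite -[_ == _]andbT.
  have -> : Num.floor (2 ^+ n * (y - d)) = k; last by rewrite eqxx.
  by apply: floor_def; rewrite mulrBr intrD1; apply/andP; split; lra.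
have l0 : 0 < l.+1%:R :> R by rewrite ltr0n.
have := fejer_decay l d2; rewrite ct => H.
rewrite -mulrA -invfM ler_pdivlMr ?mulr_gt0 ?exprn_gt0//.
apply: le_trans H; rewrite ler_wpM2l ?fejer_ge0// mulrC ler_pM2l//.
by rewrite -[leRHS]real_normK ?num_real// lerXn2r ?nnegrE ?normr_ge0// ltW.
Qed.

End boundary.

Section convergence.
Context {R : realType}.
Local Notation X := (torus R).
Variable P : probability X R.
Hypothesis hP : is_product_measure P.

(** Only countably many points of the circle are end points. *)
Lemma boundary_null n : exists W : set X, [/\ measurable W, P W = 0%E &
  forall x, ~ W x -> forall i, ~ on_boundary n (x i)].
Proof.
pose B : set (circle R) := [set c | on_boundary n c].
pose V : set R := [set k%:~R / 2 ^+ n | k in [set: int]].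
have n0 : 2 ^+ n != 0 :> R by rewrite expf_neq0.
have cV : countable V by exact: card_le_trans (card_image_le _ _) (countableP _).
have BV : B = (fun c => repr01 c) @^-1` V.
  apply/seteqP; split => c /=.
    by move=> [k E]; exists k => //; rewrite -E mulrC mulKf.
  by move=> [k _ E]; exists k; rewrite -E mulrC divfK.
have mV : measurable V.
  exact: countable_measurable.
have mB : measurable B.
  by rewrite BV -[_ @^-1` _]setTI; exact: measurable_repr01.
have B0 : circle_measure B = 0%E.
  rewrite circle_measureE; apply/eqP; rewrite eq_le measure_ge0 andbT.
  rewrite -(countable_lebesgue_measure0 cV) le_measure ?inE//.
    rewrite circle_measurableE in mB.
    rewrite (_ : [set v | _] = `[0, 1[ `&` to_circle (R:=R) @^-1` B); last first.
      by apply/seteqP; split => v /=; rewrite in_itv/=.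
    by apply: measurableI => //; exact: measurable_itv.
  move=> v [v01]; rewrite BV/= repr01_to_circle//.
exists (\bigcup_i [set x : X | B (x i)]); split.
- by apply: bigcup_measurable => i _; rewrite -[X in measurable X]setTI; exact: (measurable_coord i).
- apply/eqP; rewrite eq_le measure_ge0 andbT.
  have mi i : measurable [set x : X | B (x i)].
    by rewrite -[X in measurable X]setTI; exact: (measurable_coord i).
  have H := measure_sigma_subadditive P mi (bigcup_measurable (fun i _ => mi i)) (@subset_refl _ _).
  by apply: le_trans H _; rewrite eseries0// => i _ _; exact: (etrans (coord_law hP i mB) B0).
- by move=> x xW i xi; apply: xW; exists i.
Qed.

Definition off_cell p n (x t : X) : bool := [exists j : 'I_p, digits n (t j) != digits n (x j)].

Lemma measurable_digits_neq n i (c : circle R) :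
  measurable_fun setT (fun t : X => (digits n (t i) != digits n c)%:R : R).
Proof.
have H : measurable (setT `&` (fun t : X => (digits n (t i))%:~R : R) @^-1` [set (digits n c)%:~R]).
  exact: (measurableT_comp (measurable_digits n) (measurable_coord i)).
rewrite setTI in H.
have : measurable_fun setT (\1_(~` ((fun t : X => (digits n (t i))%:~R : R) @^-1` [set (digits n c)%:~R])) : X -> R).
  by apply/measurable_indicP; exact: measurableC.
apply: eq_measurable_fun => t _; rewrite indicE; congr (_%:R).
case: eqP => E /=; first by rewrite memNset//= E; apply.
by rewrite mem_set//= => /intr_inj.
Qed.

Lemma measurable_off_cell p n x : measurable_fun setT (fun t => (off_cell p n x t)%:R : R).
Proof.
have -> : (fun t => (off_cell p n x t)%:R : R) =
   fun t => 1 - \prod_(j < p) (1 - (digits n (t j) != digits n (x j))%:R).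
  apply/funext => t; rewrite /off_cell; case: existsP => [[j jn]|H].
    by rewrite (bigD1 j)//= jn subrr mul0r subr0.
  rewrite big1 ?subrr// => j _; case: (boolP (_ != _)) => [jn|_]; last by rewrite subr0.
  by case: H; exists j.
apply: measurable_funB => //; apply: measurable_prod => j _.
by apply: measurable_funB => //; exact: measurable_digits_neq.
Qed.

(** If t leaves the cell of x in coordinate j, the factor of index j is of order
1 / (N j + 1), while the other factors integrate to 1. *)
Lemma kern_off_cell p n (x : X) : (forall i, ~ on_boundary n (x i)) ->
  exists2 B : R, 0 <= B & forall N,
    (\int[P]_t (kern p N x t * (off_cell p n x t)%:R)%:E <= (\sum_(j < p) B / (N j).+1%:R)%:E)%E.
Proof.
move=> xb.
have [B HB] : exists B, forall j, 0 <= B j /\ forall l t, digits n t != digits n (x j) ->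
    fejer l (x j - t) <= B j / l.+1%:R.
  have H j : exists b : R, 0 <= b /\ forall l t, digits n t != digits n (x j) ->
      fejer l (x j - t) <= b / l.+1%:R.
    by have [b b0 Hb] := fejer_off_cell (xb j); exists b.
  by have [B HB] := choice H; exists B.
have B0 j : 0 <= B j by have [] := HB j.
exists (\sum_(j < p) B j); first by apply: sumr_ge0.
move=> N.
pose F (j : 'I_p) i (t : X) : R := fejer (N i) (x i - t i) *
   (if i == j then (digits n (t i) != digits n (x i))%:R else 1).
have F0 j i t : 0 <= F j i t.
  by rewrite mulr_ge0 ?fejer_ge0//; case: ifP.
have mF j i : measurable_fun setT (F j i).
  apply: measurable_funM; first exact: measurable_fejer_sub.
  by case: eqP => _ //; exact: measurable_digits_neq.
have le1 t : kern p N x t * (off_cell p n x t)%:R <= \sum_(j < p) \prod_(i < p) F j i t.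
  have s0 j : 0 <= \prod_(i < p) F j i t by apply: prodr_ge0.
  rewrite /off_cell; case: existsP => [[j jn]|_]; last by rewrite mulr0 sumr_ge0.
  rewrite mulr1 (bigD1 j)//= -[leLHS]addr0 lerD ?sumr_ge0//.
  rewrite le_eqVlt; apply/orP; left; apply/eqP; apply: eq_bigr => i _.
  rewrite /F; case: eqP => [/val_inj ->|]; last by rewrite mulr1.
  by rewrite jn mulr1.
apply: (@le_trans _ _ (\int[P]_t \sum_(j < p) (\prod_(i < p) F j i t)%:E)%E).
  apply: ge0_le_integral => //.
  - by move=> t _; rewrite lee_fin mulr_ge0// kern_ge0.
  - apply/measurable_EFinP; apply: measurable_funM; first exact: measurable_kern.
    exact: measurable_off_cell.
  - by apply: emeasurable_sum => j; apply/measurable_EFinP; apply: measurable_prod.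
  - by move=> t _; rewrite sumEFin lee_fin.
rewrite ge0_integral_sum//; last 2 first.
- by move=> j; apply/measurable_EFinP; apply: measurable_prod.
- by move=> j t _; rewrite lee_fin prodr_ge0.
rewrite -sumEFin; apply: lee_sum => j _.
under eq_integral do rewrite -prodEFin.
rewrite (@integral_prod_coord _ _ hP p (fun i (t : X) => (F j i t)%:E)); last 3 first.
- by move=> i; apply/measurable_EFinP.
- by move=> i t; rewrite lee_fin.
- by move=> i s t; rewrite /F => ->.
apply: (@le_trans _ _ (\prod_(i < p) (if i == j then B j / (N j).+1%:R else 1)%:E)%E); last first.
  rewrite prodEFin lee_fin (bigD1 j)//= eqxx big1; last by move=> i /negbTE ->.
  rewrite mulr1 ler_wpM2r// (bigD1 j)//= lerDl sumr_ge0//.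
apply: (@proj2 (0 <= \prod_(i < p) (\int[P]_t (F j i t)%:E))%E).
elim/big_ind2: _ => //.
  move=> a b c e [a0 ab] [c0 ce]; split; first exact: mule_ge0.
  exact: lee_pmul.
move=> i _; split; first by apply: integral_ge0 => t _; rewrite lee_fin.
case: eqP => [->|ij].
  rewrite -[leRHS](integral_prob_cst P); apply: ge0_le_integral => //.
  - by move=> t _; rewrite lee_fin.
  - by apply/measurable_EFinP.
  - move=> t _; rewrite lee_fin /F eqxx.
    case: eqP => //=; rewrite ?mulr0 ?divr_ge0// => /eqP H.
    by rewrite mulr1; have [_] := HB j; apply.
rewrite /F (_ : (nat_of_ord i == j) = false); last by apply/eqP => /val_inj.
under eq_integral do rewrite mulr1.
by rewrite integral_fejer.
Qed.

Definition keep_level p (i : nat) : option nat := if (i < p)%N then None else Some 0%N.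
(** The first p coordinates are kept and the others redrawn: the mean is the
conditional expectation given the first p coordinates. *)
Definition keep p : X * X -> X := resample (keep_level p) (fun=> 0).

Lemma keepE p x y i : keep p (x, y) i = if (i < p)%N then x i else y i.
Proof.
rewrite /keep /resample /keep_level/=; case: ifP => //= _.
by rewrite redraw0 subr0.
Qed.

Lemma nested_keep : nested_resamplings P keep.
Proof.
apply: (nested_resample hP (l := keep_level)) => m n i mn; rewrite /keep_level.
by case: (ltnP i m) => im; [rewrite (leq_trans im mn)|case: ifP].
Qed.

Lemma measurable_keep p : measurable_fun setT (keep p).
Proof. exact: measurable_resample. Qed.

Section dyadic.
Variables (n : nat) (g : X -> R) (M : R).
Hypotheses (mg : measurable_fun setT g) (gM : forall x, 0 <= g x <= M) (gn : dyadic_fun n g).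

Let mG : measurable_fun setT (EFin \o g). Proof. exact/measurable_EFinP. Qed.
Let G0 x : (0 <= (EFin \o g) x)%E. Proof. by rewrite lee_fin; have /andP[] := gM x. Qed.

Lemma cond_mean_dyadic p x : (n <= p)%N -> cond_mean P (keep p) (EFin \o g) x = (g x)%:E.
Proof.
move=> np; rewrite -[RHS](integral_prob_cst P); apply: eq_integral => y _ /=.
congr EFin; apply: (dyadic_fun_digits gn) => i ni.
by rewrite keepE (leq_trans ni np).
Qed.

Let M0 : 0 <= M. Proof. by have /andP[] := gM point; exact: le_trans. Qed.

Lemma cond_mean_bound p x : (cond_mean P (keep p) (EFin \o g) x <= M%:E)%E.
Proof.
rewrite -[leRHS](integral_prob_cst P); apply: ge0_le_integral => //.
- exact: (measurable_section x (measurable_keep p) mG).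
- by move=> y _; rewrite lee_fin; have /andP[] := gM (keep p (x, y)).
Qed.

Lemma cond_mean_off_cell p x t : (cond_mean P (keep p) (EFin \o g) t <=
  cond_mean P (keep p) (EFin \o g) x + (M * (off_cell p n x t)%:R)%:E)%E.
Proof.
have [xt|/existsPn xt] := boolP (off_cell p n x t).
  rewrite mulr1 -[leLHS]add0e leeD ?cond_mean_bound//; exact: cond_mean_ge0.
rewrite mulr0 adde0 le_eqVlt; apply/orP; left; apply/eqP.
apply: eq_integral => y _ /=; congr EFin; apply: (dyadic_fun_digits gn) => i ni.
rewrite !keepE; case: ltnP => // ip.
by have /negPn/eqP := xt (Ordinal ip).
Qed.

Lemma off_cell_sym p x t : off_cell p n x t = off_cell p n t x.
Proof. by rewrite /off_cell; apply: eq_existsb => j; rewrite eq_sym. Qed.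

(** The kernel depends on t through its first p coordinates. *)
Lemma fejer_int_keep p N x :
  (\int[P]_t ((kern p N x t)%:E * cond_mean P (keep p) (EFin \o g) t) =
   fejer_int P p N (EFin \o g) x)%E.
Proof.
have [rP _] := nested_keep.
apply: integral_cond_mean_pull => //.
- by apply/measurable_EFinP; exact: measurable_kern.
- by move=> t; rewrite lee_fin kern_ge0.
- move=> s t; congr EFin; apply: eq_bigr => j _; by rewrite keepE ltn_ord.
Qed.

(** The conditional mean is constant on the cell of x, and the kernel has little
mass outside that cell. *)
Lemma fejer_int_dyadic p x : (forall i, ~ on_boundary n (x i)) ->
  exists2 B : R, 0 <= B & forall N,
    (fejer_int P p N (EFin \o g) x <= cond_mean P (keep p) (EFin \o g) x + (\sum_(j < p) B / (N j).+1%:R)%:E)%E /\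
    (cond_mean P (keep p) (EFin \o g) x <= fejer_int P p N (EFin \o g) x + (\sum_(j < p) B / (N j).+1%:R)%:E)%E.
Proof.
move=> xb; have [B B0 HB] := kern_off_cell p xb.
exists (M * B); first by rewrite mulr_ge0.
move=> N; have -> : \sum_(j < p) M * B / (N j).+1%:R = M * \sum_(j < p) B / (N j).+1%:R.
  by rewrite mulr_sumr; apply: eq_bigr => j _; rewrite mulrA.
rewrite -fejer_int_keep; set E := cond_mean P (keep p) (EFin \o g).
have E0 t : (0 <= E t)%E by exact: cond_mean_ge0.
have mE : measurable_fun setT E.
  by apply: measurable_cond_mean => //; exact: measurable_keep.
have mk : measurable_fun setT (fun t => (kern p N x t)%:E).
  by apply/measurable_EFinP; exact: measurable_kern.
have mo : measurable_fun setT (fun t => (kern p N x t * (off_cell p n x t)%:R)%:E).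
  apply/measurable_EFinP; apply: measurable_funM; first exact: measurable_kern.
  exact: measurable_off_cell.
have k0 t : (0 <= (kern p N x t)%:E)%E by rewrite lee_fin kern_ge0.
have o0 t : (0 <= (kern p N x t * (off_cell p n x t)%:R)%:E)%E by rewrite lee_fin mulr_ge0 ?kern_ge0.
have Hmain (a b : X -> \bar R) : measurable_fun setT a -> measurable_fun setT b ->
    (forall t, 0 <= a t)%E -> (forall t, 0 <= b t)%E ->
    (forall t, (a t <= b t + (M * (off_cell p n x t)%:R)%:E)%E) ->
    (\int[P]_t ((kern p N x t)%:E * a t) <= \int[P]_t ((kern p N x t)%:E * b t) +
       (M * \sum_(j < p) B / (N j).+1%:R)%:E)%E.
  move=> ma mb a0 b0 ab.
  apply: (@le_trans _ _ (\int[P]_t ((kern p N x t)%:E * b t + M%:E * (kern p N x t * (off_cell p n x t)%:R)%:E))%E).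
    apply: ge0_le_integral => //.
    - by move=> t _; exact: mule_ge0.
    - exact: emeasurable_funM.
    - by apply: emeasurable_funD; [exact: emeasurable_funM|exact: measurable_funeM].
    - move=> t _; rewrite -EFinM mulrCA EFinM -ge0_muleDr//; last by rewrite lee_fin mulr_ge0.
      exact: lee_wpmul2l.
  rewrite ge0_integralD//; last 4 first.
  - by move=> t _; exact: mule_ge0.
  - exact: emeasurable_funM.
  - by move=> t _; rewrite mule_ge0.
  - exact: measurable_funeM.
  rewrite leeD2l// ge0_integralZl// EFinM; apply: lee_wpmul2l => //; exact: HB.
split.
  apply: le_trans (Hmain E (fun=> E x) _ _ _ _ _) _ => //.
    by move=> t; exact: cond_mean_off_cell.
  rewrite ge0_integralZr// integral_kern// mul1e//.
have {1}-> : E x = (\int[P]_t ((kern p N x t)%:E * E x))%E.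
  by rewrite ge0_integralZr// integral_kern// mul1e.
apply: Hmain => // t; rewrite off_cell_sym; exact: cond_mean_off_cell.
Qed.

End dyadic.

(** Intersecting covers of measure 1 / (k + 1) gives a measurable null cover. *)
Lemma negligible_small (A : set X) :
  (forall delta : R, 0 < delta -> exists W, [/\ measurable W, (P W <= delta%:E)%E & A `<=` W]) ->
  P.-negligible A.
Proof.
move=> H.
have H2 k : exists W, [/\ measurable W, (P W <= (k.+1%:R^-1)%:E)%E & A `<=` W].
  by apply: H; rewrite invr_gt0.
have [W HW] := choice H2.
have mW : measurable (\bigcap_k W k) by apply: bigcapT_measurable => k; have [] := HW k.
exists (\bigcap_k W k); split => //; last by move=> x Ax k _; have [_ _] := HW k; apply.
apply/eqP; rewrite eq_le measure_ge0 andbT; apply/lee_addgt0Pr => e e0; rewrite add0e.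
have [k ke] : exists k : nat, k.+1%:R^-1 <= e.
  exists (Num.truncn e^-1); rewrite invf_ple ?posrE ?invr_gt0//.
  by rewrite ltW// truncnS_gt.
have [mWk HWk _] := HW k.
apply: (@le_trans _ _ (P (W k))); first by apply: le_measure; rewrite ?inE// => x; apply.
by apply: le_trans HWk _; rewrite lee_fin.
Qed.

Section almost_everywhere.
Variables (kappa : nat -> nat) (d : nat).
Hypothesis kappa_lt : forall i, (kappa i < d.+1)%N.

Definition eps_close (eps : R) (a b : \bar R) := (a <= b + eps%:E)%E /\ (b <= a + eps%:E)%E.

(** This is convergence up to eps, for one p and one ratio bound C.  The last
clause is the convergence of the limits as p grows. *)
Definition eps_limits p (C eps : R) (U : X -> \bar R) (x : X) :=
  [/\ (cond_mean P (keep p) U x < +oo)%E,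
   exists n0, forall N, (forall j, (j < p)%N -> (n0 <= N j)%N) -> regular_index kappa p C N ->
     eps_close eps (fejer_int P p N U x) (cond_mean P (keep p) U x) &
   exists p0, forall q, (p0 <= q)%N -> eps_close eps (cond_mean P (keep q) U x) (U x)].

(** Outside a set of measure delta, the Fejer means, the conditional means and
the values of h = |u - g| are all at most eps / 3, and the claim for u follows
from that for g. *)
Lemma eps_limits_negligible p (C eps : R) (u : X -> R) : 1 <= C -> 0 < eps ->
  measurable_fun setT u -> (forall x, 0 <= u x) -> approximable P d u ->
  P.-negligible (~` [set x | eps_limits p C eps (EFin \o u) x]).
Proof.
move=> C1 eps0 mu u0 apx; apply: negligible_small => delta delta0.
have [cf c0] := @iter_const_fin R d.
pose k0 : R := fine (iter_const d) + 1.
have k00 : 0 < k0 by rewrite ltr_wpDl// fine_ge0.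
pose K : R := ((2 * C + 72) * 6) ^+ p.
have K1 : 1 <= K by apply: exprn_ege1; lra.
have K0 : 0 < K := lt_le_trans ltr01 K1.
(* lam makes the exceptional sets small; c is then such that K * lam / c = eps / 3. *)
have [lam l0 lamE] : exists2 lam : R, 0 < lam & lam^-1 * (8 ^+ p * k0 + (2 + 2)) = delta.
  have s0 : 0 < 8 ^+ p * k0 + (2 + 2) by rewrite !addr_gt0// mulr_gt0// exprn_gt0.
  by exists ((8 ^+ p * k0 + (2 + 2)) / delta); rewrite ?divr_gt0// invf_div divfK// gt_eqF.
have [c cc0 cE] : exists2 c : R, 0 < c &
    forall T, (0 <= T -> c%:E * T <= (K * lam)%:E -> T <= (eps / 3)%:E)%E.
  have Kl0 : 0 < K * lam by rewrite mulr_gt0.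
  exists (K * lam * (3 / eps)); first by rewrite mulr_gt0// divr_gt0.
  move=> T T0.
  have -> : (eps / 3)%:E = ((K * lam * (3 / eps))^-1%:E * (K * lam)%:E)%E.
    by rewrite -EFinM invfM invf_div mulrAC mulVf ?mul1r// gt_eqF.
  by rewrite lee_pdivlMl// mulr_gt0// divr_gt0.
have lK : (lam%:E <= (K * lam)%:E)%E by rewrite lee_fin ler_peMl// ltW.
have [n [g [M [mg gM gn Hh]]]] := apx c 1 cc0 ltr01.
pose h x := `|u x - g x|.
have h0 x : 0 <= h x by rewrite normr_ge0.
have mh : measurable_fun setT h.
  by apply: measurableT_comp => //; exact: measurable_funB.
have g0 x : 0 <= g x by have /andP[] := gM x.
pose F (x : X) : \bar R := (c * h x)%:E.
have mF : measurable_fun setT F by apply/measurable_EFinP; exact: measurable_funM.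
have F0 x : (0 <= F x)%E by rewrite lee_fin mulr_ge0// ltW.
have iF : (\int[P]_x F x <= 2%:E)%E.
  apply: (@le_trans _ _ (\int[P]_x (1 + orlicz d (F x)))%E).
    apply: ge0_le_integral => //.
    - by apply: emeasurable_funD => //; exact: measurable_orlicz.
    - by move=> x _; exact: le1Dorlicz.
  rewrite ge0_integralD//; last 2 first.
  - by move=> x _; exact: orlicz_ge0.
  - exact: measurable_orlicz.
  by rewrite integral_prob_cst (_ : 2 = 1 + 1)// EFinD leeD2l.
(* The Fejer means of c h exceed K * lam, and its conditional means and values exceed lam, on small sets. *)
have [W1 [mW1 PW1 HW1]] := regular_fejer_maximal hP p mF F0 kappa_lt l0.
have [rk nk] := nested_keep.
pose W2 := [set x | (lam%:E < maximal P keep F x)%E].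
have mW2 : measurable W2 by apply: measurable_superlevel; exact: measurable_maximal.
have PW2 : (lam%:E * P W2 <= 2%:E)%E := le_trans (maximal_weak rk nk mF F0 l0) iF.
pose W3 := [set x | (lam%:E < F x)%E].
have mW3 : measurable W3 by exact: measurable_superlevel.
have PW3 : (lam%:E * P W3 <= 2%:E)%E.
  apply: le_trans iF; have H := le_integral_abse P measurableT mF l0.
  apply: le_trans (le_trans H _).
    apply: lee_wpmul2l; first by rewrite lee_fin ltW.
    rewrite (_ : [set x | _] = [set x | lam%:E <= F x]%E); last first.
      by apply/funext => x; rewrite /mkset gee0_abs.
    have mF' := emeasurable_fun_c_infty measurableT mF lam%:E.
    apply: le_measure; rewrite ?inE//.
    by move=> x Wx; split => //=; rewrite ltW.
  by rewrite le_eqVlt; apply/orP; left; apply/eqP; apply: eq_integral => x _; rewrite gee0_abs.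
(* Last, the end points of the dyadic intervals of the scale of g. *)
have [W4 [mW4 PW4 HW4]] := boundary_null n.
exists (W1 `|` (W2 `|` (W3 `|` W4))); split.
- by do !apply: measurableU.
- have PW (W : set X) : (lam%:E * P W <= 2%:E -> P W <= (lam^-1 * 2)%:E)%E.
    by rewrite (_ : (lam^-1 * 2)%:E = lam^-1%:E * 2%:E)%E// lee_pdivlMl.
  apply: le_trans (measureU2 _ _ _) _ => //; first by do !apply: measurableU.
  apply: (@le_trans _ _ ((lam^-1 * (8 ^+ p * k0))%:E + ((lam^-1 * 2)%:E + ((lam^-1 * 2)%:E + 0)))%E).
    apply: leeD.
      apply: le_trans PW1 _; rewrite mulrA [leRHS]EFinM; apply: lee_wpmul2l.
        by rewrite lee_fin mulr_ge0 ?exprn_ge0// invr_ge0 ltW.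
      by rewrite -(fineK cf) EFinD leeD2l.
    apply: le_trans (measureU2 _ _ _) _ => //; first by do !apply: measurableU.
    apply: leeD; first exact: PW.
    apply: le_trans (measureU2 _ _ _) _ => //.
    by apply: leeD; [exact: PW|rewrite -PW4].
  by rewrite adde0 -!EFinD lee_fin -!mulrDr lamE.
move=> x; apply: contra_notP => /not_orP[xW1 /not_orP[xW2 /not_orP[xW3 xW4]]].
pose U := EFin \o u; pose G := EFin \o g; pose H := EFin \o h.
have mU : measurable_fun setT U by exact/measurable_EFinP.
have mG : measurable_fun setT G by exact/measurable_EFinP.
have mH : measurable_fun setT H by exact/measurable_EFinP.
have U0 y : (0 <= U y)%E by rewrite lee_fin.
have G0 y : (0 <= G y)%E by rewrite lee_fin.
have H0 y : (0 <= H y)%E by rewrite lee_fin.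
have UGH y : (U y <= G y + H y)%E.
  by rewrite lee_fin -lerBlDl ler_norm.
have GUH y : (G y <= U y + H y)%E.
  by rewrite lee_fin -lerBlDl /h distrC ler_norm.
have HF : F = fun y => (c%:E * H y)%E by apply/funext => y; rewrite -EFinM.
have TH N : regular_index kappa p C N -> (fejer_int P p N H x <= (eps / 3)%:E)%E.
  move=> rN; apply: cE.
    by apply: integral_ge0 => t _; rewrite mule_ge0// lee_fin kern_ge0.
  have := HW1 x xW1 C N C1 rN; rewrite /fejer_int HF -/K.
  under eq_integral do rewrite muleCA.
  rewrite ge0_integralZl// ?lee_fin ?ltW//.
  - by apply: emeasurable_funM => //; apply/measurable_EFinP; exact: measurable_kern.
  - by move=> t _; rewrite mule_ge0// lee_fin kern_ge0.
have mk q : measurable_fun setT (fun y => H (keep q (x, y))).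
  exact: (measurable_section x (measurable_keep q) mH).
have EH q : (cond_mean P (keep q) H x <= (eps / 3)%:E)%E.
  apply: cE; first exact: cond_mean_ge0.
  apply: le_trans lK; move/negP: xW2; rewrite -leNgt; apply: le_trans.
  apply: le_trans (cond_mean_le_maximal P keep F q x).
  by rewrite HF /cond_mean ge0_integralZl// lee_fin ltW.
have hx : (H x <= (eps / 3)%:E)%E.
  apply: cE => //; apply: le_trans lK; move/negP: xW3; rewrite -leNgt HF; exact.
have EUGH q (A B : X -> \bar R) : measurable_fun setT A -> measurable_fun setT B ->
    (forall y, 0 <= A y)%E -> (forall y, 0 <= B y)%E -> (forall y, A y <= B y + H y)%E ->
    (cond_mean P (keep q) A x <= cond_mean P (keep q) B x + (eps / 3)%:E)%E.
  move=> mA mB A0 B0 AB; apply: le_trans (leeD2l _ (EH q)).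
  rewrite /cond_mean -ge0_integralD//; last exact: (measurable_section x (measurable_keep q) mB).
  apply: ge0_le_integral => //.
  - exact: (measurable_section x (measurable_keep q) mA).
  - by apply: emeasurable_funD => //; exact: (measurable_section x (measurable_keep q) mB).
have TUGH N (A B : X -> \bar R) : regular_index kappa p C N ->
    measurable_fun setT A -> measurable_fun setT B ->
    (forall y, 0 <= A y)%E -> (forall y, 0 <= B y)%E -> (forall y, A y <= B y + H y)%E ->
    (fejer_int P p N A x <= fejer_int P p N B x + (eps / 3)%:E)%E.
  move=> rN mA mB A0 B0 AB; apply: le_trans (leeD2l _ (TH N rN)).
  have mkN : measurable_fun setT (fun t => (kern p N x t)%:E).
    by apply/measurable_EFinP; exact: measurable_kern.
  have k0' t : (0 <= (kern p N x t)%:E)%E by rewrite lee_fin kern_ge0.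
  rewrite /fejer_int -ge0_integralD//; last 4 first.
  - by move=> t _; exact: mule_ge0.
  - exact: emeasurable_funM.
  - by move=> t _; exact: mule_ge0.
  - exact: emeasurable_funM.
  apply: ge0_le_integral => //.
  - by move=> t _; exact: mule_ge0.
  - exact: emeasurable_funM.
  - by apply: emeasurable_funD; exact: emeasurable_funM.
  - by move=> t _; rewrite -ge0_muleDr//; exact: lee_wpmul2l.
have e3 : (eps%:E = (eps / 3)%:E + (eps / 3)%:E + (eps / 3)%:E)%E.
  by rewrite -!EFinD; congr EFin; field.
split.
- apply: (le_lt_trans (EUGH p U G mU mG U0 G0 UGH)).
  apply: (@le_lt_trans _ _ (M%:E + (eps / 3)%:E)%E); last by rewrite -EFinD ltry.
  by rewrite leeD2r//; exact: (cond_mean_bound mg gM).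
- have [B B0 HB] := fejer_int_dyadic mg gM gn p (HW4 x xW4).
  pose n0 := Num.truncn (p%:R * B * (3 / eps)).
  exists n0 => N Nn0 rN.
  have sB : \sum_(j < p) B / (N j).+1%:R <= eps / 3.
    have [->|p0] := posnP p; first by rewrite big_ord0 divr_ge0// ltW.
    apply: (@le_trans _ _ (\sum_(j < p) (eps / 3) / p%:R)).
      apply: ler_sum => j _; rewrite ler_pdivrMr//.
      have -> : B = eps / 3 / p%:R * (p%:R * B * (3 / eps)).
        by field; rewrite pnatr_eq0 -lt0n p0 gt_eqF.
      have e3p : 0 <= eps / 3 / p%:R by rewrite !divr_ge0// ltW.
      rewrite ler_wpM2l//; apply: (le_trans (ltW (truncnS_gt _))).
      by rewrite ler_nat ltnS Nn0.
    by rewrite sumr_const card_ord -[leLHS]mulr_natr divfK// pnatr_eq0 -lt0n.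
  have sB' : ((\sum_(j < p) B / (N j).+1%:R)%:E <= (eps / 3)%:E)%E by rewrite lee_fin.
  have [H1 H2] := HB N; rewrite /eps_close e3 !addeA; split.
    apply: (le_trans (TUGH N U G rN mU mG U0 G0 UGH)); rewrite leeD2r//.
    apply: (le_trans H1); apply: leeD => //.
    exact: EUGH.
  apply: (le_trans (EUGH p U G mU mG U0 G0 UGH)); rewrite leeD2r//.
  apply: (le_trans H2); apply: leeD => //.
  exact: TUGH.
- exists n => q nq; rewrite /eps_close.
  have Eg : cond_mean P (keep q) G x = G x by exact: cond_mean_dyadic.
  have e0 : (0 <= (eps / 3)%:E)%E by rewrite lee_fin divr_ge0// ltW.
  rewrite e3 !addeA; split; apply: le_trans (leeDl _ e0).
    apply: (le_trans (EUGH q U G mU mG U0 G0 UGH)); rewrite leeD2r// Eg.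
    by apply: (le_trans (GUH x)); rewrite leeD2l.
  apply: (le_trans (UGH x)); apply: leeD => //.
  rewrite -Eg; exact: EUGH.
Qed.

End almost_everywhere.

End convergence.

(** * Almost everywhere convergence for nonnegative functions *)

Section real_limits.
Context {R : realType}.
Local Notation X := (torus R).
Variable P : probability X R.
Hypothesis hP : is_product_measure P.
Variables (kappa : nat -> nat) (d : nat).
Hypothesis kappa_lt : forall i, (kappa i < d.+1)%N.

Definition fejer_limits (u : X -> R) (s : nat -> R) (x : X) :=
  (forall p (C : R), 1 <= C -> forall eps : R, 0 < eps -> exists n0, forall N,
     (forall j, (j < p)%N -> (n0 <= N j)%N) -> regular_index kappa p C N ->
     fejer_int P p N (EFin \o u) x \is a fin_num /\
     `|fine (fejer_int P p N (EFin \o u) x) - s p| <= eps) /\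
  (forall eps : R, 0 < eps -> exists p0, forall q, (p0 <= q)%N -> `|s q - u x| <= eps).

Lemma eps_close_fine (eps r : R) (a : \bar R) : (0 <= a)%E -> eps_close eps a r%:E ->
  a \is a fin_num /\ `|fine a - r| <= eps.
Proof.
case: a => [a||] a0 [] //=; rewrite -?EFinD ?lee_fin => h1 h2; split => //.
by rewrite ler_distl; apply/andP; split; lra.
Qed.

(** Countably many p, integers C and eps = 1 / (k + 1) are enough. *)
Lemma fejer_limits_negligible (u : X -> R) :
  measurable_fun setT u -> (forall x, 0 <= u x) -> approximable P d u ->
  P.-negligible (~` [set x | exists s, fejer_limits u s x]).
Proof.
move=> mu u0 apx.
pose A p c k := ~` [set x | eps_limits P kappa p c.+1%:R k.+1%:R^-1 (EFin \o u) x].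
apply: (@negligibleS _ _ _ _ (\bigcup_p \bigcup_c \bigcup_k A p c k)); last first.
  do 3 (apply: negligible_bigcup => ?).
  by apply: eps_limits_negligible => //; rewrite ?ler1n ?invr_gt0.
move=> x; apply: contra_notP => xA.
have H p c k : eps_limits P kappa p c.+1%:R k.+1%:R^-1 (EFin \o u) x.
  by apply: contrapT => nH; apply: xA; exists p => //; exists c => //; exists k.
pose E p := cond_mean P (keep p) (EFin \o u) x.
have U0 y : (0 <= (EFin \o u) y)%E by rewrite lee_fin.
have E0 p : (0 <= E p)%E by exact: cond_mean_ge0.
have Ef p : E p \is a fin_num.
  by rewrite ge0_fin_numE//; have [] := H p 0%N 0%N.
have small (eps : R) : 0 < eps -> exists k : nat, k.+1%:R^-1 <= eps.
  move=> e0; exists (Num.truncn eps^-1); rewrite invf_ple ?posrE ?invr_gt0//.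
  by rewrite ltW// truncnS_gt.
have weaken (e1 e2 : R) a b : e1 <= e2 -> eps_close e1 a b -> eps_close e2 a b.
  move=> e12 [h1 h2]; split; [apply: le_trans h1 _|apply: le_trans h2 _];
    by rewrite leeD2l// lee_fin.
exists (fun p => fine (E p)); split.
- move=> p C C1 eps /small[k ke].
  pose c := Num.truncn C; have [_ [n0 Hn0] _] := H p c k.
  exists n0 => N Nn0 rN; apply: eps_close_fine.
    by apply: integral_ge0 => t _; rewrite mule_ge0// lee_fin kern_ge0.
  rewrite fineK//; apply: weaken ke _; apply: Hn0 => // i j ip jp ij.
  apply: le_trans (rN i j ip jp ij) _; rewrite ler_wpM2r//.
  by rewrite ltW// truncnS_gt.
- move=> eps /small[k ke]; have [_ _ [p0 Hp0]] := H 0%N 0%N k.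
  exists p0 => q pq; have [] := eps_close_fine (E0 q) (weaken _ _ _ _ ke (Hp0 q pq)).
  by move=> _.
Qed.

End real_limits.

(** * Complex functions *)

Section complex_limits.
Context {R : realType}.

Lemma complex_cvg T (F : set_system T) {FF : Filter F} (g : T -> R[i]^o) (l : R[i]^o) :
  (forall eps : R, 0 < eps -> \forall t \near F,
     `|complex.Re (g t) - complex.Re l| <= eps /\ `|complex.Im (g t) - complex.Im l| <= eps) ->
  g t @[t --> F] --> l.
Proof.
move=> H; apply/cvgrPdist_lt => e e0.
have [eR e1] : e = (complex.Re e)%:C /\ 0 < complex.Re e.
  by case: e e0 => a b; rewrite ltcE/= => /andP[/eqP -> ->].
have e4 : 0 < complex.Re e / 4 by rewrite divr_gt0.
apply: filterS (H _ e4) => t [h1 h2].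
rewrite eR distrC normc_def ltcR.
set a := complex.Re (g t - l); set b := complex.Im (g t - l).
have ha : `|a| <= complex.Re e / 4 by rewrite /a raddfB.
have hb : `|b| <= complex.Re e / 4 by rewrite /b raddfB.
rewrite -(ltr_pXn2r (n := 2)) ?nnegrE ?sqrtr_ge0 ?ltW// sqr_sqrtr ?addr_ge0 ?sqr_ge0//.
rewrite -(real_normK (num_real a)) -(real_normK (num_real b)).
have := normr_ge0 a; have := normr_ge0 b; nra.
Qed.

Lemma prod_fejer_kernel p (N : nat -> nat) (x t : torus R) (z : R[i]^o) :
  (\prod_(j < p) fejer_kernel (N j) (x j - t j)) * z =
  (kern p N x t * complex.Re z) +i* (kern p N x t * complex.Im z).
Proof.
have -> : \prod_(j < p) fejer_kernel (N j) (x j - t j) = (kern p N x t)%:C.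
  rewrite /kern; elim/big_ind2: _ => // [a b c e -> ->|j _]; last exact: fejer_kernelE.
  by rewrite rmorphM.
by case: z => a b; congr (_ +i* _); rewrite /= mul0r ?subr0 ?addr0.
Qed.

Lemma regular_filter_filter D (J : 'I_D -> set nat) p (C : R) : Filter (regular_filter J p C).
Proof.
apply: filter_from_filter; first by exists 0%N.
move=> i j _ _; exists (maxn i j) => // N [h1 h2]; split; split => // k.
  exact: leq_trans (leq_maxl _ _) (h1 k).
exact: leq_trans (leq_maxr _ _) (h1 k).
Qed.

Local Notation X := (torus R).
Variable P : probability X R.
Hypothesis hP : is_product_measure P.

Lemma fine_fejer_intB p N (u v : X -> R) x :
  measurable_fun setT u -> measurable_fun setT v -> (forall y, 0 <= u y) -> (forall y, 0 <= v y) ->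
  fejer_int P p N (EFin \o u) x \is a fin_num -> fejer_int P p N (EFin \o v) x \is a fin_num ->
  \int[P]_t (kern p N x t * (u t - v t)) =
  fine (fejer_int P p N (EFin \o u) x) - fine (fejer_int P p N (EFin \o v) x).
Proof.
move=> mu mv u0 v0 fu fv.
have I (w : X -> R) : measurable_fun setT w -> (forall y, 0 <= w y) ->
    fejer_int P p N (EFin \o w) x \is a fin_num ->
    P.-integrable setT (EFin \o (fun t => kern p N x t * w t)).
  move=> mw w0 fw; apply/integrableP; split.
    by apply/measurable_EFinP; apply: measurable_funM => //; exact: measurable_kern.
  rewrite (eq_integral (fun t => (kern p N x t)%:E * (EFin \o w) t)%E).
    by rewrite -ge0_fin_numE//; apply: integral_ge0 => t _; rewrite mule_ge0// lee_fin ?kern_ge0.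
  by move=> t _ /=; rewrite -EFinM ger0_norm// mulr_ge0// kern_ge0.
under eq_Rintegral do rewrite mulrBr.
by rewrite RintegralB//; exact: I.
Qed.

Section main.
Variables (kappa : nat -> nat) (d : nat).
Hypothesis kappa_lt : forall i, (kappa i < d.+1)%N.
Variable f : X -> R[i]^o.
Hypothesis hf : LlogL P d f.

Let pos (w : X -> R) (x : X) : R := Num.max (w x) 0.

(** The positive part of w is bounded by |f|. *)
Lemma part_limits (w : X -> R) : measurable_fun setT w -> (forall x, `|w x| <= normc (f x)) ->
  P.-negligible (~` [set x | exists s, fejer_limits P kappa (pos w) s x]).
Proof.
move=> mw wf.
have mp : measurable_fun setT (pos w) by exact: measurable_maxr.
have p0 x : 0 <= pos w x by rewrite le_max lexx orbT.
apply: (fejer_limits_negligible hP (d := d)) => //.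
apply: approximable_orlicz => // c c0.
have [B B0 HB] := orlicz_le_LlogL d c0.
have [[mRe mIm] fin] := hf.
have n0 x : 0 <= normc (f x) by case: (f x) => a b; exact: sqrtr_ge0.
have mn : measurable_fun setT (fun x => normc (f x)).
  rewrite (_ : (fun x => _) = fun x => Num.sqrt (complex.Re (f x) ^+ 2 + complex.Im (f x) ^+ 2)); last first.
    by apply/funext => x; case: (f x).
  have msqrt : measurable_fun setT (@Num.sqrt R).
    by apply: continuous_measurable_fun => t; exact: sqrt_continuous.
  apply: (measurableT_comp msqrt).
  by apply: measurable_funD; exact: measurable_funX.
have ln0 (t : R) : 0 <= t -> 0 <= ln (t + 1) by move=> t0; rewrite ln_ge0// lerDr.
pose L x := normc (f x) * ln (normc (f x) + 1) ^+ d.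
have L0 x : 0 <= L x by rewrite mulr_ge0// exprn_ge0// ln0.
have mL : measurable_fun setT L.
  apply: measurable_funM => //; apply: measurable_funX.
  by apply: (measurableT_comp (@measurable_ln R)); exact: measurable_funD.
apply: (@le_lt_trans _ _ (\int[P]_x (B%:E * (1 + (L x)%:E)))%E).
  apply: ge0_le_integral => //.
  - by move=> x _; rewrite orlicz_ge0// lee_fin mulr_ge0// ltW.
  - apply: measurable_orlicz; last by move=> x; rewrite lee_fin mulr_ge0// ltW.
    by apply/measurable_EFinP; exact: measurable_funM.
  - apply: measurable_funeM; apply: emeasurable_funD => //; exact/measurable_EFinP.
  - move=> x _; apply: le_trans (HB _ (p0 x)) _.
    rewrite -EFinD -EFinM lee_fin ler_wpM2l// lerD2l.
    have pw : pos w x <= normc (f x).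
      by rewrite ge_max n0 (le_trans (ler_norm _))// wf.
    rewrite ler_pM//; first by rewrite exprn_ge0// ln0.
    rewrite lerXn2r ?nnegrE ?ln0// ler_ln ?posrE ?lerD2r// ltr_wpDl//.
rewrite ge0_integralZl//; last 2 first.
- by apply: emeasurable_funD => //; exact/measurable_EFinP.
- by move=> x _; rewrite adde_ge0// lee_fin.
rewrite ge0_integralD//; last 2 first.
- by move=> x _; rewrite lee_fin.
- exact/measurable_EFinP.
rewrite integral_prob_cst lte_mul_pinfty//.
by rewrite lte_add_pinfty// ltry.
Qed.

Let posB (w : X -> R) x : pos w x - pos (fun y => - w y) x = w x.
Proof. by rewrite /pos; case: (leP (w x) 0); case: (leP (- w x) 0); lra. Qed.

(** Re f and Im f are differences of their positive and negative parts, and the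
kernel is real. *)
Lemma fejer_mean_ae :
  P.-negligible (~` [set x | exists s : nat -> R[i]^o,
    (forall p (C : R), 1 <= C -> forall eps : R, 0 < eps -> exists n0, forall N : nat -> nat,
       (forall j, (j < p)%N -> (n0 <= N j)%N) -> regular_index kappa p C N ->
       `|complex.Re (fejer_mean P f (fun j : 'I_p => N j) x) - complex.Re (s p)| <= eps /\
       `|complex.Im (fejer_mean P f (fun j : 'I_p => N j) x) - complex.Im (s p)| <= eps) /\
    s p @[p --> \oo] --> f x]).
Proof.
have [[mRe mIm] _] := hf.
pose re x := complex.Re (f x); pose im x := complex.Im (f x).
have normRe x : `|complex.Re (f x)| <= normc (f x) /\ `|complex.Im (f x)| <= normc (f x).
  case: (f x) => a b /=; split.
    by rewrite -(sqrtr_sqr a) ler_wsqrtr// lerDl sqr_ge0.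
  by rewrite -(sqrtr_sqr b) ler_wsqrtr// lerDr sqr_ge0.
have mRe' : measurable_fun setT (fun x => - re x) by exact: measurable_funN.
have mIm' : measurable_fun setT (fun x => - im x) by exact: measurable_funN.
have N1 := part_limits mRe (fun x => (normRe x).1).
have N2 : P.-negligible (~` [set x | exists s, fejer_limits P kappa (pos (fun x => - re x)) s x]).
  by apply: part_limits => // x; rewrite normrN; exact: (normRe x).1.
have N3 := part_limits mIm (fun x => (normRe x).2).
have N4 : P.-negligible (~` [set x | exists s, fejer_limits P kappa (pos (fun x => - im x)) s x]).
  by apply: part_limits => // x; rewrite normrN; exact: (normRe x).2.
have := negligibleU N1 (negligibleU N2 (negligibleU N3 N4)).
apply: negligibleS => x; rewrite -!setCI; apply: subsetC => {}x.
move=> [[s1 [a1 b1]] [[s2 [a2 b2]] [[s3 [a3 b3]] [s4 [a4 b4]]]]].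
exists (fun p => (s1 p - s2 p) +i* (s3 p - s4 p)); split.
- move=> p C C1 eps eps0; have e2 : 0 < eps / 2 by rewrite divr_gt0.
  have [n1 H1] := a1 p C C1 _ e2; have [n2 H2] := a2 p C C1 _ e2.
  have [n3 H3] := a3 p C C1 _ e2; have [n4 H4] := a4 p C C1 _ e2.
  exists (maxn (maxn n1 n2) (maxn n3 n4)) => N HN rN.
  have {}HN j : (j < p)%N -> [/\ (n1 <= N j)%N, (n2 <= N j)%N, (n3 <= N j)%N & (n4 <= N j)%N].
    by move=> /HN; rewrite !geq_max => /andP[/andP[-> ->] /andP[-> ->]].
  have [f1 {}H1] := H1 N (fun j jp => let: And4 h _ _ _ := HN j jp in h) rN.
  have [f2 {}H2] := H2 N (fun j jp => let: And4 _ h _ _ := HN j jp in h) rN.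
  have [f3 {}H3] := H3 N (fun j jp => let: And4 _ _ h _ := HN j jp in h) rN.
  have [f4 {}H4] := H4 N (fun j jp => let: And4 _ _ _ h := HN j jp in h) rN.
  have mpos w : measurable_fun setT w -> measurable_fun setT (pos w).
    by move=> mw; exact: measurable_maxr.
  have pos0 w y : 0 <= pos w y by rewrite le_max lexx orbT.
  rewrite /fejer_mean /complex_integral/=.
  have -> : \int[P]_t complex.Re ((\prod_(j < p) fejer_kernel (N j) (x j - t j)) * f t) =
     \int[P]_t (kern p N x t * (pos re t - pos (fun y => - re y) t)).
    by apply: eq_Rintegral => t _; rewrite prod_fejer_kernel posB.
  have -> : \int[P]_t complex.Im ((\prod_(j < p) fejer_kernel (N j) (x j - t j)) * f t) =
     \int[P]_t (kern p N x t * (pos im t - pos (fun y => - im y) t)).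
    by apply: eq_Rintegral => t _; rewrite prod_fejer_kernel posB.
  rewrite !fine_fejer_intB//; try exact: mpos.
  split.
    apply: le_trans (_ : eps / 2 + eps / 2 <= _); last lra.
    apply: le_trans (lerD H1 H2); rewrite -[X in _ <= _ + X]normrN.
    by apply: le_trans (ler_normD _ _); rewrite le_eqVlt; apply/orP; left; apply/eqP; congr `|_|; ring.
  apply: le_trans (_ : eps / 2 + eps / 2 <= _); last lra.
  apply: le_trans (lerD H3 H4); rewrite -[X in _ <= _ + X]normrN.
  by apply: le_trans (ler_normD _ _); rewrite le_eqVlt; apply/orP; left; apply/eqP; congr `|_|; ring.
- apply: complex_cvg => eps eps0; have e2 : 0 < eps / 2 by rewrite divr_gt0.
  have [n1 H1] := b1 _ e2; have [n2 H2] := b2 _ e2.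
  have [n3 H3] := b3 _ e2; have [n4 H4] := b4 _ e2.
  exists (maxn (maxn n1 n2) (maxn n3 n4)) => // q; rewrite /= !geq_max.
  move=> /andP[/andP[/H1 {}H1 /H2 {}H2] /andP[/H3 {}H3 /H4 {}H4]].
  split.
    apply: le_trans (_ : eps / 2 + eps / 2 <= _); last lra.
    rewrite -[complex.Re (f x)](posB re).
    apply: le_trans (lerD H1 H2); rewrite -[X in _ <= _ + X]normrN.
    by apply: le_trans (ler_normD _ _); rewrite le_eqVlt; apply/orP; left; apply/eqP; congr `|_|; ring.
  apply: le_trans (_ : eps / 2 + eps / 2 <= _); last lra.
  rewrite -[complex.Im (f x)](posB im).
  apply: le_trans (lerD H3 H4); rewrite -[X in _ <= _ + X]normrN.
  by apply: le_trans (ler_normD _ _); rewrite le_eqVlt; apply/orP; left; apply/eqP; congr `|_|; ring.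
Qed.

End main.
End complex_limits.

(** * The theorem *)

(** The proof that the total mass is 1 is an argument, so that the probability
instance can be inferred from the term. *)
Definition as_probability d (T : measurableType d) (R : realType)
  (m : {measure set T -> \bar R}) (m1 : m setT = 1%E) : set T -> \bar R := m.

Section as_probability.
Context d (T : measurableType d) (R : realType) (m : {measure set T -> \bar R}).
Hypothesis m1 : m setT = 1%E.

HB.instance Definition _ := isMeasure.Build _ _ _ (as_probability m1)
  (measure0 m) (measure_ge0 m) (@measure_semi_sigma_additive _ _ _ m).

HB.instance Definition _ := Measure_isProbability.Build _ _ _ (as_probability m1) m1.

End as_probability.

Lemma product_measure_prob (R : realType) (mu : {measure set (torus R) -> \bar R}) :
  is_product_measure mu -> exists P : probability (torus R) R, mu = P :> {measure set (torus R) -> \bar R}.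
Proof.
move=> hmu; have mu1 : mu setT = 1%E.
  have := hmu 0%N (fun=> setT) (fun=> measurableT); rewrite big_ord0 => <-.
  by congr (mu _); apply/seteqP; split.
pose P : probability (torus R) R := as_probability mu1.
by exists P; exact: eq_measure.
Qed.

Theorem mainTheorem3 (R : realType) (mu : {measure set (torus R) -> \bar R})
    (hmu : is_product_measure mu)
    (D : nat) (hD : (0 < D)%N)
    (J : 'I_D -> set nat) (hJ : partition [set: 'I_D] J [set: nat])
    (f : torus R -> R[i]^o) (hf : LlogL mu D.-1 f) :
  {ae mu, forall x : torus R,
    exists s : nat -> R[i]^o,
      (forall p : nat, (0 < p)%N -> forall C : R, 1 <= C ->
        fejer_mean mu f N x @[N --> regular_filter J p C] --> s p) /\
      s p @[p --> \oo] --> f x}.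
Proof.
have [P muP] := product_measure_prob hmu; subst mu.
case: D hD J hJ hf => // d _ J [JT _ _] hf.
have HJ i : exists k, J k i.
  by have : [set: nat] i by []; rewrite -JT => -[k _ Jk]; exists k.
have [K HK] := choice HJ.
pose kappa i := nat_of_ord (K i).
have kappa_lt i : (kappa i < d.+1)%N by exact: ltn_ord.
apply: negligibleS (fejer_mean_ae hmu kappa_lt hf); apply: subsetC => x [s [H1 H2]].
exists s; split; last exact: H2.
move=> p _ C C1.
apply: (@complex_cvg _ _ _ (regular_filter_filter J p C)) => eps eps0.
have [n0 Hn0] := H1 p C C1 eps eps0.
exists n0 => // N [HN rN].
have -> : N = fun j : 'I_p => extend 0%N N j by apply/funext => j; rewrite extendE.
apply: Hn0.
  by move=> j jp; rewrite (extendE _ _ (Ordinal jp)).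
move=> i j ip jp /val_inj Kij.
rewrite (extendE _ _ (Ordinal ip)) (extendE _ _ (Ordinal jp)).
by apply: (rN (K i)); [exact: HK|rewrite Kij; exact: HK].
Qed.
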